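(* Consider the risk process $X(t)=ct-\sum_{j=1}^{M_f(t)}Z_j$, $t\ge0$, where $c>0$ is the constant premium rate, $M_f(t)=M(D_f(t))$ is the time-changed generalized counting process-I with rates $\lambda_1,\dots,\lambda_k>0$, $\Lambda=\lambda_1+\cdots+\lambda_k$, and the claim sizes $\{Z_j\}_{j\ge1}$ are positive iid random variables with distribution $F$, independent of $\{M_f(t)\}_{t\ge0}$. For $y\ge0$, let $K(0,y)$ be the joint probability that, with zero initial capital, ruin occurs in finite time and the deficit at the time of ruin is not more than $y$. Then $$K(0,y)= \frac{f(\Lambda)}{c} \int_0^{y}\left(1-W(u)\right)\mathrm{d}u,$$ where $$W(x)=-\frac{1}{f(\Lambda)}\sum_{n=1}^{\infty} \sum_{\Omega(k,n)}f^{(z_{k})}(\Lambda)\left(\prod_{j=1}^{k}\frac{(-\lambda_{j})^{x_{j}}}{x_{j}!}\right)F^{*n}(x),\qquad z_k=x_1+\cdots+x_k.$$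
   Context: Generalized counting process (GCP): the Lévy process $\{M(t)\}_{t\ge0}$ with values in the non-negative integers, $M(0)=0$, and $\Pr\{M(t)=n\}=\sum_{\Omega(k,n)}\prod_{j=1}^{k}\frac{(\lambda_{j}t)^{x_{j}}}{x_{j}!}e^{-\Lambda t}$, $n\ge0$, where $\Omega(k,n)=\{(x_1,\dots,x_k): x_j\in\{0,1,2,\dots\},\ \sum_{j=1}^k jx_j=n\}$. $\{D_f(t)\}_{t\ge0}$ is a Lévy subordinator independent of $M$: a non-decreasing one-dimensional Lévy process with $\mathbb{E}(e^{-sD_f(t)})=e^{-tf(s)}$, $s>0$, where $f(s)=c_2s+\int_0^\infty(1-e^{-sx})\,\overline\nu(\mathrm{d}x)$ is a Bernstein function with $c_2\ge0$ and $\overline\nu$ a non-negative Lévy measure on $(0,\infty)$ satisfying $\int_0^\infty(x\wedge1)\,\overline\nu(\mathrm{d}x)<\infty$; so $f(0)=0$. $f^{(r)}$ denotes the $r$-th derivative of $f$. $F^{*n}$ is the distribution function of $Z_1+\cdots+Z_n$. The surplus process with initial capital $u\ge0$ is $U(t)=u+X(t)$, $t\ge0$; the time to ruin is $\tau=\inf\{t>0:U(t)<0\}$ (with $\inf\emptyset=\infty$); the deficit at the time of ruin is $D=|U(\tau)|$; and $K(u,y)=\Pr\{\tau<\infty,\ D\le y\}$, $y\ge0$.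
   Formalization: The net profit condition, that the expected total claims up to time 1 (the sum of Z_j for j up to M_f(1)) is at most c, is added; without it the right side exceeds 1 for large y, e.g. k=1, λ_1=1, f(s)=s, Z_j=1, c=1/10, y=1 gives 10. *)

(* Defs.v *)
From HB Require Import structures.
From mathcomp Require Import all_boot all_order all_algebra.
From mathcomp Require Import all_classical all_reals all_analysis.
Set Implicit Arguments.
Unset Strict Implicit.
Unset Printing Implicit Defensive.
Import Order.TTheory GRing.Theory Num.Theory.
Import numFieldNormedType.Exports.
Local Open Scope classical_set_scope.
Local Open Scope ring_scope.

Definition mutually_independent d d' (T : measurableType d)
    (T' : measurableType d') (R : realType) (P : probability T R)
    (I : eqType) (X : I -> T -> T') : Prop :=
  forall (s : seq I) (B : I -> set T'), uniq s ->
    (forall i, measurable (B i)) ->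
    P (\bigcap_(i in [set` s]) (X i @^-1` B i)) =
    (\prod_(i <- s) fine (P (X i @^-1` B i)))%:E.

(* sigma(X_i : i in J) *)
Definition sigma_family d d' (T : measurableType d) (T' : measurableType d')
    (I : Type) (J : set I) (X : I -> T -> T') : set (set T) :=
  <<s [set A | exists i, J i /\
         exists2 B, measurable B & A = X i @^-1` B] >>.

Definition independent_sigma d (T : measurableType d) (R : realType)
    (P : probability T R) (G H : set (set T)) : Prop :=
  forall A B, G A -> H B -> P (A `&` B) = (P A * P B)%E.

(* Right-continuity is required at every t >= 0, a left limit at every t > 0. *)
Definition cadlag (R : realType) (x : R -> R) : Prop :=
  (forall t, 0 <= t -> x s @[s --> t^'+] --> x t) /\
  (forall t, 0 < t -> exists l : R, x s @[s --> t^'-] --> l).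

(* Processes have time set [0, +oo[ ; their values at negative times are
   unconstrained. Sample paths are cadlag, and start at 0, for every w. *)
Definition levy_process d (T : measurableType d) (R : realType)
    (P : probability T R) (X : R -> T -> R) : Prop :=
  [/\ forall t, 0 <= t -> measurable_fun setT (X t),
      forall w, X 0 w = 0 /\ cadlag (X ^~ w),
      forall t : nat -> R, 0 <= t 0%N -> (forall n, t n <= t n.+1) ->
        mutually_independent P (fun (n : nat) w => X (t n.+1) w - X (t n) w),
      forall s t, 0 <= s -> 0 <= t -> forall B : set R, measurable B ->
        P [set w | B (X (s + t) w - X s w)] = P [set w | B (X t w)] &
      forall t e, 0 <= t -> 0 < e ->
        P [set w | e < `|X s w - X t w|]
          @[s --> within [set s | 0 <= s] (nbhs t)] --> 0%E].

(* Omega(k, n): the j-th coordinate, of weight j, is [x i] with [j = i.+1].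
   As every weight is at least 1, the condition forces each coordinate to be
   at most n, so that no solution is lost by taking values in 'I_n.+1. *)
Definition Omega (k n : nat) : {set {ffun 'I_k -> 'I_n.+1}} :=
  [set x : {ffun 'I_k -> 'I_n.+1} | (\sum_(i < k) i.+1 * x i == n)%N]%SET.

Definition counting_process d (T : measurableType d) (R : realType)
    (P : probability T R) (k : nat) (lambda : 'I_k -> R)
    (M : R -> T -> nat) : Prop :=
  levy_process P (fun t w => (M t w)%:R) /\
  forall t n, 0 <= t ->
    P [set w | M t w = n] =
    (\sum_(x in Omega k n)
       (\prod_(i < k) ((lambda i * t) ^+ x i / (x i)`!%:R))
       * expR (- (\sum_(i < k) lambda i) * t))%:E.

(* Only the restriction of nu to ]0, +oo[ is ever used. *)
Definition levy_measure (R : realType)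
    (nu : {measure set (measurableTypeR R) -> \bar R}) : Prop :=
  (\int[nu]_(x in `]0%R, +oo[) (Num.min x 1)%:E < +oo)%E.

Definition bernstein (R : realType) (c2 : R)
    (nu : {measure set (measurableTypeR R) -> \bar R}) (s : R) : R :=
  c2 * s + \int[nu]_(x in `]0%R, +oo[) (1 - expR (- (s * x))).

Definition subordinator d (T : measurableType d) (R : realType)
    (P : probability T R) (f : R -> R) (D : R -> T -> R) : Prop :=
  [/\ levy_process P D,
      forall w s t, 0 <= s -> s <= t -> D s w <= D t w &
      forall t s, 0 <= t -> 0 < s ->
        ('E_P[fun w => expR (- (s * D t w))] = (expR (- (t * f s)))%:E)%E].

Definition time_changed d (T : measurableType d) (R : realType)
    (M : R -> T -> nat) (D : R -> T -> R) (t : R) (w : T) : nat :=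
  M (D t w) w.

(* The claim sizes Z_1, Z_2, ... are [Z 0], [Z 1], ... *)
Definition aggregate_claims d (T : measurableType d) (R : realType)
    (N : R -> T -> nat) (Z : nat -> T -> R) (t : R) (w : T) : R :=
  \sum_(j < N t w) Z j w.

Definition risk_process d (T : measurableType d) (R : realType)
    (c : R) (N : R -> T -> nat) (Z : nat -> T -> R) (t : R) (w : T) : R :=
  c * t - aggregate_claims N Z t w.

Definition surplus d (T : measurableType d) (R : realType)
    (X : R -> T -> R) (u t : R) (w : T) : R := u + X t w.

Definition ruin_time d (T : measurableType d) (R : realType)
    (U : R -> T -> R) (w : T) : \bar R :=
  ereal_inf [set t%:E | t in [set t | 0 < t /\ U t w < 0]].

(* Meaningful only where the ruin time is finite. *)
Definition deficit d (T : measurableType d) (R : realType)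
    (U : R -> T -> R) (w : T) : R := `|U (fine (ruin_time U w)) w|.

Definition ruin_deficit_prob d (T : measurableType d) (R : realType)
    (P : probability T R) (X : R -> T -> R) (u y : R) : \bar R :=
  P [set w | (ruin_time (surplus X u) w < +oo)%E /\
             deficit (surplus X u) w <= y].

(* F^{*n} *)
Definition conv_cdf d (T : measurableType d) (R : realType)
    (P : probability T R) (Z : nat -> T -> R) (n : nat) (x : R) : R :=
  fine (P [set w | \sum_(j < n) Z j w <= x]).

(* W, with [Fn n] standing for F^{*n}. *)
Definition claim_batch_cdf (R : realType) (k : nat) (lambda : 'I_k -> R)
    (f : R -> R) (Fn : nat -> R -> R) (x : R) : R :=
  let Lambda := \sum_(i < k) lambda i in
  - (f Lambda)^-1 *
  limn (fun N => \sum_(1 <= n < N) \sum_(a in Omega k n)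
    derive1n (\sum_(i < k) a i)%N f Lambda
    * (\prod_(i < k) ((- lambda i) ^+ a i / (a i)`!%:R)) * Fn n x).

(* Main.v *)
From HB Require Import structures.
Require Import Defs.
From mathcomp Require Import all_boot all_order all_algebra.
From mathcomp Require Import all_classical all_reals all_analysis.
From mathcomp Require Import measurable_realfun.
From mathcomp Require Import ring lra zify.
Set Implicit Arguments.
Unset Strict Implicit.
Unset Printing Implicit Defensive.
Import Order.TTheory GRing.Theory Num.Theory.
Import numFieldNormedType.Exports.
Local Open Scope classical_set_scope.
Local Open Scope ring_scope.

(** Let [S] be the aggregate claims process. The surplus [c * t - S t] is watched
    on a grid of mesh [delta]. Its values there form a random walk with steps
    [b - s j], where [b] is [c * delta] and the [s j >= 0] are the independent and
    identically distributed increments of [S]. As the mesh tends to [0], the event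
    that the walk is ruined with deficit at most [y] agrees eventually, for every
    sample path, with the same event in continuous time
    ([skeleton_ruin_cvg]). So [K(0, y)] is a limit of ruin probabilities of
    walks.

    For a walk, reversing the order of the steps before ruin turns ruin at step
    [i.+1] into the event that [i] is a ladder epoch whose height lies in a window
    of length [y] ending at [s - b], where [s] is the claim that causes ruin
    ([ruin_at_rev]). After reversal that claim can be taken to be the same one for
    all [i], so that summing over [i] counts the ladder heights in one window. The
    walk only rises by steps of [b]: its ladder heights are [b] apart, up to one
    defect for each earlier claim, and the part of the window above [0] has length
    about [min s y]. The count is therefore [min s y / b], provided that the walk
    climbs beyond [s], and [b] times the ruin probability is the mean of [min s y]
    up to terms of smaller order ([ruin_by_upper], [ruin_by_lower]). That the walk
    climbs far enough is the weak law of large numbers ([walk_to_infinity]); it is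
    applied with a drift slightly larger than [c], decreasing to [c], because the
    mean claim per unit of time may equal [c].

    After division by [b] it remains to find the limit of the mean of [min s y]
    over [delta], which is the integral from [0] to [y] of [P (u < s) / delta]. The
    increments of the time-changed counting process [N] are independent
    and stationary ([time_changed_increments]), hence so are those of [S]
    ([compound_step_iid]), and [P (u < s)] is the sum over [n >= 1] of
    [P (N delta = n)] times the tail of the [n]-fold convolution at [u]. The
    quotient [P (N delta = n) / delta] tends to the rate given by the derivatives of
    [f] at [Lambda]: it is a combination of the expectations of
    [D delta ^ z * exp (- Lambda * D delta)], which behave like
    [(-1) ^ (z + 1) * delta * f^(z) (Lambda)] because convexity lets the limit of
    the Laplace transform be differentiated ([small_time_moments]). These rates add
    up to [f Lambda] ([claim_rate_sum]), so no mass is lost in the limit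
    ([scheffe_series]) and [P (u < s) / delta] tends to [f Lambda * (1 - W u)]
    ([aggregate_tail_cvg]), with domination by [f Lambda]. *)

(** * Ladder heights of a walk with bounded upward steps *)

Section ladder.
Context {R : realType}.
Variables (b : R) (s : nat -> R).
Hypotheses (b_gt0 : 0 < b) (s_ge0 : forall j, 0 <= s j).

(** The surplus of a discrete risk model: income [b] per period, minus the
    claims. *)
Definition walk (b : R) (s : nat -> R) (i : nat) : R := \sum_(j < i) (b - s j).

Definition is_ladder (x : nat -> R) (i : nat) : bool :=
  [forall j : 'I_i.+1, x j <= x i].

Fixpoint running_max (x : nat -> R) (n : nat) : R :=
  if n is i.+1 then Num.max (running_max x i) (x i.+1) else x 0%N.

Let natDR (p q : nat) : ((p + q)%:R : R) = p%:R + q%:R.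
Proof. exact: natrD. Qed.
Let negT : ~~ true = false. Proof. by []. Qed.
Let boolR0 : (false%:R : R) = 0. Proof. by []. Qed.
Let boolR1 : (true%:R : R) = 1. Proof. by []. Qed.

Let X := walk b s.
Let m := running_max X.

Lemma walk0 : X 0%N = 0. Proof. by rewrite /X /walk big_ord0. Qed.

Lemma walkS i : X i.+1 = X i + (b - s i).
Proof. by rewrite /X /walk big_ord_recr. Qed.

Lemma running_max_ge (x : nat -> R) n j : (j <= n)%N -> x j <= running_max x n.
Proof.
elim: n => [|n IH] /=; first by rewrite leqn0 => /eqP ->.
rewrite leq_eqVlt => /predU1P[->|]; first by rewrite le_max lexx orbT.
by rewrite ltnS => /IH h; rewrite le_max h.
Qed.

Lemma running_max_attained (x : nat -> R) n :
  exists2 j, (j <= n)%N & running_max x n = x j.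
Proof.
elim: n => [|n [j jn IH]] /=; first by exists 0%N.
case: (leP (running_max x n) (x n.+1)) => h.
  by exists n.+1 => //; rewrite max_r.
by exists j; [exact: leqW | rewrite IH].
Qed.

Lemma is_ladderE (x : nat -> R) n : is_ladder x n = (running_max x n <= x n).
Proof.
apply/forallP/idP => [h|h j]; last first.
  by apply: le_trans h; apply: running_max_ge; rewrite -ltnS.
have [j jn ->] := running_max_attained x n.
by have := h (@Ordinal n.+1 j jn).
Qed.

Definition ladder_count (x : nat -> R) (n : nat) (v : R) : nat :=
  \sum_(i < n.+1) (is_ladder x i && (x i < v)%R).

Definition jump_count (n : nat) : nat := \sum_(i < n) (0 < s i)%R.

Lemma ladder_countS (x : nat -> R) n v :
  ladder_count x n.+1 v =
  (ladder_count x n v + (is_ladder x n.+1 && (x n.+1 < v)%R))%N.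
Proof. by rewrite /ladder_count big_ord_recr. Qed.

(** The one-step inequalities below are linear once every comparison in the
    minima and indicators is decided. *)
Ltac min_lra := rewrite /Num.min ?(negT, andbF, andbT, andTb, andFb) ?(boolR0, boolR1, natDR);
  repeat match goal with
  | |- context [ladder_count ?x ?n ?v] => move: (ladder_count x n v) => ?
  | |- context [jump_count ?n] => move: (jump_count n) => ?
  end;
  repeat match goal with |- context [if (?a < ?b)%O then _ else _] =>
    case: (ltP a b) => ? end; rewrite ?(boolR0, boolR1); lra.

(** The walk gains exactly [b] in a period without claim, so ladder heights
    are spaced by [b], except that the epoch closing an excursion below the
    maximum may gain less. Each excursion is opened by a claim: that claim
    pays for the defective epoch, and the term with [X n < m n] is the
    payment made in advance while the excursion lasts. *)
Lemma ladder_count_upper (v : R) n : 0 < v ->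
  b * (ladder_count X n v)%:R + b * (X n < m n)%R%:R
    <= b + Num.min v (m n) + b * (jump_count n)%:R.
Proof.
have b0 := b_gt0; move=> v0; elim: n => [|n IH].
  rewrite /ladder_count /jump_count big_ord0 big_ord1 is_ladderE /m /= walk0.
  rewrite ltxx lexx v0 min_r; [rewrite ?andTb boolR0 boolR1; lra|exact: ltW].
rewrite ladder_countS /jump_count big_ord_recr/= -/(jump_count n) !natDR.
rewrite is_ladderE -/m.
have mS : m n.+1 = Num.max (m n) (X n.+1) by [].
have Xm : X n <= m n by apply: running_max_ge.
have XS := walkS n; have sn := s_ge0 n.
have [e|sn0] := eqVneq (s n) 0; last first.
  have -> : 0 < s n by rewrite lt_neqAle eq_sym sn0 sn.
  move: IH; rewrite mS.
  case: (ltP (X n) (m n)); case: (lerP (m n) (X n.+1)) => h1 h2;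
  rewrite ?ltxx ?lexx ?h1 ?(leNgt _ (X n.+1)) ?h1;
  case: (ltP (X n.+1) v) => h3; min_lra.
rewrite e ltxx. rewrite e in XS.
move: IH; rewrite mS.
  case: (ltP (X n) (m n)); case: (lerP (m n) (X n.+1)) => h1 h2;
  rewrite ?ltxx ?lexx ?h1 ?(leNgt _ (X n.+1)) ?h1;
  case: (ltP (X n.+1) v) => h3; min_lra.
Qed.

(** The walk never rises by more than [b] in a period, so the running
    maximum grows by at most [b] at each ladder epoch. *)
Lemma ladder_count_lower (v : R) n : 0 < v ->
  Num.min v (m n) + b * (m n < v)%R%:R <= b * (ladder_count X n v)%:R.
Proof.
have b0 := b_gt0; move=> v0; elim: n => [|n IH].
  rewrite /ladder_count big_ord1 is_ladderE /m /= walk0.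
  rewrite lexx v0 min_r; [case: (ltP 0 v) => _; rewrite ?andTb ?boolR0 ?boolR1; lra|exact: ltW].
rewrite ladder_countS natDR is_ladderE -/m.
have mS : m n.+1 = Num.max (m n) (X n.+1) by [].
have Xm : X n <= m n by apply: running_max_ge.
have XS := walkS n; have sn := s_ge0 n.
move: IH; rewrite mS.
case: (lerP (m n) (X n.+1)) => h1;
  rewrite ?ltxx ?lexx ?h1 ?(leNgt _ (X n.+1)) ?h1;
  case: (ltP (m n) v) => h2; case: (ltP (X n.+1) v) => h3;
  min_lra.
Qed.

Lemma ladder_count_le0 (x : nat -> R) n v : x 0%N = 0 -> v <= 0 ->
  ladder_count x n v = 0%N.
Proof.
move=> x0 v0; apply: big1 => i _; apply/eqP; rewrite eqb0 negb_and orbC.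
apply/orP; case: (ltP (x i) v) => h; [right|by left].
rewrite is_ladderE -ltNge; apply: lt_le_trans (running_max_ge x (leq0n i)).
by rewrite x0; apply: lt_le_trans v0.
Qed.

Definition band_count (x : nat -> R) (n : nat) (y v : R) : nat :=
  \sum_(i < n.+1) [&& is_ladder x i, (v - y <= x i)%R & (x i < v)%R].

Lemma band_countE (x : nat -> R) n y v : 0 <= y ->
  ((band_count x n y v)%:R : R) =
  (ladder_count x n v)%:R - (ladder_count x n (v - y))%:R.
Proof.
move=> y0; apply/eqP; rewrite eq_sym subr_eq -natDR eqr_nat; apply/eqP.
rewrite /ladder_count /band_count -big_split/=; apply: eq_bigr => i _.
case: is_ladder => //=; case: (leP (v - y) (x i)) => h /=; first by rewrite addn0.
have -> // : x i < v; lra.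
Qed.

(** The window has length [y] and ends at [v - b]; as ladder heights are
    nonnegative it is cut at [0], which turns its length into [Num.min v y]
    up to an error of order [b]. The factor [0 < v] makes the error vanish
    in the absence of a claim. *)
Lemma band_count_upper n y v : 0 <= y -> 0 <= v ->
  b * (band_count X n y (v - b))%:R <=
  Num.min v y + b * (0 < v)%R%:R * (1 + (jump_count n)%:R).
Proof.
have b0 := b_gt0; move=> y0 v0; rewrite band_countE//.
have [h|h] := leP (v - b) 0.
  rewrite !ladder_count_le0 ?walk0//; last lra.
  rewrite subrr mulr0; apply: addr_ge0; first by rewrite le_min v0.
  by rewrite !mulr_ge0 ?addr_ge0 ?ler0n// ltW.
have -> : (0 < v) by lra.
have mn0 : 0 <= m n by rewrite -walk0; apply: running_max_ge.
have := ladder_count_upper n h.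
have [h2|h2] := leP (v - b - y) 0.
  rewrite (@ladder_count_le0 _ _ (v - b - y)) ?walk0// /Num.min.
  case: (X n < m n); min_lra.
have := ladder_count_lower n h2.
rewrite /Num.min.
case: (X n < m n); case: (m n < v - b - y); min_lra.
Qed.

(** The conditions [v <= A] and [A <= X n] say that the walk has crossed the
    whole window by time [n]. *)
Lemma band_count_lower n y v A : 0 <= y -> 0 <= v -> A <= X n -> v <= A ->
  Num.min v y - b * (0 < v)%R%:R * (2 + (jump_count n)%:R)
    <= b * (band_count X n y (v - b))%:R.
Proof.
have b0 := b_gt0; move=> y0 v0 AX vA; rewrite band_countE//.
have J0 : (0 : R) <= (jump_count n)%:R by [].
have [h|h] := leP (v - b) 0.
  rewrite !ladder_count_le0 ?walk0//; last lra.
  rewrite subrr mulr0 subr_le0.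
  have [->|vn0] := eqVneq v 0; first by rewrite ltxx min_l// !(mulr0,mul0r).
  have -> : 0 < v by rewrite lt_neqAle eq_sym vn0.
  have : v <= b * (2 + (jump_count n)%:R) by nra.
  rewrite /Num.min; min_lra.
have -> : (0 < v) by lra.
have mX : X n <= m n by apply: running_max_ge.
have := ladder_count_lower n h.
have -> : (m n < v - b) = false by apply/negbTE; rewrite -leNgt; lra.
have -> : Num.min (v - b) (m n) = v - b by rewrite min_l//; lra.
have [h2|h2] := leP (v - b - y) 0.
  rewrite (@ladder_count_le0 _ _ (v - b - y)) ?walk0// /Num.min.
  have : 0 <= b * (jump_count n)%:R by rewrite mulr_ge0// ltW.
  min_lra.
have := ladder_count_upper n h2.
have : Num.min (v - b - y) (m n) <= v - b - y by rewrite ge_min lexx.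
have : 0 <= b * (X n < m n)%R%:R by rewrite mulr_ge0// ltW.
set z := Num.min (v - b - y) _; set z2 := b * (X n < m n)%R%:R.
rewrite /Num.min; min_lra.
Qed.

End ladder.

(** * Limits of events, and mixtures *)

Section events.
Context d (T : measurableType d) (R : realType) (P : probability T R).
Local Open Scope ereal_scope.

(** The limit lies between the increasing lower limit and the decreasing
    upper limit of the events, which both equal it. Measurability of the
    limit is part of the conclusion: it is how events defined by a
    continuous-time path become measurable. *)
Lemma eventually_constant_event (A : set T) (A_ : nat -> set T) :
  (forall m, measurable (A_ m)) ->
  (forall w, \forall m \near \oo, A_ m w <-> A w) ->
  measurable A /\ P (A_ m) @[m --> \oo] --> P A.
Proof.
move=> mA_ cvA.
pose L n := \bigcap_(m in [set m | (n <= m)%N]) A_ m.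
pose U n := \bigcup_(m in [set m | (n <= m)%N]) A_ m.
have mL n : measurable (L n) by exact: bigcap_measurableType.
have mU n : measurable (U n) by exact: bigcup_measurable.
have LA : \bigcup_n L n = A.
  apply/seteqP; split => [w [n _ Lw]|w Aw].
    have [N _ hN] := cvA w.
    apply/(hN (maxn n N)); first by rewrite /= leq_maxr.
    by apply: Lw; rewrite /= leq_maxl.
  by have [N _ hN] := cvA w; exists N => // m /= Nm; apply/hN.
have UA : \bigcap_n U n = A.
  apply/seteqP; split => [w Uw|w Aw n _].
    have [N _ hN] := cvA w; have [m Nm Am] := Uw N I.
    exact/(hN m).
  have [N _ hN] := cvA w; exists (maxn n N); first by rewrite /= leq_maxl.
  by apply/hN => //; rewrite /= leq_maxr.
have mA : measurable A by rewrite -LA; exact: bigcup_measurable.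
split => //.
apply: (@squeeze_cvge _ _ _ _ (P \o L) _ (P \o U)).
- near=> m; rewrite !le_measure ?inE//.
  + by move=> w Aw; exists m => /=.
  + by move=> w /(_ m)/=; apply => //=.
- rewrite -LA; apply: nondecreasing_cvg_mu => //; first by rewrite LA.
  by move=> n m nm; apply/subsetPset => w Lw j /= mj; apply: Lw; apply: leq_trans mj.
- rewrite -UA; apply: nonincreasing_cvg_mu => //; last 2 first.
  + by rewrite UA.
  + move=> n m nm; apply/subsetPset => w [j /= mj Aj]; exists j => //=.
    exact: leq_trans mj.
  + by rewrite (le_lt_trans (probability_le1 _ _))// ltry.
Unshelve. all: by end_near. Qed.

Lemma prob_sum_partition (A : set T) (V : T -> nat) :
  measurable A -> (forall n, measurable (V @^-1` [set n])) ->
  P A = \sum_(n <oo) P (A `&` V @^-1` [set n]).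
Proof.
move=> mA mV.
have mAV n : measurable (A `&` V @^-1` [set n]) by apply: measurableI.
rewrite -measure_semi_bigcup//; last 2 first.
- apply/trivIsetP => i j _ _ ij; rewrite setIACA setIid.
  suff -> : V @^-1` [set i] `&` V @^-1` [set j] = set0 by rewrite setI0.
  by apply/seteqP; split => // w [/= -> ji]; move: ij; rewrite ji eqxx.
- exact: bigcupT_measurable.
congr (P _); apply/seteqP; split => [w Aw|w [n _ []]//].
by exists (V w).
Qed.

(** The labels [V j] are summed out one index at a time. It serves to remove
    a randomization: events that are independent given the labels, with
    weights that factor, are independent. *)
Lemma mixture_product (r : nat) (A : nat -> set T) (V : nat -> T -> nat)
    (a : nat -> nat -> R) (b : nat -> R) :
  (forall j, measurable (A j)) ->
  (forall j n, measurable (V j @^-1` [set n])) ->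
  (forall j n, 0 <= a j n)%R ->
  (forall j, \sum_(n <oo) (a j n)%:E = (b j)%:E) ->
  (forall v : nat -> nat,
    P (\bigcap_(j in [set j | (j < r)%N]) (A j `&` V j @^-1` [set v j])) =
    (\prod_(0 <= j < r) a j (v j))%:E) ->
  P (\bigcap_(j in [set j | (j < r)%N]) A j) = (\prod_(0 <= j < r) b j)%:E.
Proof.
move=> mA mV a0 ab H.
suff K s : (s <= r)%N -> forall v : nat -> nat,
    P (\bigcap_(j in [set j | (j < r)%N])
        (A j `&` [set w | (s <= j)%N -> V j w = v j])) =
    (\prod_(0 <= j < s) b j * \prod_(s <= j < r) a j (v j))%:E.
  have := K r (leqnn r) (fun=> 0%N).
  rewrite [X in (_ * X)%R]big_geq// mulr1 => <-; congr (P _).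
  apply: eq_bigcapr => j /= jr; rewrite setIidl// => w _ /= rj.
  by have := leq_trans jr rj; rewrite ltnn.
have mAV s' v : measurable (\bigcap_(j in [set j | (j < r)%N])
        (A j `&` [set w | (s' <= j)%N -> V j w = v j])).
  apply: bigcap_measurableType => j _.
  apply: measurableI => //; case: (leqP s' j) => sj.
    rewrite (_ : [set _ | _] = V j @^-1` [set v j])//.
    by apply/seteqP; split => w //=; apply.
  by rewrite (_ : [set _ | _] = setT)//; apply/seteqP; split => w.
elim: s => [_ v|s IH sr v].
  rewrite [X in (X * _)%R]big_geq// mul1r -H; congr (P _).
  apply: eq_bigcapr => j /= jr; congr (_ `&` _).
  by apply/seteqP; split => w //=; apply.
rewrite big_nat_recr//= (@prob_sum_partition _ (V s))//.
pose v' n := fun j => if j == s then n else v j.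
under eq_eseriesr => n _.
  rewrite (_ : _ `&` _ = \bigcap_(j in [set j | (j < r)%N])
        (A j `&` [set w | (s <= j)%N -> V j w = v' n j])); last first.
    apply/seteqP; split => [w [h /= Vn] j /= jr|w h].
      have [Aj Vj] := h j jr; split => // sj; rewrite /v'.
      by case: eqP => [->//|/eqP js]; apply: Vj; rewrite ltn_neqAle eq_sym js.
    split => [j /= jr|/=]; last first.
      by have [_] := h s sr; rewrite /= /v' eqxx; apply.
    have [Aj Vj] := h j jr; split => // sj.
    rewrite (Vj (ltnW sj)) /v'; case: eqP => // js.
    by move: sj; rewrite js ltnn.
  rewrite IH ?(ltnW sr)// [X in (_ * X)%R]big_ltn// {1}/v' eqxx.
  rewrite (_ : (\prod_(s.+1 <= _ < r) _)%R =
    (\prod_(s.+1 <= j < r) a j (v j))%R); last first.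
    rewrite !big_nat; apply: eq_bigr => j /andP[sj _]; rewrite /v'.
    by case: eqP => // js; move: sj; rewrite js ltnn.
  rewrite mulrCA mulrC EFinM.
  over.
rewrite nneseriesZl; last by move=> n _; rewrite lee_fin.
by rewrite ab -EFinM mulrAC.
Qed.

End events.

(** * Laws of sequences of random variables *)

Section path_law.
Context (R : realType).
Local Open Scope ereal_scope.

Definition box (n : nat) (B : nat -> set R) : set (nat -> R) :=
  [set x | forall i, (i < n)%N -> B i (x i)].

Definition boxes : set (set (nat -> R)) :=
  [set A | exists n B, (forall i, measurable (B i)) /\ A = box n B].

(** The product sigma-algebra on sequences, generated by the cylinders. *)
Definition path_space := g_sigma_algebraType boxes.

Lemma boxesI : setI_closed boxes.
Proof.
move=> _ _ [n1 [B1 [mB1 ->]]] [n2 [B2 [mB2 ->]]].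
pose cut n (B : nat -> set R) i := if (i < n)%N then B i else setT.
have mcut n B i : (forall i, measurable (B i)) -> measurable (cut n B i).
  by move=> mB; rewrite /cut; case: ifP.
exists (maxn n1 n2), (fun i => cut n1 B1 i `&` cut n2 B2 i); split.
  by move=> i; apply: measurableI; exact: mcut.
apply/seteqP; split => [x [x1 x2] i _|x h].
  by split; rewrite /cut; case: ifP => // h; [apply: x1|apply: x2].
split=> i hi.
  by have [] := h i; rewrite ?leq_max ?hi// /cut hi.
by have [] := h i; rewrite ?leq_max ?hi ?orbT// /cut hi.
Qed.

Lemma measurable_coord (i : nat) : measurable_fun setT (fun x : path_space => x i).
Proof.
move=> _ B mB; rewrite setTI; apply: sub_sigma_algebra.
exists i.+1, (fun j => if j == i then B else setT); split.
  by move=> j; case: ifP.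
apply/seteqP; split => [x Bx j _|x /(_ i)].
  by case: eqP => // ->.
by rewrite /= ltnSn eqxx; apply.
Qed.

Lemma measurable_path d (T : measurableType d) (X : nat -> T -> R) :
  (forall i, measurable_fun setT (X i)) ->
  measurable_fun setT (fun w => (fun i => X i w) : path_space).
Proof.
move=> mX; apply: (@measurability _ _ T path_space setT _ boxes erefl).
move=> _ [_ [n [B [mB ->]]] <-]; rewrite setTI.
rewrite (_ : _ @^-1` _ = \bigcap_(i in [set i | (i < n)%N]) (X i @^-1` B i))//.
by apply: bigcap_measurableType => i _; rewrite -[X in measurable X]setTI; exact: mX.
Qed.

Lemma path_law_unique d1 d2 (T1 : measurableType d1) (T2 : measurableType d2)
    (P1 : probability T1 R) (P2 : probability T2 R)
    (X1 : nat -> T1 -> R) (X2 : nat -> T2 -> R) :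
  (forall i, measurable_fun setT (X1 i)) ->
  (forall i, measurable_fun setT (X2 i)) ->
  (forall n B, (forall i, measurable (B i)) ->
    P1 (\bigcap_(i in [set i | (i < n)%N]) X1 i @^-1` B i) =
    P2 (\bigcap_(i in [set i | (i < n)%N]) X2 i @^-1` B i)) ->
  forall A : set path_space, measurable A ->
    P1 [set w | A (fun i => X1 i w)] = P2 [set w | A (fun i => X2 i w)].
Proof.
move=> mX1 mX2 H A mA.
have m1 := measurable_path mX1; have m2 := measurable_path mX2.
pose phi1 : {mfun T1 >-> path_space} := HB.pack (fun w => (fun i => X1 i w) : path_space)
  (isMeasurableFun.Build _ _ _ _ _ m1).
pose phi2 : {mfun T2 >-> path_space} := HB.pack (fun w => (fun i => X2 i w) : path_space)
  (isMeasurableFun.Build _ _ _ _ _ m2).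
change (distribution P1 phi1 A = distribution P2 phi2 A).
apply: (@measure_unique _ R path_space boxes (fun=> setT)) => //.
- exact: boxesI.
- move=> _; exists 0%N, (fun=> setT); split => //.
  by apply/seteqP; split.
- by rewrite bigcup_const//; exists 0%N.
- by move=> _ [n [B [mB ->]]]; exact: H.
- by move=> _; rewrite /= /distribution /pushforward preimage_setT probability_setT ltry.
Qed.
End path_law.

Section iid.
Context d (T : measurableType d) (R : realType) (P : probability T R).
Local Open Scope ereal_scope.

(** The common law is recorded as a plain function, so that images and
    mixtures of laws do not have to be built as measures. *)
Definition iid_with (X : nat -> T -> R) (mu : set R -> R) :=
  [/\ forall i, measurable_fun setT (X i),
      forall i B, measurable B -> P (X i @^-1` B) = (mu B)%:E &
      mutually_independent P X].

Variables (X : nat -> T -> R) (mu : set R -> R).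
Hypothesis X_iid : iid_with X mu.

Let mX i : measurable_fun setT (X i). Proof. by have [] := X_iid. Qed.

Lemma iid_box (n : nat) (sigma : nat -> nat) (B : nat -> set R) :
  injective sigma -> (forall i, measurable (B i)) ->
  P (\bigcap_(i in [set i | (i < n)%N]) X (sigma i) @^-1` B i) =
  (\prod_(0 <= i < n) mu (B i))%:E.
Proof.
move=> sigma_inj mB.
have [_ lawX indX] := X_iid.
pose s := [seq sigma i | i <- iota 0 n].
pose B' j := \bigcap_(i in [set i | (i < n)%N /\ sigma i = j]) B i.
have B'E i : (i < n)%N -> B' (sigma i) = B i.
  move=> lt_in; apply/seteqP; split => [x|x Bx j [_ /sigma_inj ->]//].
  exact.
have mB' j : measurable (B' j) by exact: bigcap_measurableType.
transitivity (P (\bigcap_(j in [set` s]) (X j @^-1` B' j))).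
  congr (P _); apply/seteqP; split => [w h j /= /mapP[i] + ->|w h i /= lt_in].
    rewrite mem_iota add0n /= => lt_in; rewrite B'E//; exact: h.
  rewrite -B'E//; apply: h; rewrite /=; apply/mapP; exists i => //.
  by rewrite mem_iota.
rewrite indX//; last by rewrite map_inj_uniq// iota_uniq.
congr (_%:E); rewrite big_map /index_iota subn0 !big_seq; apply: eq_bigr => i.
by rewrite mem_iota add0n /= => lt_in; rewrite lawX// B'E.
Qed.

Lemma iid_reindex (sigma : nat -> nat) (A : set (path_space R)) :
  injective sigma -> measurable A ->
  P [set w | A (fun i => X i w)] = P [set w | A (fun i => X (sigma i) w)].
Proof.
move=> sigma_inj mA; apply: path_law_unique => // n B mB.
by rewrite (@iid_box n id)// iid_box.
Qed.

(** On the product of two copies of the space, the sequence that takes its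
    past from the first copy and its future from the second has the same
    cylinder probabilities as [X]; there the two events depend on different
    coordinates. *)
Lemma iid_past_future (N : nat) (A B : set (path_space R)) :
  measurable A -> measurable B ->
  P ([set w | A (fun i => if (i < N)%N then X i w else 0%R)] `&`
     [set w | B (fun i => X (N + i)%N w)]) =
  P [set w | A (fun i => if (i < N)%N then X i w else 0%R)] *
  P [set w | B (fun i => X i w)].
Proof.
move=> mA mB.
pose Y i (w : T * T) := if (i < N)%N then X i w.1 else X (i - N)%N w.2.
have mY i : measurable_fun setT (Y i).
  rewrite /Y; case: (i < N)%N.
    exact: (measurableT_comp (mX i) measurable_fst).
  exact: (measurableT_comp (mX _) measurable_snd).
pose C : set (path_space R) :=
  [set x | A (fun i => if (i < N)%N then x i else 0%R)] `&`
  [set x | B (fun i => x (N + i)%N)].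
have mC : measurable C.
  have m1 : measurable_fun setT (fun x : path_space R =>
      (fun i => if (i < N)%N then x i else 0%R) : path_space R).
    apply: (@measurable_path _ _ (path_space R)
      (fun i x => if (i < N)%N then x i else 0%R)) => i.
    by case: (i < N)%N; [exact: measurable_coord|exact: measurable_cst].
  have m2 : measurable_fun setT (fun x : path_space R =>
      (fun i => x (N + i)%N) : path_space R).
    apply: (@measurable_path _ _ (path_space R) (fun i x => x (N + i)%N)) => i.
    exact: measurable_coord.
  apply: measurableI.
    by have := m1 measurableT _ mA; rewrite setTI.
  by have := m2 measurableT _ mB; rewrite setTI.
transitivity (P [set w | C (fun i => X i w)]) => //.
rewrite (@path_law_unique R _ _ _ _ P (P \x P)%E X Y mX mY _ C mC); last first.
  move=> n D mD; rewrite (@iid_box n id)//.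
  rewrite (_ : \bigcap_(i in _) _ =
    (\bigcap_(i in [set i | (i < minn n N)%N]) X i @^-1` D i) `*`
    (\bigcap_(i in [set i | (i < n - N)%N]) X i @^-1` D (N + i)%N)); last first.
    apply/seteqP; split => [w h|w [h1 h2] i /= lt_in].
      split=> i /=.
        rewrite ltn_min => /andP[lt_in iN].
        by have := h i lt_in; rewrite /= /Y iN.
      rewrite ltn_subRL => lt_in.
      by have := h (N + i)%N lt_in; rewrite /= /Y ltnNge leq_addr /= addKn.
    rewrite /Y; case: ltnP => iN; first by apply: h1; rewrite /= ltn_min lt_in.
    by have := h2 (i - N)%N; rewrite /= subnKC//; apply; rewrite ltn_sub2r// (leq_ltn_trans iN).
  apply/esym; etransitivity.
    by apply: product_measure1E; apply: bigcap_measurableType => i _;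
      rewrite -[X in measurable X]setTI; exact: mX.
  transitivity ((\prod_(0 <= i < minn n N) mu (D i))%:E *
      (\prod_(0 <= i < n - N) mu (D (N + i)%N))%:E).
    congr (_ * _); first exact: (@iid_box _ id).
    by apply: (@iid_box _ id (fun i => D (N + i)%N)).
  rewrite -EFinM.
  congr (_%:E); have [nN|Nn] := leqP n N.
    rewrite (_ : (n - N)%N = 0%N) ?[X in (_ * X)%R]big_geq ?mulr1//.
    by apply/eqP; rewrite subn_eq0.
  rewrite [RHS](big_cat_nat (n := N))//=; last exact: ltnW.
  congr (_ * _)%R.
  by rewrite -[X in index_iota X n](add0n N) big_addn; apply: eq_bigr => i _; rewrite addnC.
apply: (etrans _ (@product_measure1E _ _ _ _ _ P P _ _ _ _)); last 2 first.
- have := @measurable_path R _ T (fun i w => if (i < N)%N then X i w else 0%R).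
  move=> /(_ _ measurableT _ mA); rewrite setTI; apply => i.
  by case: (i < N)%N.
- have := measurable_path mX; move=> /(_ measurableT _ mB); rewrite setTI => H; exact: H.
have EA w : (fun i => if (i < N)%N then Y i w else 0%R) =
            (fun i => if (i < N)%N then X i w.1 else 0%R).
  by apply/funext => i; rewrite /Y; case: (i < N)%N.
have EB w : (fun i => Y (N + i)%N w) = (fun i => X i w.2).
  by apply/funext => i; rewrite /Y ltnNge leq_addr /= addKn.
apply: congr1; apply/seteqP; split => w; rewrite /C /setI /setX /mkset /=;
  by rewrite EA EB.
Qed.
End iid.

Lemma integral_prod_indep d (T : measurableType d) (R : realType)
    (P : probability T R) (X Y : T -> R) (f g : R -> R) :
  measurable_fun setT X -> measurable_fun setT Y ->
  measurable_fun setT f -> measurable_fun setT g ->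
  (forall x, 0 <= f x) -> (forall x, 0 <= g x) ->
  (forall A B, measurable A -> measurable B ->
    P (X @^-1` A `&` Y @^-1` B) = P (X @^-1` A) * P (Y @^-1` B))%E ->
  (\int[P]_w (f (X w) * g (Y w))%:E =
   (\int[P]_w (f (X w))%:E) * (\int[P]_w (g (Y w))%:E))%E.
Proof.
move=> mX mY mf mg f0 g0 XY.
have mXY : measurable_fun setT (fun w => (X w, Y w) : (R * R)%type).
  exact: measurable_fun_pair.
pose X' : {mfun T >-> R} := HB.pack X (isMeasurableFun.Build _ _ _ _ _ mX).
pose Y' : {mfun T >-> R} := HB.pack Y (isMeasurableFun.Build _ _ _ _ _ mY).
pose XY' : {mfun T >-> (R * R)%type} :=
  HB.pack (fun w => (X w, Y w) : (R * R)%type) (isMeasurableFun.Build _ _ _ _ _ mXY).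
pose h (z : (R * R)%type) := (f z.1 * g z.2)%:E.
have mh : measurable_fun setT h.
  apply/measurable_EFinP; apply: measurable_funM.
    exact: (measurableT_comp mf measurable_fst).
  exact: (measurableT_comp mg measurable_snd).
have h0 z : (0 <= h z)%E by rewrite lee_fin mulr_ge0.
transitivity (\int[distribution P XY']_z h z)%E.
  by rewrite ge0_integral_distribution.
transitivity (\int[(distribution P X' \x distribution P Y')%E]_z h z)%E.
  apply: (eq_measure_integral (distribution P X' \x distribution P Y')%E) => A mA _; apply/esym.
  exact: product_measure_unique.
rewrite fubini_tonelli1//= /fubini_F /h/=.
transitivity (\int[distribution P X']_x ((f x)%:E * \int[distribution P Y']_y (g y)%:E))%E.
  apply: eq_integral => x _.
  under eq_integral do rewrite EFinM.
  by rewrite ge0_integralZl ?lee_fin//; [exact/measurable_EFinP|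
    move=> y _; rewrite lee_fin].
rewrite ge0_integralZr//; last 3 first.
- exact/measurable_EFinP.
- by move=> x _; rewrite lee_fin.
- by apply: integral_ge0 => y _; rewrite lee_fin.
congr (_ * _)%E.
- by rewrite ge0_integral_distribution//; exact/measurable_EFinP.
- by rewrite ge0_integral_distribution//; exact/measurable_EFinP.
Qed.

Section iid_extra.
Context d (T : measurableType d) (R : realType) (P : probability T R).
Variables (X : nat -> T -> R) (mu : set R -> R).
Hypothesis X_iid : iid_with P X mu.

Lemma iid_comp (g : R -> R) : measurable_fun setT g ->
  iid_with P (fun i w => g (X i w)) (fun B => mu (g @^-1` B)).
Proof.
move=> mg; have [mX lawX indX] := X_iid.
have mgB B : measurable B -> measurable (g @^-1` B).
  by move=> mB; rewrite -[X in measurable X]setTI; exact: mg.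
split.
- by move=> i; exact: measurableT_comp.
- by move=> i B mB; rewrite -(lawX i)//; exact: mgB.
- by move=> s B us mB; apply: (indX s (fun i => g @^-1` B i)) => // i; exact: mgB.
Qed.

Lemma iid_pair i j (A B : set R) : i != j -> measurable A -> measurable B ->
  (P (X i @^-1` A `&` X j @^-1` B) = (mu A * mu B)%:E)%E.
Proof.
move=> ij mA mB; have [mX lawX indX] := X_iid.
pose C k := if k == i then A else B.
have := indX [:: i; j] C; rewrite /= inE ij /= => /(_ isT) H.
rewrite (_ : _ `&` _ = \bigcap_(k in [set` [:: i; j]]) X k @^-1` C k); last first.
  apply/seteqP; split => [w [Ai Bj] k /=|w h].
    by rewrite !inE /C => /orP[] /eqP ->; rewrite ?eqxx// eq_sym (negbTE ij).
  split.
    by have /= := h i; rewrite !inE eqxx /C eqxx; apply.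
  by have /= := h j; rewrite !inE eqxx orbT /C eq_sym (negbTE ij); apply.
rewrite H; last by move=> k; rewrite /C; case: ifP.
rewrite !big_cons big_nil mulr1 /C eqxx eq_sym (negbTE ij).
by rewrite !lawX.
Qed.
End iid_extra.

(** * Time reversal of a walk *)

Section reversal.
Context (R : realType).
Implicit Types (x : nat -> R) (b y : R).

Definition ruin_at b y i x : Prop :=
  (forall j, (j <= i)%N -> 0 <= walk b x j) /\ - y <= walk b x i.+1 < 0.

Definition ruin_by b y n x : Prop := exists2 i, (i <= n)%N & ruin_at b y i x.

(** Reverses the first [i] steps, puts step [n.+1] in position [i], and
    sends the other positions beyond [n.+1] so as to remain injective. The
    ruinous claim is thus [x n.+1] whatever [i <= n] is, and the reversed
    events for all [i] concern one and the same walk and one and the same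
    claim. *)
Definition rev_index (n i j : nat) : nat :=
  if (j < i)%N then (i - j.+1)%N else if j == i then n.+1 else (n.+1 + j)%N.

Lemma rev_index_inj n i : (i <= n)%N -> injective (rev_index n i).
Proof.
move=> le_in j1 j2; rewrite /rev_index.
case: (ltngtP j1 i) => h1; case: (ltngtP j2 i) => h2; lia.
Qed.

Lemma walk_rev b n i x j : (j <= i)%N ->
  walk b (fun l => x (rev_index n i l)) j = walk b x i - walk b x (i - j).
Proof.
elim: j => [_|j IH ji]; first by rewrite subn0 subrr walk0.
rewrite walkS IH ?(ltnW ji)//.
have -> : (i - j = (i - j.+1).+1)%N by rewrite subnSK.
by rewrite walkS /rev_index ji; lra.
Qed.

(** The partial sums of the reversed walk are [X i - X (i - j)]: all of them
    are nonnegative exactly when [X i] is a maximum so far, and the claim [x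
    n.+1] then ruins with deficit at most [y] exactly when [X i] lies in a
    window of length [y] below [x n.+1 - b]. *)
Lemma ruin_at_rev b y n i x :
  ruin_at b y i (fun l => x (rev_index n i l)) <->
  [&& is_ladder (walk b x) i, x n.+1 - b - y <= walk b x i &
      walk b x i < x n.+1 - b].
Proof.
rewrite /ruin_at.
have -> : walk b (fun l => x (rev_index n i l)) i.+1 = walk b x i + b - x n.+1.
  rewrite walkS walk_rev// subnn walk0 /rev_index ltnn eqxx; lra.
split => [[H1 H2]|/and3P[/forallP H1 H2 H3]].
  apply/and3P; split; [|lra|lra].
  apply/forallP => -[j /=]; rewrite ltnS => ji.
  have := H1 (i - j)%N; rewrite walk_rev ?leq_subr// subKn// => /(_ isT); lra.
split; last lra.
move=> j ji; rewrite walk_rev//.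
have lt : (i - j < i.+1)%N by rewrite ltnS leq_subr.
have := H1 (Ordinal lt) => /=; lra.
Qed.

Lemma measurable_walk b j :
  measurable_fun setT (fun x : path_space R => walk b x j).
Proof.
rewrite /walk; apply: measurable_sum => i.
by apply: measurable_funB => //; exact: measurable_coord.
Qed.

Lemma measurable_ruin_at b y i : measurable [set x : path_space R | ruin_at b y i x].
Proof.
rewrite (_ : [set _ | _] =
  (\bigcap_(j in [set j | (j <= i)%N]) (fun x : path_space R => walk b x j) @^-1` `[0, +oo[) `&`
  (fun x : path_space R => walk b x i.+1) @^-1` `[- y, 0[ ); last first.
  apply/seteqP; split => x; rewrite /ruin_at /= in_itv/=.
    by move=> [h1 h2]; split => // j ji; rewrite /= in_itv/= andbT h1.
  by move=> [h1 h2]; split => // j ji; have := h1 j ji; rewrite /= in_itv/= andbT.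
apply: measurableI.
  apply: bigcap_measurableType => j _; rewrite -[X in measurable X]setTI.
  exact: measurable_walk.
by rewrite -[X in measurable X]setTI; exact: measurable_walk.
Qed.

Lemma measurable_ruin_by b y n : measurable [set x : path_space R | ruin_by b y n x].
Proof.
rewrite (_ : [set _ | _] = \bigcup_(i in [set i | (i <= n)%N])
    [set x : path_space R | ruin_at b y i x]).
  by apply: bigcup_measurable => i _; exact: measurable_ruin_at.
by apply/seteqP; split => x [i]; exists i.
Qed.

Lemma trivIset_ruin_at b y :
  trivIset setT (fun i => [set x : path_space R | ruin_at b y i x]).
Proof.
suff H i j x : (i < j)%N -> ruin_at b y i x -> ruin_at b y j x -> False.
  apply/trivIsetP => i j _ _ ij; apply/seteqP; split => // x [hi hj].
  by have [ltij|ltji] := ltnP i j; [apply: (H i j x)|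
    apply: (H j i x) => //; rewrite ltn_neqAle eq_sym ij].
move=> ij [_ /andP[_ h]] [h2 _]; have := h2 _ ij; lra.
Qed.
End reversal.

(** * Ruin probability of a random walk *)

Section walk_ruin.
Context d (T : measurableType d) (R : realType) (P : probability T R).
Variables (s : nat -> T -> R) (mu : set R -> R).
Hypotheses (s_iid : iid_with P s mu) (s_ge0 : forall i w, 0 <= s i w).
Variables (b y : R) (n : nat).
Hypotheses (b_gt0 : 0 < b) (y_ge0 : 0 <= y).

Let ms i : measurable_fun setT (s i). Proof. by have [] := s_iid. Qed.

Let Xw w := walk b (fun i => s i w).
Let q := mu `]0, +oo[%classic.
Let pos i := [set w | 0 < s i w].

Let posE i : pos i = s i @^-1` `]0, +oo[%classic.
Proof. by apply/seteqP; split => w; rewrite /pos /= in_itv/= andbT. Qed.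

Let mpos i : measurable (pos i).
Proof. by rewrite posE -[X in measurable X]setTI; exact: ms. Qed.

Let Ppos i : P (pos i) = q%:E.
Proof. by rewrite posE; have [_ lawX _] := s_iid; rewrite (lawX i)//; exact: measurable_itv. Qed.

Let q_ge0 : 0 <= q.
Proof. by rewrite -lee_fin -(Ppos 0%N). Qed.

Let band i := [set w | [&& is_ladder (Xw w) i, s n.+1 w - b - y <= Xw w i &
      Xw w i < s n.+1 w - b]].

Let ruinE i : P [set w | ruin_at b y i (fun j => s j w)] = P (band i) \/ (n < i)%N.
Proof.
have [le_in|] := leqP i n; [left|by right].
rewrite (iid_reindex s_iid (rev_index_inj le_in) (measurable_ruin_at b y i)).
by congr (P _); apply/seteqP; split => w /(@ruin_at_rev R b y n i (fun j => s j w)).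
Qed.

Let mpath (A : set (path_space R)) : measurable A ->
  measurable [set w | A (fun i => s i w)].
Proof.
by move=> mA; have := measurable_path ms; move=> /(_ measurableT _ mA); rewrite setTI => h; exact: h.
Qed.

Let mband i : measurable (band i).
Proof.
have mX j : measurable_fun setT (fun w => Xw w j).
  exact: (measurableT_comp (measurable_walk b j) (measurable_path ms)).
rewrite (_ : band i = (\bigcap_(j in [set j | (j <= i)%N]) [set w | Xw w j <= Xw w i]) `&`
   ([set w | s n.+1 w - b - y <= Xw w i] `&` [set w | Xw w i < s n.+1 w - b])); last first.
  apply/seteqP; split => w.
    move=> /and3P[/forallP h1 h2 h3]; split => // j /= ji.
    by have := h1 (@Ordinal i.+1 j ji).
  move=> [h1 [/= h2 h3]]; apply/and3P; split => //.
  by apply/forallP => -[j ji]; apply: h1.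
have mle (f g : T -> R) : measurable_fun setT f -> measurable_fun setT g ->
    measurable [set w | f w <= g w].
  by move=> mf mg; rewrite -[X in measurable X]setTI; exact: measurable_fun_ler.
have mlt (f g : T -> R) : measurable_fun setT f -> measurable_fun setT g ->
    measurable [set w | f w < g w].
  by move=> mf mg; rewrite -[X in measurable X]setTI; exact: measurable_fun_ltr.
apply: measurableI; first by apply: bigcap_measurableType => j _; exact: mle.
apply: measurableI.
  by apply: mle => //; do 2 apply: measurable_funB => //.
by apply: mlt => //; apply: measurable_funB.
Qed.

Local Open Scope ereal_scope.

(** Ruin at different steps is disjoint, and each term is replaced by its
    reversed event; the sum becomes the mean number of ladder heights in a
    window placed by the independent claim [s n.+1]. *)
Let ruin_sum : P [set w | ruin_by b y n (fun j => s j w)] =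
  \int[P]_w (band_count (Xw w) n y (s n.+1 w - b))%:R%:E.
Proof.
transitivity (\sum_(i < n.+1) P [set w | ruin_at b y i (fun j => s j w)]).
  rewrite -(@measure_bigsetU_ord _ _ _ P _ xpredT
    (fun i : 'I_n.+1 => [set w | ruin_at b y i (fun j => s j w)])); last 2 first.
  - by move=> i; apply: mpath; exact: measurable_ruin_at.
  - apply/trivIsetP => i j _ _ ij; apply/seteqP; split => // w [wi wj].
    have /trivIsetP/(_ (i : nat) (j : nat) I I ij)/seteqP[h _] := @trivIset_ruin_at R b y.
    by apply: (h (fun j => s j w)); split.
  congr (P _); rewrite -(bigcup_mkord _ (fun i => [set w | ruin_at b y i (fun j => s j w)])); apply/seteqP; split => w.
    by move=> [i le_in H]; exists i.
  by move=> [i /= lt_in H]; exists i.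
transitivity (\sum_(i < n.+1) \int[P]_w (\1_(band i) w)%:E).
  apply: eq_bigr => i _; rewrite integral_indic// setIT.
  by case: (ruinE i) => // ni; have := ltn_ord i; rewrite ltnS leqNgt ni.
rewrite -ge0_integral_sum//; last first.
  by move=> i; apply/measurable_EFinP; exact: measurable_indic.
apply: eq_integral => w _; rewrite sumEFin; congr (_%:E).
rewrite /band_count natr_sum; apply: eq_bigr => i _.
by rewrite indicE; congr (nat_of_bool _)%:R; rewrite mem_setE.
Qed.

Let mind (A : set T) : measurable A -> measurable_fun setT (fun w => (\1_A w)%:E : \bar R).
Proof. by move=> mA; apply/measurable_EFinP; exact: measurable_indic. Qed.

(** The error terms of the band counts. All of them require a claim at step
    [n.+1], and those in the sum an earlier claim as well: this is why the
    mean error is negligible. *)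
Let err (k : R) w : \bar R :=
  b%:E * (k%:E * (\1_(pos n.+1) w)%:E + \sum_(j < n) (\1_(pos n.+1 `&` pos j) w)%:E).

Let errE (k : R) w : (err k w =
  (b * (0 < s n.+1 w)%R%:R * (k + (jump_count (fun i => s i w) n)%:R))%:E).
Proof.
rewrite /err sumEFin -(EFinM k) -EFinD -EFinM; congr (_%:E).
rewrite -mulrA; congr (_ * _)%R.
have posI i : (w \in pos i) = (0 < s i w)%R by apply/idP/idP; rewrite inE.
have -> : (\1_(pos n.+1) w = (0 < s n.+1 w)%R%:R :> R) by rewrite indicE posI.
rewrite mulrDr mulrC; congr (_ + _)%R.
rewrite /jump_count natr_sum mulr_sumr; apply: eq_bigr => j _.
rewrite indicE in_setI !posI.
by case: (0 < s n.+1 w)%R; case: (0 < s j w)%R; rewrite /= ?mulr0 ?mulr1.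
Qed.

Let merr k : measurable_fun setT (err k).
Proof.
apply: emeasurable_funM => //; apply: emeasurable_funD.
  by apply: emeasurable_funM => //; exact: mind.
by apply: emeasurable_sum => j; apply: mind; exact: measurableI.
Qed.

Let err_ge0 k w : (0 <= k)%R -> 0 <= err k w.
Proof.
move=> k0; rewrite errE lee_fin; apply: mulr_ge0; last exact: addr_ge0.
by rewrite mulr_ge0// ltW.
Qed.

Let int_err (k : R) : (0 <= k)%R ->
  \int[P]_w err k w = (b * (q * (k + n%:R * q)))%:E.
Proof.
move=> k0; have b0 := b_gt0; rewrite /err ge0_integralZl//; last 3 first.
- apply: emeasurable_funD.
    by apply: emeasurable_funM => //; exact: mind.
  by apply: emeasurable_sum => j; apply: mind; exact: measurableI.
- move=> w _; apply: adde_ge0; first by rewrite mule_ge0 ?lee_fin.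
  by apply: sume_ge0 => j _; rewrite lee_fin.
- by rewrite lee_fin ltW.
rewrite ge0_integralD//; last 4 first.
- by move=> w _; rewrite mule_ge0 ?lee_fin.
- by apply: emeasurable_funM => //; exact: mind.
- by move=> w _; apply: sume_ge0 => j _; rewrite lee_fin.
- by apply: emeasurable_sum => j; apply: mind; exact: measurableI.
rewrite ge0_integralZl//; last exact: mind.
rewrite (_ : \int[P]_w (\1_(pos n.+1) w)%:E = q%:E); last first.
  by rewrite integral_indic// setIT; exact: Ppos.
rewrite ge0_integral_sum//; last first.
  by move=> j; apply: mind; exact: measurableI.
rewrite (eq_bigr (fun=> (q * q)%:E)) => [|j _]; last first.
  rewrite integral_indic//; last exact: measurableI.
  rewrite setIT !posE; apply: (iid_pair s_iid); try exact: measurable_itv.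
  by have := ltn_ord j; lia.
rewrite sumEFin -(EFinM k) -EFinD -EFinM sumr_const card_ord; congr (_%:E).
rewrite -mulr_natl; lra.
Qed.

Let mmin : measurable_fun setT (fun w => (Num.min (s n.+1 w) y)%:E).
Proof. by apply/measurable_EFinP; exact: measurable_minr. Qed.

Let mband_count : measurable_fun setT
  (fun w => (band_count (Xw w) n y (s n.+1 w - b))%:R%:E : \bar R).
Proof.
rewrite (_ : (fun _ => _) = (fun w => \sum_(i < n.+1) (\1_(band i) w)%:E)).
  by apply: emeasurable_sum => i; exact: mind.
apply/funext => w; rewrite sumEFin; congr (_%:E).
rewrite /band_count natr_sum; apply: eq_bigr => i _.
by rewrite indicE; congr (nat_of_bool _)%:R; rewrite mem_setE.
Qed.

(** The first term is at most of order [q]; the error is of smaller order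
    when [b] and [b * n * q] are small. *)
Lemma ruin_by_upper :
  b%:E * P [set w | ruin_by b y n (fun j => s j w)] <=
  \int[P]_w (Num.min (s n.+1 w) y)%:E + (b * (q * (1 + n%:R * q)))%:E.
Proof.
rewrite ruin_sum -int_err// -ge0_integralZl//; last by rewrite lee_fin ltW.
rewrite -ge0_integralD//; last 2 first.
- by move=> w _; rewrite lee_fin le_min s_ge0.
- by move=> w _; exact: err_ge0.
apply: ge0_le_integral => //.
- by move=> w _; rewrite mule_ge0 ?lee_fin// ltW.
- by apply: emeasurable_funM.
- by apply: emeasurable_funD.
- move=> w _; rewrite errE -EFinM -EFinD lee_fin.
  exact: (band_count_upper b_gt0 (fun i => s_ge0 i w)).
Qed.

(** The claim [s n.+1] and the walk up to time [n] are independent, so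
    restricting to walks that have passed the level [A] costs only a factor. *)
Lemma ruin_by_lower (A : R) :
  P [set w | A <= walk b (fun i => s i w) n]%R *
    \int[P]_w (Num.min (s n.+1 w) y * (s n.+1 w <= A)%R%:R)%:E <=
  b%:E * P [set w | ruin_by b y n (fun j => s j w)] +
  (b * (q * (2 + n%:R * q)))%:E.
Proof.
pose f (x : R) : R := (A <= x)%R%:R.
pose g (x : R) : R := (Num.max 0 (Num.min x y) * (x <= A)%R%:R)%R.
have nat_bool (c : bool) : (0 <= c%:R :> R)%R by case: c.
have mle : measurable_fun setT (fun x : R => (A <= x)%R%:R : R).
  rewrite (_ : (fun _ => _) = \1_(`[A, +oo[%classic)); first exact: measurable_indic.
  apply/funext => x; rewrite indicE; congr (nat_of_bool _)%:R.
  by rewrite mem_setE in_itv/= andbT.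
have mge : measurable_fun setT (fun x : R => (x <= A)%R%:R : R).
  rewrite (_ : (fun _ => _) = \1_(`]-oo, A]%classic)); first exact: measurable_indic.
  by apply/funext => x; rewrite indicE mem_setE in_itv.
have mX : measurable_fun setT (fun w => Xw w n).
  exact: (measurableT_comp (measurable_walk b n) (measurable_path ms)).
have gE w : g (s n.+1 w) = (Num.min (s n.+1 w) y * (s n.+1 w <= A)%R%:R)%R.
  by rewrite /g max_r// le_min s_ge0.
have -> : P [set w | A <= walk b (fun i => s i w) n]%R = \int[P]_w (f (Xw w n))%:E.
  rewrite (_ : [set w | _] = (fun w => Xw w n) @^-1` `[A, +oo[); last first.
    by apply/seteqP; split => w /=; rewrite in_itv/= andbT.
  rewrite -[in LHS](setIT (_ @^-1` _)) -integral_indic//; last first.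
    by rewrite -[X in measurable X]setTI; exact: mX.
  apply: eq_integral => w _; congr (_%:E); rewrite indicE /f.
  by congr (nat_of_bool _)%:R; apply/idP/idP; rewrite inE/= in_itv/= andbT.
under [X in _ * X]eq_integral do rewrite -gE.
rewrite -(integral_prod_indep (X := fun w => Xw w n)); last 7 first.
- exact: mX.
- exact: ms.
- exact: mle.
- apply: measurable_funM => //; apply: measurable_maxr => //.
  exact: measurable_minr.
- by move=> x; exact: nat_bool.
- by move=> x; rewrite mulr_ge0// le_max lexx.
- move=> C D mC mD.
  have mC' : measurable ((fun x : path_space R => walk b x n) @^-1` C).
    by rewrite -[X in measurable X]setTI; exact: measurable_walk.
  have mD' : measurable ((fun x : path_space R => x 1%N) @^-1` D).
    by rewrite -[X in measurable X]setTI; exact: measurable_coord.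
  have := iid_past_future s_iid n mC' mD'.
  have wE w : walk b (fun i => if (i < n)%N then s i w else 0%R) n =
              walk b (fun i => s i w) n.
    by rewrite /walk; apply: eq_bigr => i _; rewrite ltn_ord.
  rewrite (_ : [set w | _] = (fun w => Xw w n) @^-1` C); last first.
    by apply/seteqP; split => w; rewrite /preimage /mkset wE.
  rewrite (_ : [set w | _] = s n.+1 @^-1` D); last first.
    by apply/seteqP; split => w; rewrite /preimage /mkset addn1.
  move=> ->; congr (_ * _); have [_ lawX _] := s_iid.
  by transitivity (P (s 1%N @^-1` D)) => //; rewrite !lawX.
rewrite ruin_sum -int_err// -ge0_integralZl//; last by rewrite lee_fin ltW.
rewrite -ge0_integralD//; last 3 first.
- by move=> w _; rewrite mule_ge0 ?lee_fin// ltW.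
- exact: emeasurable_funM.
- by move=> w _; exact: err_ge0.
apply: ge0_le_integral => //.
- by move=> w _; rewrite lee_fin mulr_ge0// /g mulr_ge0// le_max lexx.
- apply/measurable_EFinP; apply: measurable_funM.
    exact: (measurableT_comp mle mX).
  have mg : measurable_fun setT g.
    apply: measurable_funM => //.
    by apply: measurable_maxr => //; exact: measurable_minr.
  exact: (measurableT_comp mg (ms _)).
- by apply: emeasurable_funD => //; exact: emeasurable_funM.
- move=> w _; rewrite errE gE -EFinM -EFinD lee_fin /f.
  have rhs0 : (0 <= b * (band_count (Xw w) n y (s n.+1 w - b))%:R +
     b * (0 < s n.+1 w)%R%:R * (2 + (jump_count (s^~ w) n)%:R))%R.
    apply: addr_ge0; first by rewrite mulr_ge0// ltW.
    by rewrite !mulr_ge0// ?addr_ge0// ltW.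
  case: (leP A (Xw w n)) => [AX|_]; last by rewrite mul0r.
  case: (leP (s n.+1 w) A) => [sA|_]; last by rewrite !mulr0.
  rewrite mul1r mulr1 -lerBlDr.
  exact: (band_count_lower b_gt0 (fun i => s_ge0 i w) y_ge0 (s_ge0 _ w) AX sA).
Qed.
End walk_ruin.

(** * Weak law of large numbers *)

Lemma integral_cst_prob d (T : measurableType d) (R : realType)
  (P : probability T R) (r : R) : (\int[P]_w r%:E = r%:E)%E.
Proof.
rewrite integral_cst//; transitivity (r%:E * 1)%E; last by rewrite mule1.
by congr (_ * _)%E; exact: probability_setT.
Qed.

Section iid_law.
Context d (T : measurableType d) (R : realType) (P : probability T R).
Variables (s : nat -> T -> R) (mu : set R -> R).
Hypothesis s_iid : iid_with P s mu.

Lemma iid_integral i j (f : R -> R) :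
  measurable_fun setT f -> (forall x, 0 <= f x) ->
  (\int[P]_w (f (s i w))%:E = \int[P]_w (f (s j w))%:E)%E.
Proof.
move=> mf f0; have [ms lawX _] := s_iid.
pose X k : {mfun T >-> R} := HB.pack (s k) (isMeasurableFun.Build _ _ _ _ _ (ms k)).
have E k : (\int[P]_w (f (s k w))%:E = \int[distribution P (X k)]_x (f x)%:E)%E.
  by rewrite ge0_integral_distribution//; exact/measurable_EFinP.
rewrite !E; apply: eq_measure_integral => A mA _.
by transitivity (mu A)%:E; [exact: lawX|rewrite -(lawX j)].
Qed.

Lemma iid_prefix_indep (n k : nat) (h : path_space R -> R) :
  measurable_fun setT h ->
  (forall x, h (fun i => if (i < n)%N then x i else 0) = h x) ->
  forall A B, measurable A -> measurable B ->
  (P ((fun w => h (fun i => s i w)) @^-1` A `&` s (n + k)%N @^-1` B) =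
   P ((fun w => h (fun i => s i w)) @^-1` A) * P (s (n + k)%N @^-1` B))%E.
Proof.
move=> mh hE A B mA mB.
have mA' : measurable (h @^-1` A) by rewrite -[X in measurable X]setTI; exact: mh.
have mB' : measurable ((fun x : path_space R => x k) @^-1` B).
  by rewrite -[X in measurable X]setTI; exact: measurable_coord.
have := iid_past_future s_iid n mA' mB'.
rewrite (_ : [set w | _] = (fun w => h (fun i => s i w)) @^-1` A); last first.
  apply/seteqP; split => w; rewrite /preimage /mkset.
    by rewrite (hE (fun i => s i w)).
  by rewrite (hE (fun i => s i w)).
rewrite (_ : [set w | _] = s (n + k)%N @^-1` B)//.
move=> ->; congr (_ * _)%E; have [_ lawX _] := s_iid.
by transitivity (P (s k @^-1` B)) => //; rewrite !lawX.
Qed.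
End iid_law.

Section weak_law.
Context d (T : measurableType d) (R : realType) (P : probability T R).
Variables (s : nat -> T -> R) (mu : set R -> R).
Hypotheses (s_iid : iid_with P s mu) (s_ge0 : forall i w, 0 <= s i w).
Variable m : R.
Hypothesis s_mean : (\int[P]_w (s 0%N w)%:E = m%:E)%E.

Let ms i : measurable_fun setT (s i). Proof. by have [] := s_iid. Qed.

Let S n w := \sum_(i < n) s i w.

Let mS n : measurable_fun setT (S n).
Proof. by apply: measurable_sum => i. Qed.

Let S_ge0 n w : 0 <= S n w. Proof. exact: sumr_ge0. Qed.

Let lap (t : R) : \bar R := (\int[P]_w (expR (- (t * s 0%N w)))%:E)%E.

Let mexp (t : R) : measurable_fun setT (fun x : R => expR (- (t * x))).
Proof.
apply: (measurableT_comp (@measurable_expR R)).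
by apply: measurableT_comp => //; exact: mulrl_measurable.
Qed.

Let lap_fin t : 0 <= t -> exists2 l, 0 <= l & lap t = l%:E.
Proof.
move=> t0; have l0 : (0 <= lap t)%E.
  by apply: integral_ge0 => w _; rewrite lee_fin expR_ge0.
have l1 : (lap t <= 1)%E.
  rewrite -(integral_cst_prob P).
  apply: ge0_le_integral => //.
  - by apply/measurable_EFinP; exact: (measurableT_comp (mexp t) (ms 0%N)).
  - by move=> w _; rewrite lee_fin -expR0 ler_expR oppr_le0 mulr_ge0.
have lf : lap t \is a fin_num.
  by rewrite ge0_fin_numE// (le_lt_trans l1)// ltry.
by exists (fine (lap t)); [exact: fine_ge0|rewrite fineK].
Qed.

Lemma laplace_iid_sum t l n : lap t = l%:E ->
  (\int[P]_w (expR (- (t * S n w)))%:E = (l ^+ n)%:E)%E.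
Proof.
move=> lapE; elim: n => [|n IH].
  rewrite expr0 (eq_integral (fun=> 1%E)); last first.
    by move=> w _; rewrite /S big_ord0 mulr0 oppr0 expR0.
  exact: integral_cst_prob.
pose f (x : R) := expR (- (t * x)).
rewrite (eq_integral (fun w => (f (S n w) * f (s n w))%:E)); last first.
  by move=> w _; rewrite /S big_ord_recr /= mulrDr opprD expRD.
rewrite (@integral_prod_indep _ _ _ _ (S n) (s n) f f (mS n) (ms n)
  (mexp t) (mexp t) (fun=> expR_ge0 _) (fun=> expR_ge0 _)); last first.
  move=> A B mA mB.
  have := @iid_prefix_indep _ _ _ _ _ _ s_iid n 0 (fun x => \sum_(i < n) x i).
  rewrite addn0; apply => //.
    by apply: measurable_sum => i; exact: measurable_coord.
  by move=> x; apply: eq_bigr => i _; rewrite ltn_ord.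
rewrite IH (iid_integral s_iid n 0%N); [|exact: mexp|by move=> x; exact: expR_ge0].
by rewrite -/(lap t) lapE -EFinM exprSr.
Qed.

Let sint : P.-integrable setT (fun w => (s 0%N w)%:E).
Proof.
apply/integrableP; split; first exact/measurable_EFinP.
under eq_integral do rewrite abse_EFin ger0_norm//.
by rewrite s_mean ltry.
Qed.

Let expR_gap (n : nat) (x : R) : 0 <= x ->
  n%:R * (1 - expR (- (n%:R^-1 * x))) <= x <=
  n.+1%:R * (1 - expR (- (n.+1%:R^-1 * x))) + n.+1%:R^-1 * x ^+ 2.
Proof.
move=> x0; apply/andP; split.
  have [->|n0] := eqVneq n 0%N; first by rewrite mul0r.
  have n0' : 0 < n%:R :> R by rewrite ltr0n lt0n.
  rewrite -[leRHS](mulVKf (lt0r_neq0 n0')) ler_pM2l//.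
  have := expR_ge1Dx (- (n%:R^-1 * x)); lra.
have n0 : 0 < n.+1%:R :> R by [].
set u := n.+1%:R^-1 * x.
have u0 : 0 <= u by rewrite mulr_ge0// invr_ge0.
have -> : x = n.+1%:R * u by rewrite /u mulrA divff ?mul1r// lt0r_neq0.
have -> : n.+1%:R^-1 * (n.+1%:R * u) ^+ 2 = n.+1%:R * u ^+ 2.
  by rewrite exprMn (expr2 n.+1%:R) !mulrA mulVf ?lt0r_neq0// mul1r.
rewrite -mulrDr ler_pM2l//.
have h : expR (- u) * (1 + u) <= 1.
  have := expRxMexpNx_1 u; have := expR_ge1Dx u; have := expR_ge0 (- u); nra.
have := expR_ge0 (- u); nra.
Qed.

Let gap_cvg : exists2 a : nat -> R, a n @[n --> \oo] --> m &
  forall n l, lap n%:R^-1 = l%:E -> a n = n%:R * (1 - l).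
Proof.
pose g n w : \bar R := (n%:R * (1 - expR (- (n%:R^-1 * s 0%N w))))%:E.
have mg n : measurable_fun setT (g n).
  apply/measurable_EFinP; apply: measurable_funM => //.
  by apply: measurable_funB => //; exact: (measurableT_comp (mexp _) (ms 0%N)).
have ge1 n w : 0 <= 1 - expR (- (n%:R^-1 * s 0%N w)).
  by rewrite subr_ge0 -expR0 ler_expR oppr_le0 mulr_ge0// invr_ge0.
have cvg_g w : g ^~ w @ \oo --> (s 0%N w)%:E.
  apply/cvg_EFin; first by near=> n.
  apply/(@cvgrPdist_le _ R^o) => /= e e0.
  near=> n.
  have /andP[h1 _] := expR_gap n (s_ge0 0%N w).
  rewrite /= ger0_norm ?subr_ge0//.
  have n0 : (0 < n)%N by near: n; exists 1%N.
  have /andP[_ h2] := expR_gap n.-1 (s_ge0 0%N w).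
  rewrite prednK// in h2.
  have : n%:R^-1 * s 0%N w ^+ 2 <= e.
    rewrite mulrC ler_pdivrMr ?ltr0n// -ler_pdivrMl//.
    by near: n; exact: nbhs_infty_ger.
  lra.
have dom_g w n : (`|g n w| <= (s 0%N w)%:E)%E.
  rewrite /g abse_EFin lee_fin ger0_norm; last by rewrite mulr_ge0.
  by have /andP[] := expR_gap n (s_ge0 0%N w).
have [_ _ cv] := dominated_convergence measurableT mg
  ((measurable_EFinP _ _).2 (ms 0%N)) (aeW _ (fun w _ => cvg_g w)) sint
  (aeW _ (fun w n _ => dom_g w n)).
have {}cv : (\int[P]_w g n w)%E @[n --> \oo] --> m%:E by rewrite -s_mean.
exists (fun n => fine (\int[P]_w g n w)%E); first exact: fine_cvg cv.
move=> n l lE.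
have H (u : R) : ((n%:R * (1 - u))%:E + n%:R%:E * u%:E = n%:R%:E)%E.
  by rewrite -(EFinM n%:R u) -EFinD -mulrDr subrK mulr1.
have : (\int[P]_w g n w + (n%:R * l)%:E = n%:R%:E)%E.
  have me : measurable_fun setT (fun w => (expR (- (n%:R^-1 * s 0%N w)))%:E).
    by apply/measurable_EFinP; exact: (measurableT_comp (mexp _) (ms 0%N)).
  rewrite EFinM -lE -ge0_integralZl// -ge0_integralD//; last 2 first.
  - by move=> w _; rewrite lee_fin mulr_ge0.
  - exact: emeasurable_funM.
  rewrite -[RHS](integral_cst_prob P n%:R); apply: eq_integral => w _.
  exact: H.
case: (\int[P]_w g n w)%E => [r| |]//=.
by rewrite -EFinD => -[]; lra.
Unshelve. all: by end_near. Qed.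

Let mean_sum n : (\int[P]_w (S n w)%:E = (n%:R * m)%:E)%E.
Proof.
under eq_integral do rewrite -sumEFin.
rewrite ge0_integral_sum//; last 2 first.
- by move=> i; exact/measurable_EFinP.
- by move=> i w _; rewrite lee_fin.
rewrite (eq_bigr (fun=> m%:E)) => [|i _].
  by rewrite sumEFin sumr_const card_ord mulr_natl.
pose f (x : R) := Num.max x 0.
have fE j w : f (s j w) = s j w by rewrite /f max_l.
have mf : measurable_fun setT f by exact: measurable_maxr.
have f0 x : 0 <= f x by rewrite le_max lexx orbT.
transitivity (\int[P]_w (f (s i w))%:E)%E.
  by apply: eq_integral => w _; rewrite fE.
rewrite (iid_integral s_iid i 0%N mf f0) -s_mean.
by apply: eq_integral => w _; rewrite fE.
Qed.

(** Only first moments are available, so the variance is replaced by the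
    mean of the convex function [phi], the gap at [m] between [exp (- v)]
    and its tangent. It is nonnegative, at least [phi k > 0] beyond [k > m],
    and its mean at [S n / n] tends to [0] because [E exp (- S n / n)], the
    [n]-th power of the Laplace transform at [1 / n], tends to [exp (- m)]. *)
Lemma walk_to_infinity b A : m < b ->
  P [set w | A <= walk b (fun i => s i w) n] @[n --> \oo] --> 1%E.
Proof.
move=> mb; pose k := (m + b) / 2.
have mk : m < k by rewrite /k; lra.
have kb : k < b by rewrite /k; lra.
pose phi (v : R) := expR (- v) - expR (- m) + expR (- m) * (v - m).
have phi_ge0 v : 0 <= phi v.
  have : expR (- v) = expR (- m) * expR (m - v).
    by rewrite -expRD; congr expR; lra.
  have := expR_ge1Dx (m - v); have := expR_gt0 (- m); rewrite /phi; nra.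
have phi_incr v : k <= v -> phi k <= phi v.
  move=> kv.
  have h : expR (- v) = expR (- k) * expR (k - v).
    by rewrite -expRD; congr expR; lra.
  have := expR_ge1Dx (k - v); have := expR_gt0 (- k).
  have : expR (- k) <= expR (- m) by rewrite ler_expR; lra.
  rewrite /phi h; nra.
have phik : 0 < phi k.
  have h : expR (- k) = expR (- m) * expR (m - k).
    by rewrite -expRD; congr expR; lra.
  have := @expR_gt1Dx R (m - k); have := expR_gt0 (- m).
  have mk0 : m - k != 0 by apply/eqP; lra.
  by rewrite /phi h => ? /(_ mk0); nra.
have [a acvg aE] := gap_cvg.
have bound n : (0 < n)%N ->
    (P [set w | k * n%:R <= S n w]%R <=
     ((expR (- a n) - expR (- m)) / phi k)%:E)%E.
  move=> n0; have n0' : 0 < n%:R :> R by rewrite ltr0n.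
  have t0 : 0 <= n%:R^-1 :> R by rewrite invr_ge0 ltW.
  have [l l0 lE] := lap_fin t0.
  have lexp : l ^+ n <= expR (- a n).
    rewrite (aE n l lE) -mulrN opprB expRM_natl lerXn2r ?nnegrE ?expR_ge0//.
    by have := expR_ge1Dx (l - 1); lra.
  pose Y w := n%:R^-1 * S n w.
  have mY : measurable_fun setT Y by exact: measurable_funM.
  have mA : measurable [set w | k * n%:R <= S n w].
    by rewrite -[X in measurable X]setTI; exact: measurable_fun_ler.
  have mphi : measurable_fun setT (fun w => phi (Y w)).
    apply: measurable_funD.
      apply: measurable_funB => //.
      by apply: (measurableT_comp (@measurable_expR R)); exact: measurableT_comp.
    by apply: measurable_funM => //; exact: measurable_funB.
  have phiE : (\int[P]_w (phi (Y w))%:E = (l ^+ n - expR (- m))%:E)%E.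
    have em : 0 <= expR (- m) :> R by exact: expR_ge0.
    have m0 : 0 <= m.
      by rewrite -lee_fin -s_mean integral_ge0// => w _; rewrite lee_fin.
    have mexpY : measurable_fun setT (fun w => (expR (- Y w))%:E).
      apply/measurable_EFinP; apply: (measurableT_comp (@measurable_expR R)).
      exact: measurableT_comp.
    have lapY : (\int[P]_w (expR (- Y w))%:E = (l ^+ n)%:E)%E.
      exact: laplace_iid_sum.
    have : (\int[P]_w (phi (Y w))%:E + ((1 + m) * expR (- m))%:E =
            (l ^+ n)%:E + (expR (- m) * n%:R^-1 * (n%:R * m))%:E)%E.
      rewrite [X in (_ + X = _)%E](_ : _ = \int[P]_w ((1 + m) * expR (- m))%:E)%E;
        last by rewrite integral_cst_prob.
      rewrite -lapY (EFinM _ (n%:R * m)) -mean_sum.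
      have mSE : measurable_fun setT (fun w => (S n w)%:E) by exact/measurable_EFinP.
      have mphiE : measurable_fun setT (fun w => (phi (Y w))%:E).
        exact/measurable_EFinP.
      have SE0 w : setT w -> (0 <= (S n w)%:E)%E by rewrite lee_fin.
      have phiE0 w : setT w -> (0 <= (phi (Y w))%:E)%E by rewrite lee_fin.
      have c0 : 0 <= expR (- m) * n%:R^-1 by rewrite mulr_ge0.
      have mcS : measurable_fun setT (fun w => (expR (- m) * n%:R^-1)%:E * (S n w)%:E)%E.
        exact: emeasurable_funM.
      have cS0 w : setT w -> (0 <= (expR (- m) * n%:R^-1)%:E * (S n w)%:E)%E.
        by move=> _; rewrite -EFinM lee_fin mulr_ge0.
      have cc0 : 0 <= (1 + m) * expR (- m) by rewrite mulr_ge0// addr_ge0.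
      rewrite -ge0_integralZl// -!ge0_integralD//.
      apply: eq_integral => w _.
      rewrite -(EFinM (expR (- m) * n%:R^-1) (S n w)) -!EFinD; congr (_%:E).
      by rewrite -mulrA -/(Y w) /phi; lra.
    case: (\int[P]_w (phi (Y w))%:E)%E => [r| |]//=.
    rewrite -!EFinD => -[] h; congr (_%:E).
    have : expR (- m) * n%:R^-1 * (n%:R * m) = expR (- m) * m.
      by rewrite -mulrA mulKf// lt0r_neq0.
    by move: h; lra.
  have [p pE] : exists p : R, P [set w | k * n%:R <= S n w] = p%:E.
    by exists (fine (P [set w | k * n%:R <= S n w])); rewrite fineK// fin_num_measure.
  rewrite pE lee_fin ler_pdivlMr//.
  have : ((phi k)%:E * P [set w | (k * n%:R <= S n w)%R] <= \int[P]_w (phi (Y w))%:E)%E.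
    have PE : P [set w | k * n%:R <= S n w] =
        (\int[P]_w (\1_[set w | k * n%:R <= S n w] w)%:E)%E.
      by rewrite integral_indic// setIT.
    have mI : measurable_fun setT
        (fun w => (\1_[set w | k * n%:R <= S n w] w)%:E : \bar R).
      by apply/measurable_EFinP; exact: measurable_indic.
    have mphiE : measurable_fun setT (fun w => (phi (Y w))%:E).
      exact/measurable_EFinP.
    have pk0 : (0 <= (phi k)%:E)%E by rewrite lee_fin.
    rewrite PE -ge0_integralZl//.
    apply: ge0_le_integral => //.
    - by move=> w _; rewrite -EFinM lee_fin mulr_ge0.
    - exact: emeasurable_funM.
    - move=> w _; rewrite -EFinM lee_fin indicE.
      have [|_] := boolP (w \in _); last by rewrite mulr0.
      rewrite inE /= => kS; rewrite mulr1; apply: phi_incr.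
      by rewrite /Y [leRHS]mulrC ler_pdivlMr.
  rewrite pE phiE -EFinM lee_fin mulrC; lra.
have walkE n w : walk b (fun i => s i w) n = n%:R * b - S n w.
  by rewrite /walk sumrB sumr_const card_ord mulr_natl.
have mwalk n : measurable [set w | A <= walk b (fun i => s i w) n].
  rewrite -[X in measurable X]setTI; apply: measurable_fun_ler => //.
  by apply: measurable_sum => i; exact: measurable_funB.
pose lower n : R := 1 - (expR (- a n) - expR (- m)) / phi k.
have low1 : lower n @[n --> \oo] --> (1 : R).
  rewrite -[X in _ --> X](_ : 1 - (expR (- m) - expR (- m)) / phi k = 1); last first.
    by rewrite subrr mul0r subr0.
  apply: cvgB; first exact: cvg_cst.
  apply: cvgMl; apply: cvgB; last exact: cvg_cst.
  apply: continuous_cvg; first exact: continuous_expR.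
  exact: cvgN.
apply: (@squeeze_cvge _ _ _ _ (fun n => (lower n)%:E) _ (fun=> 1%E)).
- near=> n; rewrite probability_le1// andbT.
  have n0 : (0 < n)%N by near: n; exists 1%N.
  have mkS : measurable [set w | k * n%:R <= S n w].
    by rewrite -[X in measurable X]setTI; exact: measurable_fun_ler.
  apply: (@le_trans _ _ (P (~` [set w | k * n%:R <= S n w]))).
    rewrite probability_setC// /lower EFinB leeB// bound//.
  apply: le_measure; rewrite ?inE//; first exact: measurableC.
  move=> w /= /negP; rewrite -ltNge walkE => Sk.
  have : A <= n%:R * (b - k).
    rewrite -ler_pdivrMr ?subr_gt0//.
    by near: n; exact: nbhs_infty_ger.
  lra.
- by apply/cvg_EFin => //; near=> n.
- exact: cvg_cst.
Unshelve. all: by end_near. Qed.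
End weak_law.

(** * From a path to its skeletons *)

Section skeleton_path.
Context (R : realType).

Definition right_locally_constant (S : R -> R) := forall t : R, 0 <= t ->
  exists2 eta : R, 0 < eta & forall s : R, t <= s -> s < t + eta -> S s = S t.

Lemma walk_increments (S : R -> R) (c delta : R) i : S 0 = 0 ->
  walk (c * delta) (fun j => S (j.+1%:R * delta) - S (j%:R * delta)) i =
  c * (i%:R * delta) - S (i%:R * delta).
Proof.
move=> S0; elim: i => [|i IH]; first by rewrite walk0 mul0r S0; lra.
by rewrite walkS IH -natr1; lra.
Qed.

(** Let [tau] be the ruin time. Since the path is constant just after [tau],
    the jump that causes ruin happens at [tau] itself and the surplus is
    negative there. A fine skeleton sees nothing before [tau], because its
    drift is at least [c], and at its first grid point after [tau] it sees
    the same jump, with a deficit that is smaller by a vanishing amount. A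
    smaller deficit cannot spoil the comparison with [y] in the limit,
    because the inequality on the deficit is not strict. *)
Lemma skeleton_ruin_cvg (S : R -> R) (c y : R) (cm dm : nat -> R) (nm : nat -> nat) :
  S 0 = 0 -> right_locally_constant S -> 0 < c -> 0 <= y ->
  (forall m, c <= cm m) -> (forall m, 0 < dm m) ->
  cm m @[m --> \oo] --> c -> dm m @[m --> \oo] --> (0 : R) ->
  (forall t : R, \forall m \near \oo, t <= (nm m)%:R * dm m) ->
  let E := [set t | 0 < t /\ c * t - S t < 0] in
  let tau := ereal_inf [set t%:E | t in E] in
  \forall m \near \oo,
    ruin_by (cm m * dm m) y (nm m)
      (fun j => S (j.+1%:R * dm m) - S (j%:R * dm m)) <->
    ((tau < +oo)%E /\ `|c * fine tau - S (fine tau)| <= y).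
Proof.
move=> S0 Sr c0 y0 ccm dm0 cmc dmc nmc E tau.
have [[t0 Et0]|E0] := pselect (E !=set0); last first.
  have tauE : tau = +oo%E.
    rewrite /tau (_ : [set t%:E | t in E] = set0) ?ereal_inf0//.
    by apply/seteqP; split => // x [t Et _]; case: E0; exists t.
  near=> m; split; last by rewrite tauE ltxx => -[].
  move=> [i _ [_ /andP[_]]]; rewrite walk_increments// => neg; exfalso.
  apply: E0; exists (i.+1%:R * dm m); split; first by rewrite mulr_gt0.
  apply: le_lt_trans neg; rewrite lerD2r ler_wpM2r// mulr_ge0// ltW//.
have lbE : has_lbound E by exists 0 => t [t1 _]; exact: ltW.
have infE : has_inf E by split => //; exists t0.
set ti := inf E.
have tauE : tau = ti%:E by rewrite /tau ereal_inf_EFin//; exists t0.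
have ti0 : 0 <= ti.
  by apply: lb_le_inf; [exists t0|move=> t [t1 _]; exact: ltW].
have before (t : R) : 0 < t -> t < ti -> 0 <= c * t - S t.
  move=> t1 t2; rewrite leNgt; apply/negP => neg.
  have : ti <= t by apply: ge_inf.
  by rewrite leNgt t2.
have [eta eta0 Seta] := Sr ti ti0.
have neg : c * ti < S ti.
  have [t [t1 t2] t3] := inf_adherent eta0 infE.
  have tit : ti <= t by apply: ge_inf.
  rewrite -(Seta t)//; apply: (@le_lt_trans _ _ (c * t)); last by rewrite -subr_lt0.
  by rewrite ler_pM2l.
have ti1 : 0 < ti.
  rewrite lt_neqAle ti0 andbT; apply/eqP => ti00.
  by move: neg; rewrite -ti00 S0 mulr0 ltxx.
rewrite tauE ltry /=; clearbody ti.
have cvgg : cm m * (ti + dm m) @[m --> \oo] --> c * ti.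
  rewrite -[X in _ --> c * X]addr0.
  by apply: cvgM => //; apply: cvgD => //; exact: cvg_cst.
have near_y : \forall m \near \oo,
    y < S ti - c * ti -> cm m * (ti + dm m) < S ti - y.
  have [h|h] := ltP y (S ti - c * ti); last by apply: nearW.
  have h' : c * ti < S ti - y by rewrite ltrBrDr -ltrBrDl.
  by apply: filterS (cvgr_lt _ cvgg _ h').
near=> m.
have cm0 : 0 < cm m := lt_le_trans c0 (ccm m).
have d_eta : dm m < eta.
  by near: m; apply: (cvgr_lt 0).
have g_neg : cm m * (ti + dm m) < S ti.
  by near: m; apply: (cvgr_lt (c * ti)).
have g_y : y < S ti - c * ti -> cm m * (ti + dm m) < S ti - y.
  by near: m; exact: near_y.
have T_big : ti <= (nm m)%:R * dm m by near: m; exact: nmc.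
have ex : exists j, ti <= j%:R * dm m by exists (nm m).
(* [i.+1] is the first grid point at or after the ruin time [ti] *)
case: (ex_minnP ex) => -[|i]; first by rewrite mul0r leNgt ti1.
move=> hi imin.
have i_lt : i%:R * dm m < ti.
  by rewrite ltNge; apply/negP => /imin; rewrite ltnn.
have i_n : (i <= nm m)%N.
  have : i%:R * dm m < (nm m)%:R * dm m by exact: lt_le_trans T_big.
  by rewrite ltr_pM2r// ltr_nat => /ltnW.
have iS : i.+1%:R * dm m < ti + dm m by rewrite -natr1 mulrDl mul1r ltrD2r.
have SiE : S (i.+1%:R * dm m) = S ti.
  by apply: Seta => //; apply: lt_trans iS _; rewrite ltrD2l.
have walk_ge j : (j <= i)%N -> 0 <= cm m * (j%:R * dm m) - S (j%:R * dm m).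
  case: j => [_|j ji]; first by rewrite mul0r mulr0 S0 subr0.
  have j0 : 0 < j.+1%:R * dm m by rewrite mulr_gt0.
  have jt : j.+1%:R * dm m < ti.
    by apply: le_lt_trans i_lt; rewrite ler_pM2r// ler_nat.
  apply: le_trans (before _ j0 jt) _.
  by rewrite lerD2r ler_wpM2r// ltW.
have walk_lt : cm m * (i.+1%:R * dm m) - S (i.+1%:R * dm m) < 0.
  rewrite SiE subr_lt0; apply: lt_trans g_neg.
  by rewrite ltr_pM2l.
have cti : c * ti <= cm m * (i.+1%:R * dm m).
  by apply: ler_pM => //; exact: ltW.
have -> : `|c * ti - S ti| = S ti - c * ti.
  by rewrite ltr0_norm ?subr_lt0// opprB.
split.
- move=> [j jn [h1 /andP[h2 h3]]].
  have ji : j = i.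
    case: (ltngtP j i) => // [ji|ij].
      have := walk_ge j.+1 ji; move: h3; rewrite walk_increments// => h3.
      by rewrite leNgt h3.
    by have := h1 i.+1 ij; rewrite walk_increments// leNgt walk_lt.
  move: h2; rewrite ji walk_increments// SiE => h2.
  split => //; rewrite leNgt; apply/negP => /g_y g.
  have : cm m * (i.+1%:R * dm m) < cm m * (ti + dm m) by rewrite ltr_pM2l.
  lra.
- move=> [_ dy]; exists i => //; split => [j ji|]; rewrite walk_increments//.
    exact: walk_ge.
  by rewrite walk_lt andbT SiE; lra.
Unshelve. all: by end_near. Qed.

(** An integer-valued right-continuous function is constant on a right
    neighbourhood of each point, and a right-continuous nondecreasing time
    change does not leave that neighbourhood at once. *)
Lemma right_locally_constant_time_change (M : R -> nat) (D : R -> R) :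
  D 0 = 0 -> (forall s t : R, 0 <= s -> s <= t -> D s <= D t) ->
  (forall t : R, 0 <= t -> D s @[s --> t^'+] --> D t) ->
  (forall t : R, 0 <= t -> (M s)%:R @[s --> t^'+] --> ((M t)%:R : R)) ->
  forall t : R, 0 <= t -> exists2 eta : R, 0 < eta &
    forall s : R, t <= s -> s < t + eta -> M (D s) = M (D t).
Proof.
move=> D00 Dmono Dr Mr t t0.
have Dt0 : 0 <= D t by rewrite -D00; exact: Dmono.
have /(@cvgrPdist_lt _ R^o) /(_ 1 ltr01) := Mr _ Dt0.
rewrite near_withinE => /nbhs_ballP[/= e e0 He].
have Mconst (s : R) : D t <= s -> s < D t + e -> M s = M (D t).
  rewrite le_eqVlt => /predU1P[<-//|ts se].
  have : `|(M (D t))%:R - (M s)%:R| < 1 :> R.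
    apply: He => //=; rewrite /ball /= ltr_norml; lra.
  rewrite ltr_norml => /andP[h1 h2].
  move: (M s) (M (D t)) h1 h2 => p q h1 h2.
  case: (ltngtP p q) => // h.
    have : p%:R + 1 <= q%:R :> R by rewrite natr1 ler_nat.
    by move=> ?; exfalso; lra.
  have : q%:R + 1 <= p%:R :> R by rewrite natr1 ler_nat.
  by move=> ?; exfalso; lra.
have /(@cvgrPdist_lt _ R^o) /(_ e e0) := Dr _ t0.
rewrite near_withinE => /nbhs_ballP[/= eta eta0 Heta].
exists eta => // s; rewrite le_eqVlt => /predU1P[<-//|ts se].
have Dts : D t <= D s by apply: Dmono => //; exact: ltW.
apply: Mconst => //.
have : `|D t - D s| < e.
  apply: Heta => //=; rewrite /ball /= ltr_norml; lra.
rewrite ltr_norml; lra.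
Qed.
End skeleton_path.

(** * Increments of the time-changed counting process *)

Lemma measurable_truncn_eq (R : realType) (v : nat) :
  measurable ((@Num.truncn R) @^-1` [set v]).
Proof.
case: v => [|v].
  rewrite (_ : _ @^-1` _ = `]-oo, 1%R[%classic); first exact: measurable_itv.
  apply/seteqP; split => x /=; rewrite in_itv/=.
    by move=> h; rewrite ltNge -[X in X <= _]/(1%:R) -truncn_gt_nat h.
  by move=> h; apply/eqP; rewrite -leqn0 leqNgt truncn_gt_nat -ltNge.
rewrite (_ : _ @^-1` _ = `[v.+1%:R, v.+2%:R[%classic); first exact: measurable_itv.
apply/seteqP; split => x /=; rewrite in_itv/=.
  move=> h; have x0 : 0 <= x.
    rewrite leNgt; apply/negP => x0; have : (0 < Num.truncn x)%N by rewrite h.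
    by rewrite truncn_gt_nat; lra.
  by rewrite -h truncn_itv.
exact: truncn_def.
Qed.

Lemma sigma_family_measurable_fun d d' (T : measurableType d)
    (T' : measurableType d') (I : Type) (J : set I) (X : I -> T -> T') i : J i ->
  @measurable_fun _ _ (g_sigma_algebraType [set A | exists i, J i /\
         exists2 B, measurable B & A = X i @^-1` B]) T' setT (X i).
Proof.
move=> Ji _ B mB; rewrite setTI; apply: sub_sigma_algebra.
by exists i; split => //; exists B.
Qed.

Lemma sigma_family_bigcap d d' (T : measurableType d) (T' : measurableType d')
    (I : Type) (J : set I) (X : I -> T -> T') (r : nat) (F : nat -> set T) :
  (forall j, (j < r)%N -> sigma_family J X (F j)) ->
  sigma_family J X (\bigcap_(j in [set j | (j < r)%N]) F j).
Proof.
move=> mF; exact: (@bigcap_measurableType _ (g_sigma_algebraType _)).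
Qed.

Section subordination.
Context d (T : measurableType d) (R : realType) (P : probability T R).
Variables (k : nat) (lambda : 'I_k -> R) (M : R -> T -> nat) (D : R -> T -> R).
Hypotheses (M_gcp : counting_process P lambda M) (D_levy : levy_process P D)
  (D_mono : forall w s t, 0 <= s -> s <= t -> D s w <= D t w)
  (MD_indep : independent_sigma P
       (sigma_family [set t | 0 <= t] M) (sigma_family [set t | 0 <= t] D)).

Definition gcp_pmf (lambda : 'I_k -> R) (n : nat) (t : R) : R :=
  \sum_(x in Omega k n)
    (\prod_(i < k) ((lambda i * t) ^+ x i / (x i)`!%:R))
       * expR (- (\sum_(i < k) lambda i) * t).

Let p := gcp_pmf lambda.

Lemma measurable_counting t n : 0 <= t -> measurable (M t @^-1` [set n]).
Proof.
move=> t0; have [[mM _ _ _ _] _] := M_gcp.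
rewrite (_ : _ @^-1` _ = (fun w => (M t w)%:R) @^-1` [set n%:R : R]).
  by rewrite -[X in measurable X]setTI; exact: mM.
by apply/seteqP; split => w /= => [->//|/eqP]; rewrite eqr_nat => /eqP.
Qed.

Lemma gcp_pmfE t n : 0 <= t -> P (M t @^-1` [set n]) = (p n t)%:E.
Proof. by move=> t0; have [_ H] := M_gcp; exact: H. Qed.

Lemma gcp_pmf_ge0 n t : 0 <= t -> 0 <= p n t.
Proof. by move=> t0; rewrite -lee_fin -gcp_pmfE. Qed.

Lemma gcp_pmf_le1 n t : 0 <= t -> p n t <= 1.
Proof.
move=> t0; rewrite -lee_fin -gcp_pmfE//; apply: probability_le1.
exact: measurable_counting.
Qed.

Lemma gcp_pmf_sum t : 0 <= t -> (\sum_(n <oo) (p n t)%:E = 1)%E.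
Proof.
move=> t0; rewrite -[RHS](@probability_setT _ _ _ P).
rewrite (@prob_sum_partition _ _ _ P setT (M t))//; last first.
  by move=> n; exact: measurable_counting.
by apply: eq_eseriesr => n _; rewrite setTI gcp_pmfE.
Qed.

Lemma continuous_gcp_pmf n : continuous (p n).
Proof.
move=> t; rewrite /p /gcp_pmf; apply: cvg_big => [|x _]; first exact: add_continuous.
apply: cvgM.
  apply: cvg_big => [|i _]; first exact: mul_continuous.
  apply: cvgM; last exact: cvg_cst.
  rewrite exprMn; under eq_cvg do rewrite exprMn.
  by apply: cvgM; [exact: cvg_cst|exact: exprn_continuous].
apply: continuous_cvg; first exact: continuous_expR.
by apply: cvgM => //; exact: cvg_cst.
Qed.

Lemma measurable_gcp_pmf n : measurable_fun setT (p n).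
Proof. by apply: continuous_measurable_fun; exact: continuous_gcp_pmf. Qed.

(** The increments are independent and stationary as real numbers; equations
    between counts are events on them. *)
Lemma gcp_increments (u : nat -> R) (n : nat -> nat) r :
  0 <= u 0%N -> (forall j, u j <= u j.+1) ->
  P (\bigcap_(j in [set j | (j < r)%N])
      [set w | M (u j.+1) w = (M (u j) w + n j)%N]) =
  (\prod_(0 <= j < r) p (n j) (u j.+1 - u j))%:E.
Proof.
move=> u0 uS; have [[mM M0 indM statM _] _] := M_gcp.
have u_ge0 j : 0 <= u j.
  by elim: j => // j IH; exact: le_trans (uS j).
have := indM u u0 uS (iota 0 r) (fun j => [set (n j)%:R]) (iota_uniq _ _).
rewrite (_ : \bigcap_(i in _) _ = \bigcap_(j in [set j | (j < r)%N])
      [set w | M (u j.+1) w = (M (u j) w + n j)%N]); last first.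
  apply/seteqP; split => [w h j /= jr|w h j].
    have := h j; rewrite /= mem_iota add0n /= => /(_ jr) /eqP.
    by rewrite subr_eq -natrD eqr_nat addnC => /eqP.
  rewrite /= mem_iota add0n /= => jr.
  by rewrite (h j jr) natrD addrAC subrr add0r.
move=> -> //; congr (_%:E); rewrite /index_iota subn0; apply: eq_bigr => j _.
pose t := u j.+1 - u j.
have t0 : 0 <= t by rewrite subr_ge0.
have := statM (u j) t (u_ge0 j) t0 [set (n j)%:R] (measurable_set1 _).
rewrite (_ : u j + t = u j.+1); last by rewrite /t; lra.
rewrite /preimage => ->.
rewrite (_ : [set w | _] = M t @^-1` [set n j]).
  by rewrite gcp_pmfE.
by apply/seteqP; split => w /= => [/eqP|->//]; rewrite eqr_nat => /eqP.
Qed.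

Section grid.
Variable delta : R.
Hypothesis delta_ge0 : 0 <= delta.

Let Del j w := D (j.+1%:R * delta) w - D (j%:R * delta) w.
(** The increments of the subordinator on the grid are rounded up to
    multiples of [1 / q.+1]: [V] is the rounded-down numerator, [W] the
    position after [j] rounded-up increments, and [Dq] the resulting
    discrete subordinator. Rounding up makes the approximation come from the
    right, the side on which [M] is continuous. *)
Let V q j w := Num.truncn (q.+1%:R * Del j w).
Let W q j w := (\sum_(i < j) (V q i w).+1)%N.
Let Dq q j w : R := (W q j w)%:R / q.+1%:R.

Let grid_ge0 j : 0 <= j%:R * delta. Proof. exact: mulr_ge0. Qed.

Let D0 w : D 0 w = 0. Proof. by have [_ /(_ w) [] ] := D_levy. Qed.

Let Del_ge0 j w : 0 <= Del j w.
Proof. by rewrite subr_ge0 D_mono// ler_wpM2r// ler_nat. Qed.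

Let sumDel j w : \sum_(i < j) Del i w = D (j%:R * delta) w.
Proof.
elim: j => [|j IH]; first by rewrite big_ord0 mul0r D0.
by rewrite big_ord_recr /= IH addrC subrK.
Qed.

Let D_le_Dq q j w : D (j%:R * delta) w <= Dq q j w.
Proof.
rewrite /Dq ler_pdivlMr// -sumDel /W natr_sum mulr_suml; apply: ler_sum => i _.
by rewrite mulrC ltW// truncnS_gt.
Qed.

Let Dq_le q j w : Dq q j w <= D (j%:R * delta) w + j%:R / q.+1%:R.
Proof.
rewrite /Dq ler_pdivrMr// mulrDl -sumDel /W natr_sum mulr_suml.
rewrite divfK// -[X in _ <= _ + X%:R](card_ord j) -sum1_card natr_sum -big_split/=.
apply: ler_sum => i _; rewrite -natr1 lerD2r mulrC.
by rewrite truncn_le mulr_ge0.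
Qed.

Let M_right_const w t : 0 <= t -> exists2 eta : R, 0 < eta &
  forall s : R, t <= s -> s < t + eta -> M s w = M t w.
Proof.
have [[_ M0 _ _ _] _] := M_gcp; have [_ [Mr _]] := M0 w.
apply: (@right_locally_constant_time_change R (M ^~ w) id) => //.
by move=> s s0; exact: cvg_at_right_filter.
Qed.

Let M_Dq_cvg j w : \forall q \near \oo, M (Dq q j w) w = M (D (j%:R * delta) w) w.
Proof.
have Dj0 : 0 <= D (j%:R * delta) w by rewrite -(D0 w) D_mono.
have [eta eta0 H] := M_right_const w Dj0.
near=> q; apply: H => //; apply: le_lt_trans (Dq_le q j w) _.
rewrite ltrD2l ltr_pdivrMr// mulrC -ltr_pdivrMr//.
apply: lt_trans (_ : q%:R < _); last by rewrite ltr_nat.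
by near: q; exact: nbhs_infty_gtr.
Unshelve. all: by end_near. Qed.

Let mDel j : measurable_fun setT (Del j).
Proof. by have [mD _ _ _ _] := D_levy; apply: measurable_funB; exact: mD. Qed.

Let mlevel q v : measurable [set x : R | Num.truncn (q.+1%:R * x) = v].
Proof.
rewrite (_ : [set x | _] = ( *%R q.+1%:R) @^-1` (@Num.truncn R @^-1` [set v]))//.
rewrite -[X in measurable X]setTI; apply: mulrl_measurable => //.
exact: measurable_truncn_eq.
Qed.

Let mV q j v : measurable (V q j @^-1` [set v]).
Proof.
rewrite -[X in measurable X]setTI.
exact: (mDel j measurableT (mlevel q v)).
Qed.

Let levelP q v := fine (P (V q 0 @^-1` [set v])).

Let V_law q (v : nat -> nat) r :
  P (\bigcap_(j in [set j | (j < r)%N]) V q j @^-1` [set v j]) =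
  (\prod_(0 <= j < r) levelP q (v j))%:E.
Proof.
have [mD _ indD statD _] := D_levy.
have mono j : j%:R * delta <= j.+1%:R * delta by rewrite ler_wpM2r// ler_nat.
have := indD (fun j => j%:R * delta) (grid_ge0 0%N) mono (iota 0 r)
  (fun j => [set x : R | Num.truncn (q.+1%:R * x) = v j]) (iota_uniq _ _)
  (fun j => mlevel q (v j)).
rewrite (_ : \bigcap_(i in _) _ =
  \bigcap_(j in [set j | (j < r)%N]) V q j @^-1` [set v j]); last first.
  apply/seteqP; split => [w h j /= jr|w h j].
    by have := h j; rewrite /= mem_iota add0n; apply.
  by rewrite /= mem_iota add0n /= => jr; exact: h.
move=> ->; congr (_%:E); rewrite /index_iota subn0; apply: eq_bigr => j _.
congr fine; have := statD (j%:R * delta) delta (grid_ge0 j) delta_ge0 _ (mlevel q (v j)).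
rewrite (_ : j%:R * delta + delta = j.+1%:R * delta); last first.
  by rewrite -natr1 mulrDl mul1r.
rewrite /preimage => ->; congr (P _); apply/seteqP.
by split => w; rewrite /V /Del /= mul1r mul0r D0 subr0.
Qed.

Let mW q j a : measurable (W q j @^-1` [set a]).
Proof.
elim: j a => [a|j IH a].
  rewrite (_ : _ @^-1` _ = [set w | 0%N = a]); last first.
    by apply/seteqP; split => w; rewrite /W /= big_ord0.
  by case: (eqVneq 0%N a) => [->|/eqP h]; [rewrite (_ : [set _ | _] = setT)|
    rewrite (_ : [set _ | _] = set0)] => //; apply/seteqP; split => // w /=.
rewrite (_ : _ @^-1` _ = \bigcup_v (V q j @^-1` [set v] `&`
    (if (v < a)%N then W q j @^-1` [set (a - v.+1)%N] else set0))).
  apply: bigcupT_measurable => v; apply: measurableI => //; case: ifP => _; last exact: measurable0.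
  exact: IH.
apply/seteqP; split => w; rewrite /W /= big_ord_recr/=.
  by move=> aE; exists (V q j w) => //; split => //; case: ifP => /=; lia.
by move=> [v _ [/= Vv]]; case: ifP => //= va; rewrite /W /= => ->; lia.
Qed.

Let mMDq q j n : measurable [set w | M (Dq q j w) w = n].
Proof.
rewrite (_ : [set w | _] = \bigcup_a (W q j @^-1` [set a] `&`
    M (a%:R / q.+1%:R) @^-1` [set n])).
  apply: bigcupT_measurable => a; apply: measurableI => //.
  by apply: measurable_counting; rewrite divr_ge0.
apply/seteqP; split => w /=; first by move=> h; exists (W q j w).
by move=> [a _ [/= <-]].
Qed.

Let mA q j n : measurable [set w | M (Dq q j.+1 w) w = (M (Dq q j w) w + n)%N].
Proof.
rewrite (_ : [set w | _] = \bigcup_a ([set w | M (Dq q j.+1 w) w = (a + n)%N] `&`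
    [set w | M (Dq q j w) w = a])).
  by apply: bigcupT_measurable => a; exact: measurableI.
apply/seteqP; split => w /=; first by move=> h; exists (M (Dq q j w) w).
by move=> [a _ [/= -> ->]].
Qed.

(** The same weight seen as a series over the rounded levels, which is what
    the mixture argument produces, and as a mean, which is what passes to
    the limit. *)
Let smooth_pmf q n : {b : R | (\sum_(v <oo)
   (levelP q v * p n (v.+1%:R / q.+1%:R))%:E = b%:E)%E &
   (\int[P]_w (p n ((V q 0 w).+1%:R / q.+1%:R))%:E = b%:E)%E}.
Proof.
pose g v := p n (v.+1%:R / q.+1%:R).
have g0 v : 0 <= g v by rewrite gcp_pmf_ge0// divr_ge0.
have g1 v : g v <= 1 by rewrite gcp_pmf_le1// divr_ge0.
have mg : measurable_fun setT (fun w => (g (V q 0 w))%:E).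
  move=> _ B mB; rewrite setTI.
  rewrite (_ : _ @^-1` B = \bigcup_v (V q 0 @^-1` [set v] `&`
      [set w | B (g v)%:E])).
    apply: bigcupT_measurable => v; apply: measurableI => //.
    have [Bg|Bg] := pselect (B (g v)%:E).
      by rewrite (_ : [set w | _] = setT)//; apply/seteqP; split.
    by rewrite (_ : [set w | _] = set0)//; apply/seteqP; split.
  apply/seteqP; split => w /=; first by move=> Bw; exists (V q 0 w).
  by move=> [v _ [/= <-]].
have intE : (\int[P]_w (g (V q 0 w))%:E = \sum_(v <oo) (levelP q v * g v)%:E)%E.
  have UT : \bigcup_v (V q 0 @^-1` [set v]) = setT.
    by apply/seteqP; split => // w _; exists (V q 0 w).
  rewrite -{1}UT ge0_integral_bigcup//; last 3 first.
  - by rewrite UT.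
  - by move=> w _; rewrite lee_fin.
  - apply/trivIsetP => i j _ _ ij; apply/seteqP; split => // w [/= h1 h2].
    by move: ij; rewrite -h1 -h2 eqxx.
  apply: eq_eseriesr => v _.
  rewrite (eq_integral (fun=> (g v)%:E)); last first.
    by move=> w; rewrite inE /= => ->.
  by rewrite integral_cst// /levelP EFinM fineK ?fin_num_measure// muleC.
have fin : (\int[P]_w (g (V q 0 w))%:E)%E \is a fin_num.
  rewrite ge0_fin_numE; last by apply: integral_ge0 => w _; rewrite lee_fin.
  apply: (@le_lt_trans _ _ (\int[P]_w 1%:E)%E).
    by apply: ge0_le_integral => // w _; rewrite lee_fin.
  by rewrite integral_cst_prob ltry.
by exists (fine (\int[P]_w (g (V q 0 w))%:E)%E); rewrite ?fineK// -?intE ?fineK.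
Qed.

(** Given the rounded increments the times are deterministic: there the
    increments of [M] are independent, and [M] is independent of the levels. *)
Let skeleton_increments q (n : nat -> nat) r :
  P (\bigcap_(j in [set j | (j < r)%N])
      [set w | M (Dq q j.+1 w) w = (M (Dq q j w) w + n j)%N]) =
  (\prod_(0 <= j < r) s2val (smooth_pmf q (n j)))%:E.
Proof.
apply: (@mixture_product _ _ _ P r _ (V q)
  (fun j v => levelP q v * p (n j) (v.+1%:R / q.+1%:R))) => //.
- by move=> j v; rewrite mulr_ge0// ?fine_ge0// gcp_pmf_ge0// divr_ge0.
- by move=> j; case: (smooth_pmf q (n j)).
move=> v.
pose u j : R := (\sum_(i < j) (v i).+1)%:R / q.+1%:R.
have uS j : u j.+1 - u j = (v j).+1%:R / q.+1%:R.
  by rewrite /u big_ord_recr /= natrD mulrDl addrAC subrr add0r.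
rewrite (_ : \bigcap_(i in _) _ =
  \bigcap_(j in [set j | (j < r)%N]) [set w | M (u j.+1) w = (M (u j) w + n j)%N]
  `&` \bigcap_(j in [set j | (j < r)%N]) V q j @^-1` [set v j]); last first.
  have WE w j : (forall i, (i < r)%N -> V q i w = v i) -> (j <= r)%N -> Dq q j w = u j.
    move=> h jr; rewrite /Dq /u /W; congr (_%:R / _); apply: eq_bigr => i _.
    by rewrite h// (leq_trans (ltn_ord i)).
  apply/seteqP; split => [w h|w [h1 h2] j /= jr].
    have hV i : (i < r)%N -> V q i w = v i by move=> /h[].
    split => j /= jr; last exact: hV.
    by have [/= + _] := h j jr; rewrite !WE// ltnW.
  split; last exact: h2.
  by have := h1 j jr; rewrite /= !WE// ltnW.
rewrite MD_indep.
- rewrite V_law gcp_increments//; last 2 first.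
  + by rewrite divr_ge0.
  + by move=> j; rewrite -subr_ge0 uS divr_ge0.
  rewrite -EFinM -big_split/=; congr (_%:E); apply: eq_bigr => j _.
  by rewrite uS mulrC.
- apply: sigma_family_bigcap => j jr.
  rewrite (_ : [set w | _] = \bigcup_a (M (u j.+1) @^-1` [set (a + n j)%N] `&`
    M (u j) @^-1` [set a])); last first.
    apply/seteqP; split => w /=; first by move=> h; exists (M (u j) w).
    by move=> [a _ [/= -> ->]].
  have gen i m : sigma_family [set t | 0 <= t] M (M (u i) @^-1` [set m]).
    apply: sub_sigma_algebra; exists (u i); split; first by rewrite /= divr_ge0.
    by exists [set m].
  apply: (@bigcupT_measurable _ (g_sigma_algebraType _)) => a.
  by apply: (@measurableI _ (g_sigma_algebraType _)); exact: gen.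
- apply: sigma_family_bigcap => j jr.
  have mDs t : 0 <= t -> @measurable_fun _ _ (g_sigma_algebraType [set A |
     exists i, [set t | 0 <= t] i /\ exists2 B, measurable B & A = D i @^-1` B])
     R setT (D t).
    by move=> t0; exact: sigma_family_measurable_fun.
  have := measurable_funB (mDs _ (grid_ge0 j.+1)) (mDs _ (grid_ge0 j)).
  by move=> /(_ measurableT _ (mlevel q (v j))); rewrite setTI.
Qed.

Definition subordinated_pmf (n : nat) : R := fine (\int[P]_w (p n (D delta w))%:E)%E.

Let Dd_ge0 w : 0 <= D delta w. Proof. by rewrite -(D0 w) D_mono. Qed.

Let mpD n : measurable_fun setT (fun w => (p n (D delta w))%:E).
Proof.
apply/measurable_EFinP; apply: (measurableT_comp (measurable_gcp_pmf n)).
by have [mD _ _ _ _] := D_levy; exact: mD.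
Qed.

Let bound_int : P.-integrable setT (fun=> 1%:E).
Proof.
apply/integrableP; split => //; under eq_integral do rewrite abse1.
by rewrite integral_cst_prob ltry.
Qed.

Lemma subordinated_pmfE n :
  (\int[P]_w (p n (D delta w))%:E = (subordinated_pmf n)%:E)%E.
Proof.
rewrite fineK// ge0_fin_numE; last first.
  by apply: integral_ge0 => w _; rewrite lee_fin gcp_pmf_ge0.
apply: (@le_lt_trans _ _ (\int[P]_w 1%:E)%E); last by rewrite integral_cst_prob ltry.
apply: ge0_le_integral => //.
  by move=> w _; rewrite lee_fin gcp_pmf_ge0.
by move=> w _; rewrite lee_fin gcp_pmf_le1.
Qed.

Let smooth_pmf_cvg n : s2val (smooth_pmf q n) @[q --> \oo] --> subordinated_pmf n.
Proof.
pose g q w : \bar R := (p n ((V q 0 w).+1%:R / q.+1%:R))%:E.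
have gE q w : (V q 0 w).+1%:R / q.+1%:R = Dq q 1 w.
  by rewrite /Dq /W big_ord1.
have mg q : measurable_fun setT (g q).
  have : measurable_fun setT (fun w => Dq q 1 w).
    move=> _ B mB; rewrite setTI.
    rewrite (_ : _ @^-1` B = \bigcup_a (W q 1 @^-1` [set a] `&`
      [set w | B (a%:R / q.+1%:R)])).
      apply: bigcupT_measurable => a; apply: measurableI => //.
      have [Bg|Bg] := pselect (B (a%:R / q.+1%:R)).
        by rewrite (_ : [set w | _] = setT)//; apply/seteqP; split.
      by rewrite (_ : [set w | _] = set0)//; apply/seteqP; split.
    apply/seteqP; split => w /=; first by move=> Bw; exists (W q 1 w).
    by move=> [a _ [/= <-]].
  move=> mDq; apply/measurable_EFinP; rewrite /g.
  under eq_fun do rewrite gE.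
  exact: (measurableT_comp (measurable_gcp_pmf n) mDq).
have cvg_g w : g ^~ w @ \oo --> (p n (D delta w))%:E.
  apply/cvg_EFin; first by near=> q.
  rewrite /g /comp /=; under eq_cvg do rewrite gE.
  apply: continuous_cvg; first exact: continuous_gcp_pmf.
  apply: (@squeeze_cvgr _ _ _ _ (fun=> D delta w)
     (fun q : nat => D delta w + 1 / q.+1%:R)).
  - near=> q; have := D_le_Dq q 1 w; have := Dq_le q 1 w.
    by rewrite (mul1r delta) => h1 h2; apply/andP; split.
  - exact: cvg_cst.
  - rewrite -[X in _ --> X]addr0; apply: cvgD; first exact: cvg_cst.
    by under eq_cvg do rewrite div1r; exact: cvg_harmonic.
have dom w q : (`|g q w| <= 1%:E)%E.
  rewrite /g abse_EFin lee_fin ger0_norm ?gcp_pmf_le1 ?gcp_pmf_ge0// divr_ge0//.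
have [_ _ cv] := dominated_convergence measurableT mg (mpD n)
  (aeW _ (fun w _ => cvg_g w)) bound_int (aeW _ (fun w q _ => dom w q)).
have -> : (fun q => s2val (smooth_pmf q n)) = (fun q => fine (\int[P]_w g q w)%E).
  apply/funext => q; case: (smooth_pmf q n) => b /= _ bE.
  by rewrite /g bE.
by apply: fine_cvg; rewrite -subordinated_pmfE; exact: cv.
Unshelve. all: by end_near. Qed.

Let N t w := time_changed M D t w.

Let grid_event (n : nat -> nat) r :
  measurable (\bigcap_(j in [set j | (j < r)%N])
      [set w | N (j.+1%:R * delta) w = (N (j%:R * delta) w + n j)%N]) /\
  P (\bigcap_(j in [set j | (j < r)%N])
      [set w | M (Dq q j.+1 w) w = (M (Dq q j w) w + n j)%N]) @[q --> \oo] -->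
  P (\bigcap_(j in [set j | (j < r)%N])
      [set w | N (j.+1%:R * delta) w = (N (j%:R * delta) w + n j)%N]).
Proof.
apply: eventually_constant_event.
  by move=> q; apply: bigcap_measurableType => j _; exact: mA.
move=> w; have /= H : \forall q \near \oo, forall j, (j <= r)%N ->
    M (Dq q j w) w = N (j%:R * delta) w.
  elim: (r) => [|i IH].
    near=> q => j; rewrite leqn0 => /eqP ->; near: q; exact: M_Dq_cvg.
  near=> q => j; rewrite leq_eqVlt ltnS => /predU1P[->|].
    by near: q; exact: M_Dq_cvg.
  by move: j; near: q; exact: IH.
near=> q.
have Hq j : (j <= r)%N -> M (Dq q j w) w = N (j%:R * delta) w.
  by move: j; near: q; exact: H.
by split => h j /= jr; have := h j jr; rewrite /= !Hq// ltnW.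
Unshelve. all: by end_near. Qed.

(** The discrete subordinator converges to [D] from the right along every
    path, so the events and the weights both converge. *)
Lemma time_changed_increments (n : nat -> nat) r :
  P (\bigcap_(j in [set j | (j < r)%N])
      [set w | N (j.+1%:R * delta) w = (N (j%:R * delta) w + n j)%N]) =
  (\prod_(0 <= j < r) subordinated_pmf (n j))%:E.
Proof.
have [_ cv] := grid_event n r.
have cv' : (\prod_(0 <= j < r) s2val (smooth_pmf q (n j)))%:E @[q --> \oo] -->
    (\prod_(0 <= j < r) subordinated_pmf (n j))%:E.
  apply/cvg_EFin; first by near=> q.
  rewrite /comp /=; apply: cvg_big => [|j _]; first exact: mul_continuous.
  exact: smooth_pmf_cvg.
move: cv; under eq_cvg do rewrite skeleton_increments; move=> cv.
exact: (cvg_unique (@ereal_hausdorff R) cv cv').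
Unshelve. all: by end_near. Qed.

Lemma measurable_time_changed j n :
  measurable [set w | time_changed M D (j%:R * delta) w = n].
Proof.
have [//|] := @eventually_constant_event _ _ _ P
  [set w | time_changed M D (j%:R * delta) w = n]
  (fun q => [set w | M (Dq q j w) w = n]) (fun q => mMDq q j n).
move=> w; near=> q.
have E : M (Dq q j w) w = time_changed M D (j%:R * delta) w.
  by near: q; exact: M_Dq_cvg.
by rewrite /= E.
Unshelve. all: by end_near. Qed.

Lemma time_changed0 w : time_changed M D 0 w = 0%N.
Proof.
rewrite /time_changed D0; have [[_ /(_ w)[+ _] _ _ _] _] := M_gcp.
by move=> /eqP; rewrite -(mulr0n 1) eqr_nat => /eqP.
Qed.

End grid.
End subordination.

(** * Claims grouped by a counting process *)

Section iid_of_boxes.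
Context d (T : measurableType d) (R : realType) (P : probability T R).

(** The first [r] coordinates suffice, as any finite set of indices is
    completed by trivial constraints. *)
Lemma iid_of_boxes (X : nat -> T -> R) (mu : set R -> R) :
  (forall i, measurable_fun setT (X i)) -> mu setT = 1 ->
  (forall r (B : nat -> set R), (forall i, measurable (B i)) ->
    P (\bigcap_(j in [set j | (j < r)%N]) X j @^-1` B j) =
    (\prod_(0 <= j < r) mu (B j))%:E) ->
  iid_with P X mu.
Proof.
move=> mX mu1 H.
have lawX i B : measurable B -> P (X i @^-1` B) = (mu B)%:E.
  move=> mB; pose C j := if j == i then B else setT.
  have mC j : measurable (C j) by rewrite /C; case: ifP.
  have := H i.+1 C mC; rewrite (_ : \bigcap_(j in _) _ = X i @^-1` B); last first.
    apply/seteqP; split => [w h|w Bw j _].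
      by have := h i; rewrite /= ltnSn /C eqxx; apply.
    by rewrite /C; case: eqP => // ->.
  move=> ->; rewrite big_nat_recr//= /C eqxx big_nat big1 ?mul1r// => j /andP[_ ji].
  by rewrite ltn_eqF.
split => // s B us mB.
pose r := (\max_(i <- s) i).+1.
have lt_r i : i \in s -> (i < r)%N by move=> si; rewrite ltnS; exact: leq_bigmax_seq.
pose C j := if j \in s then B j else setT.
have mC j : measurable (C j) by rewrite /C; case: ifP.
rewrite (_ : \bigcap_(i in _) _ = \bigcap_(j in [set j | (j < r)%N]) X j @^-1` C j); last first.
  apply/seteqP; split => w h j /=; rewrite /C.
    by move=> _; case: ifP => //; exact: h.
  by move=> js; have := h j (lt_r j js); rewrite /C js.
rewrite H//; congr (_%:E).
under [RHS]eq_bigr do rewrite (lawX _ _ (mB _)) /=.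
rewrite (bigID (mem s))/= [X in _ * X]big1 ?mulr1; last first.
  by move=> j /negbTE js; rewrite /C js.
rewrite -big_filter; rewrite (perm_big s).
  by rewrite !big_seq; apply: eq_bigr => j js; rewrite /C js.
apply: uniq_perm; rewrite ?filter_uniq// ?iota_uniq// => j.
rewrite mem_filter mem_index_iota /=.
by case: (boolP (j \in s)) => //= /lt_r ->.
Qed.

Lemma probability_setI1 (A E : set T) : measurable A -> measurable E ->
  P E = 1%E -> P (A `&` E) = P A.
Proof.
move=> mA mE E1.
have mEc : measurable (~` E) by exact: measurableC.
have Ec0 : P (~` E) = 0%E by rewrite probability_setC// E1 subee.
rewrite [RHS](@measureDI _ _ _ P A E)//.
rewrite [X in _ = (X + _)%E](_ : _ = 0%E) ?add0e//.
apply: (@subset_measure0 _ _ _ P (A `\` E) (~` E)) => //.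
exact: measurableD.
Qed.
End iid_of_boxes.

Section compound.
Context d (T : measurableType d) (R : realType) (P : probability T R).
Variables (Z : nat -> T -> R) (mu : set R -> R) (K : nat -> T -> nat) (pmf : nat -> R).
Hypotheses (Z_iid : iid_with P Z mu) (K0 : forall w, K 0%N w = 0%N)
  (mK : forall j n, measurable (K j @^-1` [set n]))
  (K_incr : forall (n : nat -> nat) r,
    P (\bigcap_(j in [set j | (j < r)%N]) [set w | K j.+1 w = (K j w + n j)%N]) =
    (\prod_(0 <= j < r) pmf (n j))%:E)
  (KZ_indep : forall (n : nat -> nat) r (A : set T),
    sigma_family setT Z A ->
    P (A `&` \bigcap_(j in [set j | (j < r)%N]) [set w | K j.+1 w = (K j w + n j)%N]) =
    (P A * P (\bigcap_(j in [set j | (j < r)%N]) [set w | K j.+1 w = (K j w + n j)%N]))%E).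

Let mZ i : measurable_fun setT (Z i). Proof. by have [] := Z_iid. Qed.

Definition claim_sum (Z : nat -> T -> R) (n : nat) (w : T) : R := \sum_(i < n) Z i w.

Definition sum_law (n : nat) (B : set R) : R := fine (P (claim_sum Z n @^-1` B)).

Definition compound_step (j : nat) (w : T) : R :=
  claim_sum Z (K j.+1 w) w - claim_sum Z (K j w) w.

Let mS n : measurable_fun setT (claim_sum Z n).
Proof. by apply: measurable_sum => i. Qed.

Let mS_level n B : measurable B -> measurable (claim_sum Z n @^-1` B).
Proof. by move=> mB; rewrite -[X in measurable X]setTI; exact: mS. Qed.

Let sum_lawE n B : measurable B -> P (claim_sum Z n @^-1` B) = (sum_law n B)%:E.
Proof. by move=> mB; rewrite /sum_law fineK// fin_num_measure//; exact: mS_level. Qed.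

Lemma measurable_claim_sum_random j :
  measurable_fun setT (fun w => claim_sum Z (K j w) w).
Proof.
move=> _ B mB; rewrite setTI.
rewrite (_ : _ @^-1` B = \bigcup_n (K j @^-1` [set n] `&` claim_sum Z n @^-1` B)).
  by apply: bigcupT_measurable => n; apply: measurableI => //; exact: mS_level.
apply/seteqP; split => w /=; first by move=> h; exists (K j w).
by move=> [n _ [/= <-]].
Qed.

Let mstep j : measurable_fun setT (compound_step j).
Proof. by apply: measurable_funB; exact: measurable_claim_sum_random. Qed.

Let pmfE n : P (K 1%N @^-1` [set n]) = (pmf n)%:E.
Proof.
have := K_incr (fun=> n) 1; rewrite big_nat1 => <-; congr (P _).
apply/seteqP; split => [w /= h j /=|w h].
  by rewrite ltnS leqn0 => /eqP ->; rewrite K0.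
by have := h 0%N erefl; rewrite /= K0.
Qed.

Let pmf_ge0 n : 0 <= pmf n.
Proof. by rewrite -lee_fin -pmfE. Qed.

Lemma compound_pmf_sum : (\sum_(n <oo) (pmf n)%:E = 1)%E.
Proof.
rewrite -[RHS](@probability_setT _ _ _ P) (@prob_sum_partition _ _ _ P _ (K 1%N))//.
by apply: eq_eseriesr => n _; rewrite setTI pmfE.
Qed.

Let block (n : nat -> nat) j := (\sum_(l < j) n l)%N.

(** The last block is a function of the future of the sequence at the time
    it begins, and the future has the law of the sequence itself; induction
    on the number of blocks. *)
Lemma block_sums_indep (n : nat -> nat) (B : nat -> set R) r :
  (forall j, measurable (B j)) ->
  P (\bigcap_(j in [set j | (j < r)%N])
     [set w | B j (claim_sum Z (block n j.+1) w - claim_sum Z (block n j) w)]) =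
  (\prod_(0 <= j < r) sum_law (n j) (B j))%:E.
Proof.
move=> mB; elim: r => [|r IH].
  rewrite big_geq// (_ : \bigcap_(j in _) _ = setT) ?probability_setT//.
  by apply/seteqP; split.
have mdiff (X : nat -> path_space R -> R) p q : X = (fun n x => \sum_(i < n) x i) ->
    measurable_fun setT (fun x : path_space R => X p x - X q x).
  by move=> ->; apply: measurable_funB; apply: measurable_sum => i; exact: measurable_coord.
pose A : set (path_space R) := \bigcap_(j in [set j | (j < r)%N])
  [set x : path_space R | B j ((\sum_(i < block n j.+1) x i) - (\sum_(i < block n j) x i))].
pose C : set (path_space R) := [set x : path_space R | B r (\sum_(i < n r) x i)].
have mA : measurable A.
  apply: bigcap_measurableType => j _.
  by have := mdiff _ (block n j.+1) (block n j) erefl measurableT _ (mB j); rewrite setTI.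
have mC : measurable C.
  have h : measurable_fun setT (fun x : path_space R => \sum_(i < n r) x i).
    by apply: measurable_sum => i; exact: measurable_coord.
  by have := h measurableT _ (mB r); rewrite setTI.
have := iid_past_future Z_iid (block n r) mA mC.
have le_block i j : (i <= j)%N -> (block n i <= block n j)%N.
  by move=> ij; rewrite -(subnKC ij) /block big_split_ord /= leq_addr.
have cutE w p : (p <= block n r)%N ->
    \sum_(i < p) (if (i < block n r)%N then Z i w else 0) = claim_sum Z p w.
  by move=> pr; apply: eq_bigr => i _; rewrite (leq_trans (ltn_ord i) pr).
have AE : [set w | A (fun i => if (i < block n r)%N then Z i w else 0)] =
    \bigcap_(j in [set j | (j < r)%N])
     [set w | B j (claim_sum Z (block n j.+1) w - claim_sum Z (block n j) w)].
  apply/seteqP; split => w h j /= jr; have := h j jr;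
    by rewrite /= !cutE// le_block// ltnW.
have CE : [set w | C (fun i => Z (block n r + i)%N w)] =
    [set w | B r (claim_sum Z (block n r.+1) w - claim_sum Z (block n r) w)].
  have E w : claim_sum Z (block n r.+1) w - claim_sum Z (block n r) w =
      \sum_(i < n r) Z (block n r + i)%N w.
    rewrite (_ : block n r.+1 = (block n r + n r)%N); last by rewrite /block big_ord_recr.
    by rewrite /claim_sum big_split_ord/= addrAC subrr add0r.
  by apply/seteqP; split => w; rewrite /C /= E.
rewrite AE CE IH => H.
rewrite big_nat_recr//= EFinM -(sum_lawE _ (mB r)) -H; congr (P _).
apply/seteqP; split => [w h|w [h1 h2] j /=].
  by split; [move=> j /= jr; apply: h; rewrite /= ltnS ltnW|exact: (h r (ltnSn r))].
by rewrite ltnS leq_eqVlt => /predU1P[->//|]; exact: h1.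
Qed.

Definition mixture_law (B : set R) : R :=
  fine (\sum_(n <oo) (pmf n * sum_law n B)%:E)%E.

Lemma mixture_lawE (B : set R) : measurable B ->
  (\sum_(n <oo) (pmf n * sum_law n B)%:E = (mixture_law B)%:E)%E.
Proof.
move=> mB.
have le1 n : sum_law n B <= 1.
  by rewrite -lee_fin -sum_lawE//; apply: probability_le1; exact: mS_level.
have ge0 n : 0 <= sum_law n B by rewrite fine_ge0.
rewrite fineK// ge0_fin_numE; last first.
  by apply: nneseries_ge0 => n _ _; rewrite lee_fin mulr_ge0.
apply: (@le_lt_trans _ _ 1%E); last exact: ltry.
rewrite -compound_pmf_sum; apply: lee_nneseries => n _.
  by move=> _; rewrite lee_fin mulr_ge0.
by rewrite lee_fin ler_piMr.
Qed.

Lemma mixture_lawT : mixture_law setT = 1.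
Proof.
apply: EFin_inj; rewrite -mixture_lawE// -compound_pmf_sum.
apply: eq_eseriesr => n _; rewrite /sum_law preimage_setT probability_setT.
by rewrite mulr1.
Qed.

Let mincr j : measurable [set w | (K j w <= K j.+1 w)%N].
Proof.
rewrite (_ : [set w | _] = \bigcup_a \bigcup_c (K j @^-1` [set a] `&`
    K j.+1 @^-1` [set (a + c)%N])).
  by do 2 (apply: bigcupT_measurable => ?); exact: measurableI.
apply/seteqP; split => w /=.
  move=> h; exists (K j w) => //; exists (K j.+1 w - K j w)%N => //; split => //=.
  by rewrite subnKC.
by move=> [a _ [c _ [/= -> ->]]]; rewrite leq_addr.
Qed.

Let mdiffK j n : measurable ((fun w => (K j.+1 w - K j w)%N) @^-1` [set n]).
Proof.
rewrite (_ : _ @^-1` _ = \bigcup_a \bigcup_c (K j @^-1` [set a] `&`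
    (K j.+1 @^-1` [set c] `&` [set w | (c - a)%N = n]))).
  apply: bigcupT_measurable => a; apply: bigcupT_measurable => c.
  apply: measurableI => //; apply: measurableI => //.
  case: (eqVneq (c - a)%N n) => [->|/eqP h].
    by rewrite (_ : [set _ | _] = setT)//; apply/seteqP; split.
  by rewrite (_ : [set _ | _] = set0)//; apply/seteqP; split.
apply/seteqP; split => w /=.
  by move=> h; exists (K j w) => //; exists (K j.+1 w).
by move=> [a _ [c _ [/= -> [-> ]]]].
Qed.

(** The counts may fail to be nondecreasing on a null event; the truncated
    difference of naturals would hide this, hence the extra condition in the
    event. *)
Let increasing_boxes r (B : nat -> set R) : (forall i, measurable (B i)) ->
  P (\bigcap_(j in [set j | (j < r)%N])
    ([set w | (K j w <= K j.+1 w)%N] `&` compound_step j @^-1` B j)) =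
  (\prod_(0 <= j < r) mixture_law (B j))%:E.
Proof.
move=> mB; apply: (@mixture_product _ _ _ P r _ (fun j w => (K j.+1 w - K j w)%N)
  (fun j n => pmf n * sum_law n (B j))) => //.
- move=> j; apply: measurableI => //.
  by rewrite -[X in measurable X]setTI; exact: mstep.
- by move=> j n; rewrite mulr_ge0// fine_ge0.
- by move=> j; exact: mixture_lawE.
move=> v.
have KE w : (forall j, (j < r)%N -> K j.+1 w = (K j w + v j)%N) ->
    forall j, (j <= r)%N -> K j w = block v j.
  move=> h; elim=> [_|j IH jr]; first by rewrite K0 /block big_ord0.
  by rewrite h// IH ?(ltnW jr)// /block big_ord_recr.
have := KZ_indep v r.
pose blocks := \bigcap_(j in [set j | (j < r)%N])
     [set w | B j (claim_sum Z (block v j.+1) w - claim_sum Z (block v j) w)].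
move=> /(_ blocks); rewrite block_sums_indep// K_incr -EFinM -big_split/=.
rewrite (eq_bigr (fun j => pmf (v j) * sum_law (v j) (B j))) => [<-|j _].
- congr (P _); apply/seteqP; split => [w h|w [h1 h2] j /= jr].
    have hK j : (j < r)%N -> K j.+1 w = (K j w + v j)%N.
      by move=> jr; have [[/= le _] <-] := h j jr; rewrite subnKC.
    split => j /= jr; last exact: hK.
    have [[_ ]] := h j jr; rewrite /= /compound_step.
    by rewrite !(KE w hK)// ltnW.
  have kj := h2 j jr; split; last by rewrite /= kj addKn.
  split; first by rewrite /= kj leq_addr.
  by have := h1 j jr; rewrite /= /compound_step !(KE w h2)// ltnW.
- apply: sigma_family_bigcap => j jr.
  have mZs i : @measurable_fun _ _ (g_sigma_algebraType [set A |
     exists i, setT i /\ exists2 B, measurable B & A = Z i @^-1` B]) R setT (Z i).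
    exact: sigma_family_measurable_fun.
  have mc n : @measurable_fun _ _ (g_sigma_algebraType [set A |
     exists i, setT i /\ exists2 B, measurable B & A = Z i @^-1` B]) R setT (claim_sum Z n).
    by apply: measurable_sum => i.
  have := measurable_funB (mc (block v j.+1)) (mc (block v j)).
  by move=> /(_ measurableT _ (mB j)); rewrite setTI.
- by rewrite mulrC.
Qed.

Lemma increasing_ae r :
  P (\bigcap_(j in [set j | (j < r)%N]) [set w | (K j w <= K j.+1 w)%N]) = 1%E.
Proof.
have := @increasing_boxes r (fun=> setT) (fun=> measurableT).
rewrite [X in (X)%:E]big1 => [<-|j _]; last exact: mixture_lawT.
by congr (P _); apply: eq_bigcapr => j _; rewrite preimage_setT setIT.
Qed.

(** Given the numbers of claims in the successive periods, the steps are
    sums over consecutive blocks; the numbers are then summed out. *)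
Lemma compound_step_iid : iid_with P compound_step mixture_law.
Proof.
apply: iid_of_boxes => //; first exact: mixture_lawT.
move=> r B mB; rewrite -increasing_boxes//.
rewrite -(@probability_setI1 _ _ _ P _
  (\bigcap_(j in [set j | (j < r)%N]) [set w | (K j w <= K j.+1 w)%N])).
- congr (P _); apply/seteqP; split => [w [h1 h2] j jr|w h].
    by split; [exact: h2|exact: h1].
  by split => j jr; have [] := h j jr.
- apply: bigcap_measurableType => j _; rewrite -[X in measurable X]setTI.
  exact: mstep.
- by apply: bigcap_measurableType => j _.
- exact: increasing_ae.
Qed.

End compound.

(** * Derivatives of a Bernstein function *)

(** The exponential series dominates each of its terms. *)
Lemma power_exp_bound (R : realType) (z : nat) (s x : R) : 0 < s -> 0 <= x ->
  x ^+ z * expR (- (s * x)) <= z`!%:R / s ^+ z.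
Proof.
move=> s0 x0.
have sx0 : 0 <= s * x by rewrite mulr_ge0// ltW.
have e0 : 0 <= expR (- (s * x)) by exact: expR_ge0.
rewrite ler_pdivlMr ?exprn_gt0//.
case: z => [|z].
  by rewrite !expr0 mul1r mulr1 fact0 -expR0 ler_expR oppr_le0.
have := expR_ge1Dxn z sx0.
have fz : 0 < z.+1`!%:R :> R by rewrite ltr0n fact_gt0.
have : expR (s * x) * expR (- (s * x)) = 1 by exact: expRxMexpNx_1.
rewrite exprMn => E h.
have h' : s ^+ z.+1 * x ^+ z.+1 <= z.+1`!%:R * expR (s * x).
  by rewrite mulrC -ler_pdivrMl// mulrC; lra.
rewrite mulrAC (mulrC (x ^+ _)).
apply: le_trans (ler_wpM2r e0 h') _.
by rewrite -mulrA E mulr1.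
Qed.

Section bernstein_derivatives.
Context (R : realType).
Variables (c2 : R) (nu : {measure set (measurableTypeR R) -> \bar R}).
Hypothesis nu_levy : levy_measure nu.

Let pos : set (measurableTypeR R) := `]0%R, +oo[%classic.

Definition levy_moment (z : nat) (s : R) : R :=
  \int[nu]_(x in pos) ((x : R) ^+ z * expR (- (s * x))).

Let mpos : measurable pos. Proof. exact: measurable_itv. Qed.

Let measurable_funR (D : set (measurableTypeR R)) (g : R -> R) :
  measurable_fun setT g -> measurable_fun D (g : measurableTypeR R -> R).
Proof. by move=> mg; apply: (@measurable_funTS _ _ (measurableTypeR R)); exact: mg. Qed.

Let posP (x : R) : pos x -> 0 < x. Proof. by rewrite /pos /= in_itv/= andbT. Qed.

Let int_min : nu.-integrable pos (fun x : measurableTypeR R => (Num.min (x : R) 1)%:E).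
Proof.
apply/integrableP; split.
  apply/measurable_EFinP; apply: (@measurable_funR _ (fun x => Num.min x 1)).
  exact: measurable_minr.
rewrite (eq_integral (fun x : measurableTypeR R => (Num.min (x : R) 1)%:E)) => [|x]; first exact: nu_levy.
rewrite inE => /posP x0; rewrite abse_EFin ger0_norm//.
by rewrite le_min ler01 ltW.
Qed.

Let mexpM (z : nat) (s : R) :
  measurable_fun setT (fun x : R => x ^+ z * expR (- (s * x))).
Proof.
apply: measurable_funM => //.
apply: (measurableT_comp (@measurable_expR R)).
by apply: measurableT_comp => //; exact: mulrl_measurable.
Qed.

Let power_exp_le (z : nat) (s x : R) : (0 < z)%N -> 0 < s -> 0 < x ->
  x ^+ z * expR (- (s * x)) <= (1 + z`!%:R / s ^+ z) * Num.min x 1.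
Proof.
move=> z0 s0 x0.
have sx0 : 0 < s * x by rewrite mulr_gt0.
have e1 : expR (- (s * x)) <= 1 by rewrite -expR0 ler_expR oppr_le0 ltW.
have e0 : 0 <= expR (- (s * x)) by exact: expR_ge0.
have c0 : 0 <= z`!%:R / s ^+ z by rewrite divr_ge0 ?exprn_ge0// ltW.
have [x1|x1] := leP x 1.
  have xz : x ^+ z <= x.
    case: z z0 {c0} => // z _; rewrite exprS; apply: ler_piMr; first exact: ltW.
    by apply: exprn_ile1 => //; exact: ltW.
  have xz0 : 0 <= x ^+ z by rewrite exprn_ge0// ltW.
  nra.
rewrite mulr1.
have := power_exp_bound z s0 (ltW x0); lra.
Qed.

Lemma levy_moment_integrable (z : nat) (s : R) : (0 < z)%N -> 0 < s ->
  nu.-integrable pos (fun x : measurableTypeR R => ((x : R) ^+ z * expR (- (s * x)))%:E).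
Proof.
move=> z0 s0.
apply: (@le_integrable _ _ _ nu pos mpos _
    (fun x : measurableTypeR R => (1 + z`!%:R / s ^+ z)%:E * (Num.min (x : R) 1)%:E)%E).
- by apply/measurable_EFinP; exact: (measurable_funR (mexpM z s)).
- move=> x /posP x0; rewrite -EFinM !abse_EFin lee_fin ger0_norm; last first.
    by rewrite mulr_ge0 ?expR_ge0// exprn_ge0// ltW.
  by apply: le_trans (power_exp_le z0 s0 x0) _; exact: ler_norm.
- exact: integrableZl.
Qed.

Lemma exp_gap_integrable (s : R) : 0 < s ->
  nu.-integrable pos (fun x : measurableTypeR R => (1 - expR (- (s * (x : R))))%:E).
Proof.
move=> s0.
apply: (@le_integrable _ _ _ nu pos mpos _
    (fun x : measurableTypeR R => (1 + s)%:E * (Num.min (x : R) 1)%:E)%E).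
- apply/measurable_EFinP; apply: (@measurable_funR _ (fun x => 1 - expR (- (s * x)))).
  apply: measurable_funB => //.
  apply: (measurableT_comp (@measurable_expR R)).
  by apply: measurableT_comp => //; exact: mulrl_measurable.
- move=> x /posP x0; rewrite -EFinM !abse_EFin lee_fin.
  have sx0 : 0 < s * x by rewrite mulr_gt0.
  have e1 : expR (- (s * x)) <= 1 by rewrite -expR0 ler_expR oppr_le0 ltW.
  have e0 : 0 <= expR (- (s * x)) by exact: expR_ge0.
  have e2 := expR_ge1Dx (- (s * x)).
  rewrite ger0_norm ?subr_ge0//; apply: le_trans (ler_norm _).
  have [x1|x1] := leP x 1; first nra.
  by lra.
- exact: integrableZl.
Qed.

(** Differentiation under the integral; on a neighbourhood of [s] the
    derivative is dominated by its value at [s / 2]. *)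
Lemma levy_moment_derive (z : nat) (s : R) : (0 < z)%N -> 0 < s ->
  is_derive s 1 (levy_moment z) (- levy_moment z.+1 s).
Proof.
move=> z0 s0.
pose f (u x : R) := x ^+ z * expR (- (u * x)).
pose G (x : R) := `|x ^+ z.+1 * expR (- ((s / 2) * x))|.
have s20 : 0 < s / 2 by rewrite divr_gt0.
have Is : `]s / 2, s + 1[%classic s by rewrite /= in_itv/=; lra.
have df (u x : R) : is_derive u 1 (f ^~ x) (- (x ^+ z.+1 * expR (- (u * x)))).
  rewrite /f; apply: is_derive_eq.
  by rewrite /GRing.scale/= exprS; ring.
have d1 (u x : R) : partial1of2 f u x = - (x ^+ z.+1 * expR (- (u * x))).
  by rewrite partial1of2E; have := df u x => ?; rewrite derive_val.
have intf u : `]s / 2, s + 1[%classic u -> nu.-integrable pos (EFin \o f u).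
  rewrite /= in_itv/= => /andP[u0 _]; apply: levy_moment_integrable => //; lra.
have derf u x : `]s / 2, s + 1[%classic u -> pos x -> derivable (f ^~ x) u 1.
  by move=> _ _; have := df u x => ?; exact: ex_derive.
have G0 x : 0 <= G x by exact: normr_ge0.
have intG : nu.-integrable pos (EFin \o G).
  by apply: integrable_norm; exact: levy_moment_integrable.
have Gub u x : `]s / 2, s + 1[%classic u -> pos x -> `|partial1of2 f u x| <= G x.
  rewrite /= in_itv/= => /andP[u0 _] /posP x0; rewrite d1 normrN /G !normrM.
  rewrite ler_wpM2l// !ger0_norm ?expR_ge0// ler_expR lerN2 ler_wpM2r// ltW//.
have Dv := @derivable_under_integral R _ _ nu f pos mpos s (s/2) (s+1) Is intf derf
  G G0 intG Gub.
have Dval := @differentiation_under_integral R _ _ nu f pos mpos s (s/2) (s+1) Is intf derf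
  G G0 intG Gub.
apply: DeriveDef => //; rewrite -derive1E Dval.
under eq_Rintegral do rewrite d1 -mulN1r.
by rewrite RintegralZl ?mulN1r//; exact: levy_moment_integrable.
Qed.

Lemma bernstein_derive (s : R) : 0 < s ->
  is_derive s 1 (bernstein c2 nu) (c2 + levy_moment 1 s).
Proof.
move=> s0.
pose f (u x : R) := 1 - expR (- (u * x)).
pose G (x : R) := `|x ^+ 1 * expR (- ((s / 2) * x))|.
have s20 : 0 < s / 2 by rewrite divr_gt0.
have Is : `]s / 2, s + 1[%classic s by rewrite /= in_itv/=; lra.
have df (u x : R) : is_derive u 1 (f ^~ x) (x ^+ 1 * expR (- (u * x))).
  rewrite /f; apply: is_derive_eq.
  by rewrite /GRing.scale/= expr1; ring.
have d1 (u x : R) : partial1of2 f u x = x ^+ 1 * expR (- (u * x)).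
  by rewrite partial1of2E; have := df u x => ?; rewrite derive_val.
have intf u : `]s / 2, s + 1[%classic u -> nu.-integrable pos (EFin \o f u).
  rewrite /= in_itv/= => /andP[u0 _]; apply: exp_gap_integrable => //; lra.
have derf u x : `]s / 2, s + 1[%classic u -> pos x -> derivable (f ^~ x) u 1.
  by move=> _ _; have := df u x => ?; exact: ex_derive.
have G0 x : 0 <= G x by exact: normr_ge0.
have intG : nu.-integrable pos (EFin \o G).
  by apply: integrable_norm; exact: levy_moment_integrable.
have Gub u x : `]s / 2, s + 1[%classic u -> pos x -> `|partial1of2 f u x| <= G x.
  rewrite /= in_itv/= => /andP[u0 _] /posP x0; rewrite d1 /G !normrM.
  rewrite ler_wpM2l// !ger0_norm ?expR_ge0// ler_expR lerN2 ler_wpM2r// ltW//.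
have Dv := @derivable_under_integral R _ _ nu f pos mpos s (s/2) (s+1) Is intf derf
  G G0 intG Gub.
have Dval := @differentiation_under_integral R _ _ nu f pos mpos s (s/2) (s+1) Is intf derf
  G G0 intG Gub.
have dI : is_derive s 1 (fun u => \int[nu]_(x in pos) f u x) (levy_moment 1 s).
  apply: DeriveDef => //; rewrite -derive1E Dval.
  by under eq_Rintegral do rewrite d1.
rewrite /bernstein; apply: is_derive_eq.
by rewrite /GRing.scale/= mulr1.
Qed.

Lemma bernstein_deriven (z : nat) (s : R) : 0 < s ->
  derive1n z.+1 (bernstein c2 nu) s =
  (-1) ^+ z * (levy_moment z.+1 s + (if z == 0%N then c2 else 0)) /\
  derivable (derive1n z (bernstein c2 nu)) s 1.
Proof.
elim: z s => [|z IH] s s0.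
  have D1 := bernstein_derive s0; split; last exact: ex_derive.
  by rewrite derive1nS derive1n0 derive1E derive_val expr0 mul1r eqxx addrC.
have near_pos : \forall u \near s, 0 < u.
  exact: lt_nbhsr.
pose g (u : R) : R := (-1) ^+ z * (levy_moment z.+1 u + (if z == 0%N then c2 else 0)).
have fg : \near s, g s = derive1n z.+1 (bernstein c2 nu) s.
  by apply: filterS near_pos => u u0; have [-> _] := IH u u0.
have Dm := @levy_moment_derive z.+1 s isT s0.
have Dg : is_derive s 1 g ((-1) ^+ z.+1 * levy_moment z.+2 s).
  rewrite /g; apply: is_derive_eq.
  by rewrite /GRing.scale/= exprS; ring.
have Df := near_eq_is_derive fg Dg; split; last exact: ex_derive.
by rewrite derive1nS derive1E derive_val addr0.
Qed.

End bernstein_derivatives.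

(** * Limits of derivatives of convex functions *)

Section real_limits.
Context (R : realType).

(** For convex [F m] with derivative [- F' m], the two inequalities squeeze
    [F' m s] between difference quotients of [F m]. These converge to
    difference quotients of the limit [A], and the latter to its derivative:
    so derivatives converge where only the functions were known to. *)
Lemma convex_limit_derivative (F F' : nat -> R -> R) (A : R -> R) (s l : R) :
  0 < s -> (forall u, 0 < u -> F m u @[m --> \oo] --> A u) ->
  (forall m h, 0 < h -> F m s - F m (s + h) <= h * F' m s) ->
  (forall m h, 0 < h -> h < s -> h * F' m s <= F m (s - h) - F m s) ->
  is_derive s 1 A (- l) -> F' m s @[m --> \oo] --> l.
Proof.
move=> s0 FA low up dA.
have quot : h^-1 *: (A (h *: 1 + s) - A s) @[h --> 0^'] --> - l.
  have dv : derivable A s 1 by exact: ex_derive.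
  have -> : - l = 'D_1 A s by rewrite derive_val.
  exact: dv.
apply/(@cvgrPdist_lt _ R^o) => /= e e0.
have e20 : 0 < e / 2 by rewrite divr_gt0.
have /(@cvgrPdist_lt _ R^o) /(_ _ e20) := quot.
rewrite near_withinE => /nbhs_ballP[/= r r0 Hr].
pose h := Num.min (r / 2) (s / 2).
have h0 : 0 < h by rewrite lt_min !divr_gt0.
have hr : h < r by rewrite /h gt_min; apply/orP; left; lra.
have hs : h < s by rewrite /h gt_min; apply/orP; right; lra.
have q1 : `|- l - h^-1 * (A (h + s) - A s)| < e / 2.
  have := Hr h; rewrite /ball /= sub0r normrN gtr0_norm// => /(_ hr (lt0r_neq0 h0)).
  by rewrite /GRing.scale /= mulr1.
have q2 : `|- l + h^-1 * (A (s - h) - A s)| < e / 2.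
  have := Hr (- h); rewrite /ball /= sub0r normrN normrN gtr0_norm// oppr_eq0.
  move=> /(_ hr (lt0r_neq0 h0)).
  by rewrite /GRing.scale /= mulr1 invrN mulNr opprK (addrC (- h)).
have he : 0 < h * (e / 4) by rewrite mulr_gt0// divr_gt0.
have sh : 0 < s + h by lra.
have smh : 0 < s - h by lra.
near=> m.
have f1 : `|A s - F m s| < h * (e / 4).
  by near: m; move: he; move/(@cvgrPdist_lt _ R^o): (FA _ s0); apply.
have f2 : `|A (s + h) - F m (s + h)| < h * (e / 4).
  by near: m; move: he; move/(@cvgrPdist_lt _ R^o): (FA _ sh); apply.
have f3 : `|A (s - h) - F m (s - h)| < h * (e / 4).
  by near: m; move: he; move/(@cvgrPdist_lt _ R^o): (FA _ smh); apply.
have l1 := low m h h0; have l2 := up m h h0 hs.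
have k1 : h * (- l - e / 2) < A (h + s) - A s /\ A (h + s) - A s < h * (- l + e / 2).
  move: q1; rewrite ltr_norml => /andP[a1 a2].
  have E : h * (h^-1 * (A (h + s) - A s)) = A (h + s) - A s.
    by rewrite mulrA divff ?mul1r// lt0r_neq0.
  by split; rewrite -E ltr_pM2l//; lra.
have k2 : h * (l - e / 2) < A (s - h) - A s /\ A (s - h) - A s < h * (l + e / 2).
  move: q2; rewrite ltr_norml => /andP[a1 a2].
  have E : h * (h^-1 * (A (s - h) - A s)) = A (s - h) - A s.
    by rewrite mulrA divff ?mul1r// lt0r_neq0.
  by split; rewrite -E ltr_pM2l//; lra.
move: f1 f2 f3; rewrite !ltr_norml => /andP[a1 a2] /andP[a3 a4] /andP[a5 a6].
have [k11 k12] := k1; have [k21 k22] := k2.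
have shE : h + s = s + h by rewrite addrC.
rewrite shE in k11 k12.
have u1 : h * (l - e) < h * F' m s by nra.
have u2 : h * F' m s < h * (l + e) by nra.
move: u1 u2; rewrite !ltr_pM2l// => u1 u2.
by apply/andP; split; lra.
Unshelve. all: by end_near. Qed.
End real_limits.

(** * Convergence of series without loss of mass *)

Section real_series.
Context (R : realType).

Lemma nneseries_real_cvg (h : nat -> R) (H : R) : (forall n, 0 <= h n) ->
  (\sum_(0 <= n < N) h n) @[N --> \oo] --> H <->
  (\sum_(n <oo) (h n)%:E = H%:E)%E.
Proof.
move=> h0; split => [cv|E].
  apply/cvg_lim => //; under eq_cvg do rewrite sumEFin.
  by apply/cvg_EFin; first by near=> n.
have : (\sum_(0 <= n < N) (h n)%:E)%E @[N --> \oo] --> H%:E.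
  by rewrite -E; apply: is_cvg_nneseries => n _ _; rewrite lee_fin.
by under eq_cvg do rewrite sumEFin; move=> /fine_cvg.
Unshelve. all: by end_near. Qed.

(** No mass escapes to large indices when the total masses converge to the
    total mass of the limit, so bounded test sequences, even varying with
    [m], can be integrated in the limit. *)
Lemma scheffe_series (alpha : nat -> nat -> R) (h : nat -> R) (tot : nat -> R) (H C : R)
    (a : nat -> nat -> R) (b : nat -> R) :
  (forall m n, 0 <= alpha m n) ->
  (forall n, alpha m n @[m --> \oo] --> h n) ->
  (forall m, \sum_(n <oo) (alpha m n)%:E = (tot m)%:E)%E ->
  tot m @[m --> \oo] --> H ->
  (\sum_(n <oo) (h n)%:E = H%:E)%E ->
  (forall m n, 0 <= a m n <= C) ->
  (forall n, a m n @[m --> \oo] --> b n) ->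
  exists L : R, exists x : nat -> R,
    [/\ (\sum_(n <oo) (h n * b n)%:E = L%:E)%E,
        forall m, (\sum_(n <oo) (alpha m n * a m n)%:E = (x m)%:E)%E &
        x m @[m --> \oo] --> L].
Proof.
move=> alpha0 alphah totE totH hH aC ab.
have h0 n : 0 <= h n.
  by apply: (cvgr_to_ge (alphah n)); near=> m.
have bC n : 0 <= b n <= C.
  by apply/andP; split; [apply: (cvgr_to_ge (ab n))|apply: (cvgr_to_le (ab n))];
    near=> m; have /andP[] := aC m n.
have C0 : 0 <= C by have /andP[/le_trans h1 /h1] := bC 0%N.
have tail (u v : nat -> R) (U : R) : (forall n, 0 <= u n) ->
    (forall n, 0 <= v n <= C) -> (\sum_(n <oo) (u n)%:E = U%:E)%E ->
    exists2 X : R, (\sum_(n <oo) (u n * v n)%:E = X%:E)%E &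
    forall N, \sum_(0 <= n < N) u n * v n <= X <=
      \sum_(0 <= n < N) u n * v n + C * (U - \sum_(0 <= n < N) u n).
  move=> u0 vC UE.
  have v0 n : 0 <= v n by have /andP[] := vC n.
  have split_series (w : nat -> R) N : (forall n, 0 <= w n) ->
      (\sum_(n <oo) (w n)%:E = (\sum_(0 <= n < N) w n)%:E + \sum_(N <= n <oo) (w n)%:E)%E.
    move=> w0; rewrite (nneseries_split 0 N); last by move=> n _; rewrite lee_fin.
    by rewrite add0n sumEFin.
  have dom N : (\sum_(N <= n <oo) (u n * v n)%:E <= C%:E * \sum_(N <= n <oo) (u n)%:E)%E.
    rewrite -nneseriesZl; last by move=> n _; rewrite lee_fin.
    apply: lee_nneseries => n _.
      by move=> _; rewrite lee_fin mulr_ge0.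
    by rewrite -EFinM lee_fin mulrC ler_wpM2r//; have /andP[] := vC n.
  have X0 : (0 <= \sum_(n <oo) (u n * v n)%:E)%E.
    by apply: nneseries_ge0 => n _ _; rewrite lee_fin mulr_ge0.
  have [X XE] : exists X : R, (\sum_(n <oo) (u n * v n)%:E = X%:E)%E.
    exists (fine (\sum_(n <oo) (u n * v n)%:E)%E); rewrite fineK// ge0_fin_numE//.
    by apply: le_lt_trans (dom 0%N) _; rewrite UE -EFinM ltry.
  exists X => // N.
  have T0 : (0 <= \sum_(N <= n <oo) (u n * v n)%:E)%E.
    by apply: nneseries_ge0 => n _ _; rewrite lee_fin mulr_ge0.
  have := split_series (fun n => u n * v n) N (fun n => mulr_ge0 (u0 n) (v0 n)).
  have := split_series u N u0; rewrite UE XE.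
  have := dom N; move: T0.
  case: (\sum_(N <= n <oo) (u n * v n)%:E)%E => [r1| |]//=.
  case: (\sum_(N <= n <oo) (u n)%:E)%E => [r2| |]//=.
  rewrite -!EFinD -EFinM !lee_fin => r10 r12 [] E1 [] E2.
    rewrite E1 E2; apply/andP; split; first by rewrite lerDl.
    by rewrite lerD2l; lra.
have [L LE Lb] := tail h b H h0 bC hH.
have /choice[x xP] : forall m, exists x : R,
    (\sum_(n <oo) (alpha m n * a m n)%:E = x%:E)%E /\
    forall N, \sum_(0 <= n < N) alpha m n * a m n <= x <=
      \sum_(0 <= n < N) alpha m n * a m n + C * (tot m - \sum_(0 <= n < N) alpha m n).
  by move=> m; have [X X1 X2] := tail _ _ _ (alpha0 m) (aC m) (totE m); exists X.
exists L, x; split => //; first by move=> m; have [] := xP m.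
apply/(@cvgrPdist_le _ R^o) => /= e e0.
pose e' := e / (C + C + 2).
have D0 : 0 < C + C + 2 by lra.
have e'0 : 0 < e' by rewrite divr_gt0.
have e'E : e' * (C + C + 2) = e by rewrite /e' divfK// lt0r_neq0.
have hcv := (nneseries_real_cvg H h0).2 hH.
have [N _ HN] : \forall N \near \oo, H - \sum_(0 <= n < N) h n < e' / 2.
  have e'20 : 0 < e' / 2 by rewrite divr_gt0.
  move/(@cvgrPdist_lt _ R^o) : hcv => /(_ _ e'20); apply: filterS => N.
  by apply: le_lt_trans; exact: ler_norm.
have {}HN := HN N (leqnn N).
have fin1 : \sum_(0 <= n < N) alpha m n * a m n @[m --> \oo] -->
            \sum_(0 <= n < N) h n * b n.
  by apply: cvg_big => [|n _]; [exact: add_continuous|exact: cvgM].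
have fin2 : tot m - \sum_(0 <= n < N) alpha m n @[m --> \oo] -->
            H - \sum_(0 <= n < N) h n.
  apply: cvgB => //; apply: cvg_big => [|n _]; [exact: add_continuous|exact: alphah].
near=> m.
have g1 : `|\sum_(0 <= n < N) h n * b n - \sum_(0 <= n < N) alpha m n * a m n| < e'.
  by near: m; move/(@cvgrPdist_lt _ R^o) : fin1; apply.
have g2 : tot m - \sum_(0 <= n < N) alpha m n < e'.
  by near: m; apply: (cvgr_lt _ fin2); apply: lt_trans HN _; lra.
have /andP[b1 b2] := Lb N; have [_ /(_ N)/andP[b3 b4]] := xP m.
move: g1; rewrite ltr_norml => /andP[g11 g12].
rewrite -e'E.
set Sh := \sum_(0 <= n < N) h n * b n in b1 b2 g11 g12.
set Sa := \sum_(0 <= n < N) alpha m n * a m n in b3 b4 g11 g12.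
have c1 : C * (H - \sum_(0 <= n < N) h n) <= C * e' by rewrite ler_wpM2l//; lra.
have c2 : C * (tot m - \sum_(0 <= n < N) alpha m n) <= C * e'.
  by rewrite ler_wpM2l// ltW.
have c3 : 0 <= C * e' by rewrite mulr_ge0// ltW.
have E : e' * (C + C + 2) = C * e' + C * e' + e' + e' by ring.
rewrite E; move: c1 c2 c3 b2 b4; set z1 := C * (H - _); set z2 := C * (tot m - _).
set z3 := C * e' => *.
by rewrite ler_norml; apply/andP; split; lra.
Unshelve. all: by end_near. Qed.
End real_series.

(** * Small-time moments of a subordinator *)

Section small_time.
Context d (T : measurableType d) (R : realType) (P : probability T R).
Variables (c2 : R) (nu : {measure set (measurableTypeR R) -> \bar R})
  (D : R -> T -> R).
Let f := bernstein c2 nu.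
Hypotheses (nu_levy : levy_measure nu) (D_sub : subordinator P f D).

Let mD (t : R) : 0 <= t -> measurable_fun setT (D t).
Proof. by move=> t0; have [[mD _ _ _ _] _ _] := D_sub; exact: mD. Qed.

Let D_ge0 (t : R) w : 0 <= t -> 0 <= D t w.
Proof.
move=> t0; have [[_ /(_ w)[D0 _] _ _ _] mono _] := D_sub.
by rewrite -D0; exact: mono.
Qed.

Definition exp_moment (z : nat) (s t : R) : R :=
  \int[P]_w (D t w ^+ z * expR (- (s * D t w))).

Lemma integrable_exp_moment z (s t : R) : 0 < s -> 0 <= t ->
  P.-integrable setT (EFin \o (fun w => D t w ^+ z * expR (- (s * D t w)))).
Proof.
move=> s0 t0; apply: measurable_bounded_integrable => //.
- by rewrite [X in (X < _)%E](_ : _ = 1%E) ?ltry//; exact: probability_setT.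
- apply: measurable_funM; first exact: measurable_funX (mD t0).
  apply: (measurableT_comp (@measurable_expR R)).
  apply: measurableT_comp => //.
  by apply: measurable_funM => //; exact: mD.
- exists (z`!%:R / s ^+ z); split; first by rewrite num_real.
  move=> x xM w _ /=; apply: le_trans (ltW xM).
  rewrite ger0_norm; first by apply: power_exp_bound => //; exact: D_ge0.
  by rewrite mulr_ge0 ?expR_ge0// exprn_ge0// D_ge0.
Qed.

Let moment0 (s t : R) : 0 < s -> 0 <= t -> exp_moment 0 s t = expR (- (t * f s)).
Proof.
move=> s0 t0; have [_ _ /(_ t s t0 s0)] := D_sub; rewrite unlock => E.
rewrite /exp_moment /Rintegral (_ : (\int[P]_w _)%E = (expR (- (t * f s)))%:E) //.
by rewrite -E; apply: eq_integral => w _; rewrite expr0 mul1r.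
Qed.

Let moment_low z (s h t : R) : 0 < s -> 0 < h -> 0 <= t ->
  exp_moment z s t - exp_moment z (s + h) t <= h * exp_moment z.+1 s t.
Proof.
move=> s0 h0 t0; have sh : 0 < s + h by rewrite addr_gt0.
have i1 := integrable_exp_moment z s0 t0.
have i2 := integrable_exp_moment z sh t0.
have i3 := integrable_exp_moment z.+1 s0 t0.
rewrite -RintegralB// -RintegralZl//; apply: le_Rintegral => //.
- exact: (integrableB measurableT i1 i2).
- exact: (integrableZl measurableT h i3).
move=> w _; have x0 := D_ge0 w t0; move: (D t w) x0 => x x0.
have xz : 0 <= x ^+ z by exact: exprn_ge0.
have e0 : 0 <= expR (- (s * x)) by exact: expR_ge0.
have := expR_ge1Dx (- (h * x)).
rewrite mulrDl opprD expRD exprS => e1.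
rewrite (_ : _ - _ = x ^+ z * expR (- (s * x)) * (1 - expR (- (h * x)))); last by ring.
rewrite [X in _ <= X](_ : _ = x ^+ z * expR (- (s * x)) * (h * x)); last by ring.
by apply: ler_wpM2l; [exact: mulr_ge0|lra].
Qed.

Let moment_up z (s h t : R) : 0 < h -> h < s -> 0 <= t ->
  h * exp_moment z.+1 s t <= exp_moment z (s - h) t - exp_moment z s t.
Proof.
move=> h0 hs t0; have sh : 0 < s - h by rewrite subr_gt0.
have s0 := lt_trans h0 hs.
have i1 := integrable_exp_moment z s0 t0.
have i2 := integrable_exp_moment z sh t0.
have i3 := integrable_exp_moment z.+1 s0 t0.
rewrite -RintegralB// -RintegralZl//; apply: le_Rintegral => //.
- exact: (integrableZl measurableT h i3).
- exact: (integrableB measurableT i2 i1).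
move=> w _; have x0 := D_ge0 w t0; move: (D t w) x0 => x x0.
have xz : 0 <= x ^+ z by exact: exprn_ge0.
have e0 : 0 <= expR (- (s * x)) by exact: expR_ge0.
have := expR_ge1Dx (h * x).
rewrite mulrBl opprB addrC expRD exprS => e1.
rewrite (_ : _ - _ = x ^+ z * expR (- (s * x)) * (expR (h * x) - 1)); last by ring.
rewrite [X in X <= _](_ : _ = x ^+ z * expR (- (s * x)) * (h * x)); last by ring.
by apply: ler_wpM2l; [exact: mulr_ge0|lra].
Qed.

Lemma exp_quotient_cvg (t : nat -> R) (a : R) : (forall m, 0 < t m) ->
  t m @[m --> \oo] --> 0 ->
  (expR (- (t m * a)) - 1) / t m @[m --> \oo] --> - a.
Proof.
move=> t0 t_cvg.
have dE : is_derive (0 : R) (1 : R) (fun u : R => expR (- (u * a))) (- a).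
  apply: is_derive_eq; rewrite mul0r oppr0 expR0 /GRing.scale/=; ring.
have q : h^-1 *: (expR (- ((h *: 1 + 0) * a)) - expR (- (0 * a))) @[h --> 0^'] --> - a.
  have dv : derivable (fun u : R => expR (- (u * a))) 0 1 by exact: ex_derive.
  have -> : - a = 'D_1 (fun u : R => expR (- (u * a))) 0 by rewrite derive_val.
  exact: dv.
have tn0 m : t m != 0 by exact: lt0r_neq0.
have := (cvgr_dnbhsP _ _ _).1 q t (conj tn0 t_cvg).
apply: cvg_trans; apply: near_eq_cvg; near=> m.
by rewrite /= mul0r oppr0 expR0 addr0 /GRing.scale /= mulr1 mulrC.
Unshelve. all: by end_near. Qed.

(** The case [z = 0] is the difference quotient of [exp (- t * f s)] at [t =
    0]. Each further moment is minus the derivative in [s] of the previous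
    one, and all of them are convex in [s], so that the limit can be
    differentiated. *)
Lemma small_time_moments (t : nat -> R) z (s : R) : (forall m, 0 < t m) ->
  t m @[m --> \oo] --> 0 -> 0 < s ->
  (exp_moment z s (t m) - (z == 0%N)%:R) / t m @[m --> \oo] -->
  (-1) ^+ z.+1 * derive1n z f s.
Proof.
move=> t0 t_cvg; elim: z s => [|z IH] s s0.
  rewrite eqxx expr1 mulN1r derive1n0.
  have := @exp_quotient_cvg t (f s) t0 t_cvg.
  by under [X in _ -> X]eq_cvg do rewrite moment0// ?ltW//.
rewrite /= [X in _ --> X](_ : _ = - - ((-1) ^+ z.+2 * derive1n z.+1 f s)); last by rewrite opprK.
rewrite opprK; under eq_cvg do rewrite subr0.
apply: (@convex_limit_derivative R
  (fun m u => (exp_moment z u (t m) - (z == 0%N)%:R) / t m)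
  (fun m u => exp_moment z.+1 u (t m) / t m)
  (fun u => (-1) ^+ z.+1 * derive1n z f u) s) => //.
- move=> m h h0; rewrite -mulrBl opprB addrA subrK mulrA ler_wpM2r//.
    by rewrite invr_ge0 ltW.
  by apply: moment_low => //; exact: ltW.
- move=> m h h0 hs; rewrite -mulrBl opprB addrA subrK mulrA ler_wpM2r//.
    by rewrite invr_ge0 ltW.
  by apply: moment_up => //; exact: ltW.
have [_ dz] := bernstein_deriven c2 nu_levy z s0.
have -> : - ((-1) ^+ z.+2 * derive1n z.+1 f s) = (-1) ^+ z.+1 * derive1n z.+1 f s.
  by rewrite (exprS _ z.+1) mulN1r mulNr opprK.
rewrite derive1nS derive1E.
have dz' : is_derive s 1 (derive1n z f) ('D_1 (derive1n z f) s) by exact: DeriveDef.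
exact: (@is_deriveZ _ _ _ (derive1n z f) ((-1) ^+ z.+1) s 1).
Qed.
End small_time.

(** * Rates of the batches of claims *)

Lemma Rintegral_sum d (T : measurableType d) (R : realType)
    (mu : {measure set T -> \bar R}) (B : set T) (I : Type) (s : seq I)
    (Q : pred I) (g : I -> T -> R) : measurable B ->
  (forall i, mu.-integrable B (EFin \o g i)) ->
  \int[mu]_(x in B) (\sum_(i <- s | Q i) g i x) =
  \sum_(i <- s | Q i) \int[mu]_(x in B) g i x.
Proof.
move=> mB ig; rewrite /Rintegral.
under eq_integral do rewrite -sumEFin.
rewrite (integral_sum mB (f := fun i x => (g i x)%:E))//.
rewrite (eq_bigr (fun i => (\int[mu]_(x in B) g i x)%:E)) => [|i _].
  by rewrite sumEFin.
by rewrite /Rintegral fineK//; exact: (integrable_fin_num mB (ig i)).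
Qed.

Lemma nneseries_behead (R : realType) (u : nat -> R) (U : R) :
  (forall n, 0 <= u n) -> (\sum_(n <oo) (u n)%:E = U%:E)%E ->
  (\sum_(n <oo) (u n.+1)%:E = (U - u 0%N)%:E)%E.
Proof.
move=> u0; rewrite nneseries_recl//; last by move=> n _; rewrite lee_fin.
rewrite -(nneseries_addn 1); last by move=> n; rewrite lee_fin.
under eq_eseriesr do rewrite addn1.
case: (\sum_(n <oo) _)%E => [r| |] //=.
by rewrite -EFinD => -[<-]; rewrite addrAC subrr add0r.
Qed.

Section rates.
Context d (T : measurableType d) (R : realType) (P : probability T R).
Variables (k : nat) (lambda : 'I_k -> R).
Variables (c2 : R) (nu : {measure set (measurableTypeR R) -> \bar R})
  (M : R -> T -> nat) (D : R -> T -> R).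
Let f := bernstein c2 nu.
Let Lambda := \sum_(i < k) lambda i.
Let p := gcp_pmf lambda.
Hypotheses (lambda_gt0 : forall i, 0 < lambda i) (k_gt0 : (0 < k)%N)
  (c2_ge0 : 0 <= c2) (nu_levy : levy_measure nu) (D_sub : subordinator P f D)
  (M_gcp : counting_process P lambda M).

Definition batch_coef n (a : {ffun 'I_k -> 'I_n.+1}) : R :=
  \prod_(i < k) (lambda i ^+ a i / (a i)`!%:R).

Definition batch_size n (a : {ffun 'I_k -> 'I_n.+1}) : nat := \sum_(i < k) a i.

(** The coefficient of the [n]-fold convolution in the series defining [W],
    without its normalization; it turns out to be the rate at which batches
    of [n] claims arrive. *)
Definition claim_rate n : R :=
  - \sum_(a in Omega k n)
    derive1n (\sum_(i < k) a i)%N f Lambda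
    * (\prod_(i < k) ((- lambda i) ^+ a i / (a i)`!%:R)).

Let coef_ge0 n (a : {ffun 'I_k -> 'I_n.+1}) : 0 <= batch_coef a.
Proof. by apply: prodr_ge0 => i _; rewrite divr_ge0// exprn_ge0// ltW. Qed.

Lemma total_rate_gt0 : 0 < Lambda.
Proof.
rewrite /Lambda (bigD1 (Ordinal k_gt0))//=; apply: ltr_pwDl => //.
by apply: sumr_ge0 => i _; exact: ltW.
Qed.

Let L0 := total_rate_gt0.

Lemma batch_size_gt0 n (a : {ffun 'I_k -> 'I_n.+1}) :
  (0 < n)%N -> a \in Omega k n -> (0 < batch_size a)%N.
Proof.
move=> n0; rewrite inE => /eqP an; rewrite lt0n; apply/eqP => a0.
move/eqP: a0; rewrite sum_nat_eq0 => /forallP a0.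
by move: n0; rewrite -an big1// => i _; rewrite (eqP (a0 i)) muln0.
Qed.

Lemma gcp_pmf_expand n x : p n x =
  \sum_(a in Omega k n) batch_coef a * (x ^+ batch_size a * expR (- (Lambda * x))).
Proof.
apply: eq_bigr => a _; rewrite mulNr mulrA; congr (_ * _).
rewrite /batch_coef /batch_size -prodrXr -big_split/=; apply: eq_bigr => i _.
by rewrite exprMn mulrAC.
Qed.

Let p_ge0 n (x : R) : 0 <= x -> 0 <= p n x.
Proof.
move=> x0; rewrite gcp_pmf_expand; apply: sumr_ge0 => a _.
by rewrite mulr_ge0// mulr_ge0 ?expR_ge0// exprn_ge0.
Qed.

Let pmf := subordinated_pmf P lambda D.

Lemma subordinated_pmf_expand (t : R) n : 0 <= t -> pmf t n =
  \sum_(a in Omega k n) batch_coef a * exp_moment P D (batch_size a) Lambda t.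
Proof.
move=> t0.
pose g (a : {ffun 'I_k -> 'I_n.+1}) w := batch_coef a *
  (D t w ^+ batch_size a * expR (- (Lambda * D t w))).
have ig a : P.-integrable setT (EFin \o g a).
  have := integrable_exp_moment D_sub (batch_size a) L0 t0.
  by move=> /(integrableZl measurableT (batch_coef a)).
transitivity (\int[P]_w \sum_(a in Omega k n) g a w).
  rewrite /pmf /subordinated_pmf /Rintegral; congr fine; apply: eq_integral => w _.
  by congr EFin; exact: gcp_pmf_expand.
rewrite Rintegral_sum//; apply: eq_bigr => a _; rewrite RintegralZl//.
exact: (integrable_exp_moment D_sub (batch_size a) L0 t0).
Qed.

Lemma gcp_pmf0 x : p 0 x = expR (- (Lambda * x)).
Proof.
rewrite gcp_pmf_expand (bigD1 [ffun=> ord0])/=; last first.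
  by rewrite inE big1// => i _; rewrite ffunE muln0.
rewrite big1 ?addr0; last first.
  move=> a /andP[_ /eqP[]]; apply/ffunP => i; rewrite ffunE; apply: val_inj => /=.
  by case: (a i) => -[].
rewrite /batch_coef /batch_size big1 ?big1 ?expr0 ?mul1r//.
- by move=> i _; rewrite ffunE.
- by move=> i _; rewrite ffunE expr0 fact0 divr1.
Qed.

Lemma subordinated_pmf0 (t : R) : 0 <= t -> pmf t 0 = expR (- (t * f Lambda)).
Proof.
move=> t0; rewrite /pmf /subordinated_pmf.
have [_ _ /(_ t _ t0 L0)] := D_sub; rewrite unlock => E.
rewrite (_ : (\int[P]_w _)%E = (expR (- (t * f Lambda)))%:E) // -E.
by apply: eq_integral => w _; rewrite -/p gcp_pmf0.
Qed.

Lemma claim_rateE n : claim_rate n =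
  \sum_(a in Omega k n) batch_coef a * ((-1) ^+ (batch_size a).+1
    * derive1n (batch_size a) f Lambda).
Proof.
rewrite /claim_rate -sumrN; apply: eq_bigr => a _.
rewrite (_ : \prod_(i < k) _ = (-1) ^+ batch_size a * batch_coef a).
  by rewrite /batch_size exprS; ring.
rewrite /batch_coef /batch_size -prodrXr -big_split/=; apply: eq_bigr => i _.
by rewrite (exprNn (lambda i)) mulrA.
Qed.

Lemma claim_rate_cvg (t : nat -> R) n : (0 < n)%N -> (forall m, 0 < t m) ->
  t m @[m --> \oo] --> 0 -> pmf (t m) n / t m @[m --> \oo] --> claim_rate n.
Proof.
move=> n0 t0 t_cvg; rewrite claim_rateE.
under eq_cvg => m do rewrite subordinated_pmf_expand ?mulr_suml ?(ltW (t0 m))//.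
apply: cvg_big => [|a aO]; first exact: add_continuous.
under eq_cvg do rewrite -mulrA; apply: cvgM; first exact: cvg_cst.
have := small_time_moments nu_levy D_sub (z := batch_size a) t0 t_cvg L0.
by rewrite eqn0Ngt (batch_size_gt0 n0 aO)/=; under eq_cvg do rewrite subr0.
Qed.

Let D_levy : levy_process P D. Proof. by have [] := D_sub. Qed.
Let D_mono w s t : 0 <= s -> s <= t -> D s w <= D t w.
Proof. by have [_ mono _] := D_sub; exact: mono. Qed.
Let D_ge0 t w : 0 <= t -> 0 <= D t w.
Proof. by move=> t0; have [_ /(_ w)[<- _] _ _ _] := D_levy; exact: D_mono. Qed.

Lemma subordinated_pmf_ge0 (t : R) n : 0 <= t -> 0 <= pmf t n.
Proof.
move=> t0; rewrite /pmf /subordinated_pmf fine_ge0// integral_ge0// => w _.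
by rewrite lee_fin p_ge0// D_ge0.
Qed.

Lemma subordinated_pmf_total (t : R) : 0 <= t ->
  (\sum_(n <oo) (pmf t n.+1)%:E = (1 - expR (- (t * f Lambda)))%:E)%E.
Proof.
move=> t0; rewrite -subordinated_pmf0//; apply: nneseries_behead.
  by move=> n; exact: subordinated_pmf_ge0.
rewrite -[RHS](integral_cst_prob P).
rewrite (eq_integral (fun w => \sum_(n <oo) (p n (D t w))%:E)%E); last first.
  by move=> w _; rewrite (gcp_pmf_sum M_gcp)// D_ge0.
rewrite integral_nneseries//.
- by apply: eq_eseriesr => n _; rewrite (subordinated_pmfE M_gcp).
- move=> n; apply/measurable_EFinP; apply: (measurableT_comp (measurable_gcp_pmf lambda n)).
  by have [mD _ _ _ _] := D_levy; exact: mD.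
- by move=> n w _; rewrite lee_fin p_ge0// D_ge0.
Qed.

Let pos : set (measurableTypeR R) := `]0%R, +oo[%classic.

Let posP (x : R) : pos x -> 0 < x. Proof. by rewrite /pos /= in_itv/= andbT. Qed.

Let mpos : measurable pos. Proof. exact: measurable_itv. Qed.

(** The part of the rate that a drift of the subordinator produces: single
    events of the Poisson processes underlying [M]. *)
Let single_coef n : R :=
  \sum_(a in Omega k n) batch_coef a * (batch_size a == 1%N)%:R.

(** The derivatives of the Bernstein function turn each coefficient into an
    integral against [nu], plus a drift contribution from the terms with
    exactly one event. *)
Let pmf_nu_integrable n :
  nu.-integrable pos (fun x : measurableTypeR R => (p n.+1 (x : R))%:E) /\
  claim_rate n.+1 = \int[nu]_(x in pos) p n.+1 x + c2 * single_coef n.+1.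
Proof.
pose g (a : {ffun 'I_k -> 'I_n.+2}) (x : measurableTypeR R) :=
  batch_coef a * (batch_size a != 0%N)%:R * ((x : R) ^+ (batch_size a) * expR (- (Lambda * x))).
have ig a : nu.-integrable pos (EFin \o g a).
  rewrite /g; case: (posnP (batch_size a)) => [->|a0].
    rewrite (_ : _ \o _ = cst 0%E) ?integrable0//.
    by apply/funext => x /=; rewrite ?eqxx mulr0 mul0r.
  rewrite /= mulr1.
  have := levy_moment_integrable nu_levy a0 L0.
  by move=> /(integrableZl mpos (batch_coef a)).
have gE x : p n.+1 x = \sum_(a in Omega k n.+1) g a x.
  rewrite gcp_pmf_expand; apply: eq_bigr => a aO.
  by rewrite /g -lt0n batch_size_gt0// mulr1.
split.
  rewrite (_ : (fun x : measurableTypeR R => _) =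
    (fun x => \sum_(a in Omega k n.+1) (g a x)%:E)%E).
    by apply: (integrable_sum mpos) => a _; exact: ig.
  by apply/funext => x; rewrite gE sumEFin.
under eq_Rintegral do rewrite gE.
rewrite (Rintegral_sum _ _ mpos ig) claim_rateE /single_coef mulr_sumr -big_split/=.
apply: eq_bigr => a aO; have a0 := batch_size_gt0 (ltn0Sn n) aO.
rewrite /g -lt0n a0 mulr1 RintegralZl//; last exact: levy_moment_integrable.
case: (batch_size a) a0 => // z _.
have [-> _] := bernstein_deriven c2 nu_levy z L0.
rewrite mulrA -exprD (_ : (-1) ^+ _ = 1); last first.
  by rewrite -signr_odd (_ : odd _ = false)// addSn addSn /= negbK oddD addbb.
by rewrite mul1r /levy_moment mulrDr eqSS; case: (z == 0%N); rewrite ?mulr1 ?mulr0 ?addr0 // (mulrC c2).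
Qed.

(** The batch of size [i.+1] made of one event of type [i]. *)
Let single_coef_ge (i : 'I_k) : lambda i <= single_coef i.+1.
Proof.
pose a : {ffun 'I_k -> 'I_i.+2} := [ffun j => if j == i then lift ord0 ord0 else ord0].
have aE j : a j = (j == i) :> nat by rewrite ffunE; case: (j == i).
have aO : a \in Omega k i.+1.
  rewrite inE (bigD1 i)//= aE eqxx muln1 big1 ?addn0// => j /negbTE ji.
  by rewrite aE ji muln0.
have a1 : batch_size a = 1%N.
  rewrite /batch_size (bigD1 i)//= aE eqxx big1 ?addn0// => j /negbTE ji.
  by rewrite aE ji.
have ac : batch_coef a = lambda i.
  rewrite /batch_coef (bigD1 i)//= aE eqxx expr1 divr1 big1 ?mulr1// => j /negbTE ji.
  by rewrite aE ji /= expr0 divr1.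
rewrite /single_coef (bigD1 a)//= a1 ac eqxx mulr1 lerDl.
by apply: sumr_ge0 => b _; rewrite mulr_ge0.
Qed.

Lemma claim_rate_ge0 n : 0 <= claim_rate n.+1.
Proof.
have [_ ->] := pmf_nu_integrable n; apply: addr_ge0.
  by apply: Rintegral_ge0 => x /posP x0; rewrite p_ge0// ltW.
apply: mulr_ge0 => //; apply: sumr_ge0 => a _.
by rewrite mulr_ge0.
Qed.

(** The partial sums are bounded by the limit of the total masses [(1 - exp
    (- t * f Lambda)) / t]. The opposite inequality is computed: the jump
    part of the rates sums by monotone convergence to the jump part of [f
    Lambda], because the probabilities of a counting process sum to one, and
    the drift part is at least [c2 * Lambda]. *)
Lemma claim_rate_sum : (\sum_(n <oo) (claim_rate n.+1)%:E = (f Lambda)%:E)%E.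
Proof.
apply/eqP; rewrite eq_le; apply/andP; split.
  apply: lime_le.
    by apply: is_cvg_nneseries => n _ _; rewrite lee_fin claim_rate_ge0.
  near=> N; rewrite sumEFin lee_fin.
  pose t m : R := m.+1%:R^-1.
  have t0 m : 0 < t m by rewrite invr_gt0.
  have t_cvg : t m @[m --> \oo] --> 0 by exact: cvg_harmonic.
  have tot_cvg : (1 - expR (- (t m * f Lambda))) / t m @[m --> \oo] --> f Lambda.
    rewrite -[X in _ --> X]opprK; under eq_cvg do rewrite -[X in X / _]opprB mulNr.
    by apply: cvgN; exact: exp_quotient_cvg.
  have part_cvg : \sum_(0 <= n < N) (pmf (t m) n.+1 / t m) @[m --> \oo] -->
      \sum_(0 <= n < N) claim_rate n.+1.
    apply: cvg_big => [|n _]; first exact: add_continuous.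
    exact: claim_rate_cvg.
  apply: (ler_cvg_to part_cvg tot_cvg); near=> m.
  rewrite -mulr_suml ler_wpM2r//; first by rewrite invr_ge0 ltW.
  rewrite -lee_fin -(subordinated_pmf_total (ltW (t0 m))) -sumEFin.
  by apply: nneseries_lim_ge => n _ _; rewrite lee_fin subordinated_pmf_ge0// ltW.
have EI n : (claim_rate n.+1)%:E = ((\int[nu]_(x in pos) (p n.+1 (x : R))%:E) +
    (c2 * single_coef n.+1)%:E)%E.
  have [ip ->] := pmf_nu_integrable n.
  by rewrite EFinD /Rintegral fineK//; exact: (integrable_fin_num mpos ip).
have c0 n : 0 <= c2 * single_coef n.+1.
  apply: mulr_ge0 => //; apply: sumr_ge0 => a _; by rewrite mulr_ge0.
under eq_eseriesr do rewrite EI.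
rewrite nneseriesD; last 2 first.
- move=> n _ _; apply: integral_ge0 => x /posP x0; rewrite lee_fin p_ge0//; exact: ltW.
- by move=> n _ _; rewrite lee_fin.
rewrite -integral_nneseries//; last 2 first.
- by move=> n; have [/measurable_int] := pmf_nu_integrable n.
- by move=> n x /posP x0; rewrite lee_fin p_ge0// ltW.
have gapE : (\int[nu]_(x in pos) (\sum_(n <oo) (p n.+1 (x : R))%:E) =
    (\int[nu]_(x in pos) (1 - expR (- (Lambda * (x : R)))))%:E)%E.
  rewrite /Rintegral fineK; last first.
    exact: (integrable_fin_num mpos (exp_gap_integrable nu_levy L0)).
  apply: eq_integral => x; rewrite inE => /posP x0.
  rewrite -gcp_pmf0; apply: (@nneseries_behead _ (fun n => p n (x : R))).
    by move=> n; rewrite p_ge0// ltW.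
  by apply: (gcp_pmf_sum M_gcp); exact: ltW.
rewrite gapE /f /bernstein addrC EFinD leeD2l//.
apply: le_trans (nneseries_lim_ge (m := 0) k _); last by move=> n _ _; rewrite lee_fin.
rewrite sumEFin lee_fin big_mkord -mulr_sumr ler_wpM2l//.
by apply: ler_sum => i _; exact: single_coef_ge.
Unshelve. all: by end_near. Qed.

End rates.

(** * Truncated means and tails *)

Section layer_cake.
Context d (T : measurableType d) (R : realType) (P : probability T R).

Lemma tail_event_measurable (X : T -> R) (u : R) : measurable_fun setT X ->
  measurable [set w | u < X w].
Proof.
move=> mX; rewrite (_ : [set w | _] = X @^-1` `]u, +oo[%classic).
  by rewrite -[X in measurable X]setTI; apply: mX => //; exact: measurable_itv.
by apply/seteqP; split => w /=; rewrite in_itv/= andbT.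
Qed.

Lemma tail_eventE (X : T -> R) (u : R) : measurable_fun setT X ->
  P [set w | u < X w] = (fine (P [set w | u < X w]))%:E.
Proof.
by move=> mX; rewrite fineK// fin_num_measure//; exact: tail_event_measurable.
Qed.

Lemma measurable_tail (X : T -> R) : measurable_fun setT X ->
  measurable_fun setT (fun u : R => P [set w | u < X w]).
Proof.
move=> mX; rewrite (_ : (fun u => _) = EFin \o (fun u => fine (P [set w | u < X w]))).
  apply/measurable_EFinP; apply: nonincreasing_measurable => // u v uv.
  have := tail_eventE u mX; have := tail_eventE v mX.
  rewrite -lee_fin => <- <-; apply: le_measure; rewrite ?inE//;
    try exact: tail_event_measurable.
  by move=> w /=; exact: le_lt_trans.
by apply/funext => u; rewrite /= -tail_eventE.
Qed.

Lemma expectation_truncated (X : T -> R) (y : R) : measurable_fun setT X ->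
  (forall w, 0 <= X w) -> 0 <= y ->
  (\int[P]_w (Num.min (X w) y)%:E =
   \int[lebesgue_measure]_(u in `[0%R, y]) P [set w | (u < X w)%R])%E.
Proof.
move=> mX X0 y0.
have mY : measurable_fun setT (fun w => Num.min (X w) y).
  exact: measurable_minr.
pose Y : {RV P >-> R} := HB.pack (fun w => Num.min (X w) y)
  (isMeasurableFun.Build _ _ _ _ _ mY).
have Y0 w : 0 <= Y w by rewrite /Y /= le_min X0.
have := ge0_expectation_ccdf Y0; rewrite unlock => E.
rewrite [LHS]E.
pose G u := P [set w | (u < X w)%R].
rewrite -integral_itv_bndo_bndc; last exact: measurable_funTS (measurable_tail mX).
rewrite [RHS](_ : _ = \int[lebesgue_measure]_(u in `[0%R, +oo[ `&` `[0%R, y[) G u)%E; last first.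
  congr (integral _ _ _); apply/seteqP; split => u /=; rewrite !in_itv/= ?andbT.
    by move=> /andP[-> ->].
  by move=> [-> /andP[_ ->]].
rewrite integral_mkcondr; apply: eq_integral => u; rewrite inE /= in_itv/= andbT => u0.
rewrite /patch; case: ifPn; rewrite ?inE ?notin_setE /= in_itv/= u0/=.
  move=> uy; rewrite /ccdf /distribution /pushforward /G; congr (P _).
  by apply/seteqP; split => w; rewrite /Y /= in_itv/= andbT lt_min uy andbT.
move=> uy; rewrite /ccdf /distribution /pushforward.
rewrite (_ : _ @^-1` _ = set0) ?measure0//; apply/seteqP; split => w //=.
by rewrite in_itv/= andbT lt_min => /andP[_ /uy].
Qed.

(** The truncated mean is the integral of the tail over the interval from
    [0] to [y], to which dominated convergence applies. *)
Lemma truncated_mean_cvg (X : nat -> T -> R) (t : nat -> R) (g y : R) (psi : R -> R) :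
  (forall m, measurable_fun setT (X m)) -> (forall m w, 0 <= X m w) ->
  (forall m, 0 < t m) -> 0 <= y ->
  (forall m u, 0 <= u -> fine (P [set w | u < X m w]) / t m <= g) ->
  (forall u, 0 <= u -> fine (P [set w | u < X m w]) / t m @[m --> \oo] --> psi u) ->
  lebesgue_measure.-integrable `[0, y] (EFin \o psi) /\
  fine (\int[P]_w (Num.min (X m w) y)%:E)%E / t m @[m --> \oo] -->
    \int[lebesgue_measure]_(u in `[0, y]) psi u.
Proof.
move=> mX X0 t0 y0 Xg Xpsi.
pose F m u := fine (P [set w | u < X m w]) / t m.
have mP m : measurable_fun setT (fun u : R => fine (P [set w | u < X m w])).
  have := measurable_tail (mX m); under eq_fun do rewrite (tail_eventE _ (mX m)).
  by move/measurable_EFinP.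
have mF m : measurable_fun setT (F m) by exact: measurable_funM.
have mI : measurable (`[0, y] : set (measurableTypeR R)) by exact: measurable_itv.
have Ipos u : `[0, y]%classic u -> 0 <= u by rewrite /= in_itv/= => /andP[].
have mpsi : measurable_fun `[0, y] psi.
  apply: (@measurable_fun_cvg _ _ _ _ F) => [m|u /Ipos u0]; last exact: Xpsi.
  exact: measurable_funTS.
have F0 m u : 0 <= F m u by rewrite divr_ge0 ?fine_ge0// ltW.
have intg : lebesgue_measure.-integrable `[0, y] (EFin \o cst g).
  apply: measurable_bounded_integrable => //.
    by rewrite [X in (X < _)%E]lebesgue_measure_itv/=; case: ifP => _; rewrite ?oppr0 ?adde0 -?EFinD ltry.
  by exists `|g|; split; [exact: num_real|move=> z gz u _ /=; exact: ltW].
have iF m : lebesgue_measure.-integrable `[0, y] (EFin \o F m).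
  apply: (le_integrable mI _ _ intg).
    by apply/measurable_EFinP; exact: (measurable_funTS (mF m)).
  move=> u /Ipos u0; rewrite /= lee_fin ger0_norm//; apply: le_trans (Xg _ _ u0) _.
  exact: ler_norm.
have [] := @dominated_convergence _ _ _ lebesgue_measure _ mI
  (fun m u => (F m u)%:E) (EFin \o psi) (EFin \o cst g).
- by move=> m; apply/measurable_EFinP; exact: (measurable_funTS (mF m)).
- exact/measurable_EFinP.
- apply: aeW => u /Ipos u0; apply/cvg_EFin; first by near=> m.
  exact: Xpsi.
- exact: intg.
- apply: aeW => u m /Ipos u0; rewrite /= lee_fin ger0_norm//; exact: Xg.
move=> ipsi _ cv; split => //.
have /fine_cvg : (\int[lebesgue_measure]_(u in `[0%R, y]) (F m u)%:E)%E @[m --> \oo] -->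
    (\int[lebesgue_measure]_(u in `[0, y]) psi u)%:E.
  rewrite /Rintegral fineK; last exact: (integrable_fin_num mI ipsi).
  exact: cv.
apply: cvg_trans; apply: near_eq_cvg; near=> m.
rewrite /= expectation_truncated//.
have -> : (\int[lebesgue_measure]_(u in `[0%R, y]) P [set w | (u < X m w)%R] =
    (t m)%:E * \int[lebesgue_measure]_(u in `[0%R, y]) (F m u)%:E)%E.
  rewrite -(@integralZl _ _ _ _ _ mI _ (iF m)); apply: eq_integral => u _.
  by rewrite (tail_eventE _ (mX m)) -EFinM /F mulrCA divff ?mulr1// lt0r_neq0.
rewrite fineM//; last exact: (integrable_fin_num mI (iF m)).
by rewrite /= mulrAC divff ?mul1r// lt0r_neq0.
Unshelve. all: by end_near. Qed.
End layer_cake.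

(** * Ruin of a jump process started from zero capital *)

Section almost_sure.
Context d (T : measurableType d) (R : realType) (P : probability T R).

Lemma probability_ae_eq (A B : set T) : measurable A -> measurable B ->
  {ae P, forall w, A w <-> B w} -> P A = P B.
Proof.
move=> mA mB [N [mN N0 NAB]].
have N1 : P (~` N) = 1%E by rewrite probability_setC// N0 sube0.
rewrite -(probability_setI1 mA (measurableC mN) N1).
rewrite -(probability_setI1 mB (measurableC mN) N1); congr (P _).
apply/seteqP; split => w [AB nN]; split => //;
  by (have h : A w <-> B w by apply: contrapT => h; apply: nN; exact: NAB); apply/h.
Qed.
End almost_sure.

Section zero_capital.
Context d (T : measurableType d) (R : realType) (P : probability T R).
Variables (S : R -> T -> R) (c y g : R) (psi : R -> R).
Let step (delta : R) (j : nat) (w : T) : R := S (j.+1%:R * delta) w - S (j%:R * delta) w.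
Hypotheses (S0 : forall w, S 0 w = 0)
  (S_path : forall w, right_locally_constant (S ^~ w))
  (S_iid : forall delta : R, 0 < delta -> exists mu, iid_with P (step delta) mu)
  (S_incr : forall (delta : R) j, 0 < delta -> {ae P, forall w, 0 <= step delta j w})
  (S_mean : (\int[P]_w `|S 1 w|%:E <= c%:E)%E)
  (c_gt0 : 0 < c) (y_ge0 : 0 <= y) (g_ge0 : 0 <= g)
  (S_tail_le : forall (delta u : R), 0 < delta -> 0 <= u ->
    fine (P [set w | u < `|S delta w|]) / delta <= g)
  (S_tail : forall (t : nat -> R) (u : R), (forall m, 0 < t m) ->
    t m @[m --> \oo] --> 0 -> 0 <= u ->
    fine (P [set w | u < `|S (t m) w|]) / t m @[m --> \oo] --> psi u)
  (S_escape : forall (t : nat -> R), (forall m, 0 < t m) ->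
    t m @[m --> \oo] --> 0 ->
    fine (P [set w | m%:R < `|S (t m) w|]) / t m @[m --> \oo] --> 0).

Let astep (delta : R) (j : nat) (w : T) : R := `|step delta j w|.

Let step0 delta w : step delta 0 w = S delta w.
Proof. by rewrite /step mul1r mul0r S0 subr0. Qed.

Let mS (delta : R) : 0 < delta -> measurable_fun setT (S delta).
Proof.
move=> d0; have [mu [ms _ _]] := S_iid d0; have := ms 0%N.
by rewrite (_ : step delta 0 = S delta)//; apply/funext => w; exact: step0.
Qed.

Let mstep (delta : R) j : 0 < delta -> measurable_fun setT (step delta j).
Proof. by move=> d0; have [mu [ms _ _]] := S_iid d0. Qed.

Let astep_iid (delta : R) : 0 < delta ->
  exists2 mu, iid_with P (astep delta) mu & mu `]0, +oo[%classic <= g * delta.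
Proof.
move=> d0; have [mu mu_iid] := S_iid d0.
have iidA := iid_comp mu_iid (@normr_measurable R setT).
exists (fun B => mu (Num.norm @^-1` B)) => //.
have [_ /(_ 0%N `]0, +oo[%classic (measurable_itv _)) E _] := iidA.
rewrite -ler_pdivrMr//; apply: le_trans (S_tail_le d0 (lexx 0)).
rewrite ler_wpM2r ?invr_ge0 ?(ltW d0)// -[X in X <= _]/(fine (_%:E)) -E.
rewrite le_eqVlt; apply/orP; left; apply/eqP; congr (fine (P _)).
by apply/seteqP; split => w /=; rewrite in_itv/= andbT step0.
Qed.

(** The steps are nonnegative only almost surely; their absolute values are
    nonnegative everywhere and give path events the same probability. *)
Let path_event_abs (delta : R) (A : set (path_space R)) : 0 < delta -> measurable A ->
  measurable [set w | A (fun j => step delta j w)] /\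
  P [set w | A (fun j => step delta j w)] = P [set w | A (fun j => astep delta j w)].
Proof.
move=> d0 mA.
have m1 : measurable [set w | A (fun j => step delta j w)].
  have /measurable_path := fun j => mstep j d0.
  by move=> /(_ measurableT _ mA); rewrite setTI.
have m2 : measurable [set w | A (fun j => astep delta j w)].
  have /measurable_path : forall j, measurable_fun setT (astep delta j).
    by move=> j; apply: measurableT_comp => //; exact: mstep.
  by move=> /(_ measurableT _ mA); rewrite setTI.
split => //; apply: probability_ae_eq => //.
have : {ae P, forall w j, 0 <= step delta j w}.
  by apply: ae_foralln => j; exact: S_incr.
apply: filterS => w h /=.
rewrite (_ : (fun j => astep delta j w) = (fun j => step delta j w))//.
by apply/funext => j; rewrite /astep ger0_norm.
Qed.

(** Slightly above [c], so that the walk goes to infinity even when the mean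
    claim per unit of time equals [c]. *)
Let cm (m : nat) : R := c * (1 + m.+1%:R^-1).

Let c_lt_cm m : c < cm m.
Proof. by rewrite /cm mulrDr mulr1 ltrDl mulr_gt0// invr_gt0. Qed.

Let cm_cvg : cm m @[m --> \oo] --> c.
Proof.
have : cm m @[m --> \oo] --> c * (1 + 0).
  apply: cvgM; first exact: cvg_cst.
  by apply: cvgD; [exact: cvg_cst|exact: cvg_harmonic].
by rewrite addr0 mulr1.
Qed.

Let level (b A : R) n : set (path_space R) := [set x | A <= walk b x n].

Let mlevel b A n : measurable (level b A n).
Proof.
rewrite (_ : level b A n = (fun x : path_space R => walk b x n) @^-1` `[A, +oo[%classic).
  by rewrite -[X in measurable X]setTI; apply: measurable_walk => //; exact: measurable_itv.
by apply/seteqP; split => x /=; rewrite in_itv/= andbT.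
Qed.

(** The horizon is measured on the grid of mesh [1]. It does not depend on
    the mesh used later, since the walk and the process agree at grid
    points. *)
Let horizon m : exists n : nat, (m <= n)%N /\
  1 - m.+1%:R^-1 <= fine (P [set w | m%:R <= cm m * n%:R - S n%:R w]).
Proof.
have d1 : 0 < 1 :> R by exact: ltr01.
have [mu mu_iid mu0] := astep_iid d1.
have [mean meanE] : exists mean : R, (\int[P]_w (astep 1 0 w)%:E = mean%:E)%E.
  exists (fine (\int[P]_w (astep 1 0 w)%:E)%E).
  rewrite fineK// ge0_fin_numE; last by apply: integral_ge0 => w _; rewrite lee_fin normr_ge0.
  apply: le_lt_trans (ltry c); apply: le_trans S_mean.
  by under eq_integral do rewrite /astep step0.
have mean_c : mean <= c.
  rewrite -lee_fin -meanE; apply: le_trans S_mean.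
  by under eq_integral do rewrite /astep step0.
have mean_cm : mean < cm m by exact: le_lt_trans (c_lt_cm m).
have := walk_to_infinity mu_iid (fun j w => normr_ge0 _) meanE (m%:R) mean_cm.
move=> /fine_cvg /= cv.
have e1 : 1 - m.+1%:R^-1 < 1 :> R by rewrite ltrBlDr ltrDl invr_gt0.
have : \forall n \near \oo, (m <= n)%N /\
  1 - m.+1%:R^-1 <= fine (P [set w | m%:R <= walk (cm m) (fun i => astep 1 i w) n]).
  near=> n; split; first by near: n; exact: nbhs_infty_ge.
  by near: n; exact: (cvgr_ge _ cv).
move=> [n0 _ /(_ n0 (leqnn n0))[mn h]]; exists n0; split => //.
apply: le_trans h _; rewrite le_eqVlt; apply/orP; left; apply/eqP; congr fine.
have [_ <-] := path_event_abs d1 (mlevel (cm m) m%:R n0).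
have E w : walk (cm m) (fun j => step 1 j w) n0 = cm m * n0%:R - S n0%:R w.
  by have := @walk_increments R (S ^~ w) (cm m) 1 n0 (S0 w); rewrite !mulr1.
by congr (P _); apply/seteqP; split => w; rewrite /level /= E.
Unshelve. all: by end_near. Qed.

Let trunc_mean (delta : R) : R := fine (\int[P]_w (Num.min `|S delta w| y)%:E)%E.

Let mabs (delta : R) : 0 < delta -> measurable_fun setT (fun w => `|S delta w|).
Proof. by move=> d0; apply: measurableT_comp => //; exact: mS. Qed.

Let mmin (delta : R) : 0 < delta ->
  measurable_fun setT (fun w => (Num.min `|S delta w| y)%:E).
Proof.
by move=> d0; apply/measurable_EFinP; apply: measurable_minr => //; exact: mabs.
Qed.

Let min_ge0 (delta : R) w : 0 <= Num.min `|S delta w| y.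
Proof. by rewrite le_min normr_ge0. Qed.

Let trunc_meanE (delta : R) : 0 < delta ->
  (\int[P]_w (Num.min `|S delta w| y)%:E = (trunc_mean delta)%:E)%E.
Proof.
move=> d0; rewrite fineK// ge0_fin_numE; last first.
  by apply: integral_ge0 => w _; rewrite lee_fin min_ge0.
apply: le_lt_trans (ltry y); rewrite -[leRHS](integral_cst_prob P).
apply: ge0_le_integral => //.
- by move=> w _; rewrite lee_fin min_ge0.
- exact: mmin.
- by move=> w _; rewrite lee_fin ge_min lexx orbT.
Qed.

Let mruin (b : R) n (delta : R) : 0 < delta ->
  measurable [set w | ruin_by b y n (fun j => step delta j w)].
Proof.
by move=> d0; have [] := path_event_abs d0 (measurable_ruin_by b y n).
Qed.

Let cut (A x : R) : R := Num.min `|x| y * (x <= A)%R%:R.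

Let mcut A : measurable_fun setT (cut A).
Proof.
apply: measurable_funM; first by apply: measurable_minr.
rewrite (_ : (fun _ => _) = \1_(`]-oo, A]%classic)); first exact: measurable_indic.
by apply/funext => x; rewrite indicE mem_setE in_itv.
Qed.

Let cut_ge0 A x : 0 <= cut A x.
Proof. by rewrite mulr_ge0// ?le_min ?normr_ge0//; case: (_ <= _). Qed.

Let cut_mean (delta A : R) : 0 < delta -> exists2 ct : R,
  (\int[P]_w (cut A `|S delta w|)%:E = ct%:E)%E &
  trunc_mean delta - y * fine (P [set w | A < `|S delta w|]) <= ct.
Proof.
move=> d0.
have mc : measurable_fun setT (fun w => (cut A `|S delta w|)%:E).
  by apply/measurable_EFinP; apply: measurableT_comp => //; exact: mabs.
have cut_le w : cut A `|S delta w| <= Num.min `|S delta w| y.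
  rewrite /cut normr_id; case: (_ <= A); rewrite ?mulr1// mulr0.
  exact: min_ge0.
have [ct ctE] : exists ct : R, (\int[P]_w (cut A `|S delta w|)%:E = ct%:E)%E.
  exists (fine (\int[P]_w (cut A `|S delta w|)%:E)%E).
  rewrite fineK// ge0_fin_numE; last by apply: integral_ge0 => w _; rewrite lee_fin.
  apply: le_lt_trans (ltry (trunc_mean delta)); rewrite -trunc_meanE//.
  apply: ge0_le_integral => //; first by move=> w _; rewrite lee_fin.
    exact: mmin.
  by move=> w _; rewrite lee_fin.
exists ct => //; rewrite lerBlDr -lee_fin EFinD -ctE -trunc_meanE//.
pose B := [set w | A < `|S delta w|].
have mB : measurable B by exact: tail_event_measurable (mabs d0).
have mind : measurable_fun setT (fun w => (y * \1_B w)%:E).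
  by apply/measurable_EFinP; apply: measurable_funM => //; exact: measurable_indic.
have ind0 w : setT w -> (0 <= (y * \1_B w)%:E)%E.
  by move=> _; rewrite lee_fin mulr_ge0.
have -> : (y * fine (P B))%:E = (\int[P]_w (y * \1_B w)%:E)%E.
  under eq_integral do rewrite EFinM.
  rewrite ge0_integralZl//; last by apply/measurable_EFinP; exact: measurable_indic.
  by rewrite integral_indic// setIT EFinM fineK// fin_num_measure.
rewrite -ge0_integralD//; last by move=> w _; rewrite lee_fin.
apply: ge0_le_integral => //.
- by move=> w _; rewrite lee_fin min_ge0.
- exact: mmin.
- exact: emeasurable_funD.
move=> w _; rewrite -EFinD lee_fin /cut normr_id indicE.
case: (leP `|S delta w| A) => SA.
  by rewrite mulr1 memNset ?mulr0 ?addr0// /B /= => /(le_lt_trans SA); rewrite ltxx.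
by rewrite mulr0 add0r mem_set// mulr1 ge_min lexx orbT.
Qed.

Let skeleton_bounds (delta : R) n (m : nat) : 0 < delta ->
  exists q : R, [/\ 0 <= q, q <= g * delta,
    cm m * delta * fine (P [set w | ruin_by (cm m * delta) y n (fun j => step delta j w)])
      <= trunc_mean delta + cm m * delta * (q * (1 + n%:R * q)) &
    fine (P [set w | m%:R <= walk (cm m * delta) (fun j => step delta j w) n]) *
      (trunc_mean delta - y * fine (P [set w | m%:R < `|S delta w|]))
      <= cm m * delta * fine (P [set w | ruin_by (cm m * delta) y n (fun j => step delta j w)])
         + cm m * delta * (q * (2 + n%:R * q))].
Proof.
move=> d0; have [mu mu_iid mu_le] := astep_iid d0.
have b0 : 0 < cm m * delta by rewrite mulr_gt0// (lt_trans c_gt0).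
have a0 j w : 0 <= astep delta j w by exact: normr_ge0.
have [mr Er] := path_event_abs d0 (measurable_ruin_by (cm m * delta) y n).
have [ml El] := path_event_abs d0 (mlevel (cm m * delta) m%:R n).
have finE (A : set T) : measurable A -> P A = (fine (P A))%:E.
  by move=> mA; rewrite fineK// fin_num_measure.
exists (mu `]0, +oo[%classic); split => //.
- have [_ /(_ 0%N _ (measurable_itv `]0, +oo[)) E _] := mu_iid.
  by rewrite -lee_fin -E.
- have := ruin_by_upper mu_iid a0 n b0 y_ge0.
  rewrite -Er (finE _ mr) -EFinM.
  have -> : (\int[P]_w (Num.min (astep delta n.+1 w) y)%:E = (trunc_mean delta)%:E)%E.
    rewrite -trunc_meanE//.
    have f0 (x : R) : 0 <= Num.min `|x| y by rewrite le_min normr_ge0.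
    have mf : measurable_fun setT (fun x : R => Num.min `|x| y) by exact: measurable_minr.
    have := iid_integral mu_iid n.+1 0 mf f0.
    under eq_integral do rewrite normr_id.
    move=> ->; apply: eq_integral => w _; by rewrite /astep step0 normr_id.
  by rewrite -EFinD lee_fin.
have := ruin_by_lower mu_iid a0 n b0 y_ge0 m%:R.
have [ct ctE ct_ge] := cut_mean m%:R d0.
have -> : (\int[P]_w (Num.min (astep delta n.+1 w) y * (astep delta n.+1 w <= m%:R)%R%:R)%:E
    = ct%:E)%E.
  rewrite -ctE.
  have := iid_integral mu_iid n.+1 0 (mcut m%:R) (cut_ge0 m%:R).
  under eq_integral do rewrite /cut /astep normr_id.
  move=> ->; apply: eq_integral => w _; by rewrite /astep step0.
rewrite -El (finE _ ml) -Er (finE _ mr) -!EFinM -EFinD lee_fin.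
move=> h; apply: le_trans h; apply: ler_wpM2l; last exact: ct_ge.
by rewrite /= fine_ge0.
Qed.

(** The reversal bounds give, for the walk of mesh [delta] and drift [cm m],
    the ruin probability [trunc_mean delta / (cm m * delta)] up to errors of
    order [delta + delta * T], where [T] is the time horizon. First the
    horizon is chosen so large that the walk has most likely passed every
    relevant claim, then the mesh is chosen small compared with the inverse
    of the horizon. *)
Lemma zero_capital_ruin :
  let tau w := ereal_inf [set t%:E | t in [set t | 0 < t /\ c * t - S t w < 0]] in
  lebesgue_measure.-integrable `[0, y] (EFin \o psi) /\
  P [set w | (tau w < +oo)%E /\ `|c * fine (tau w) - S (fine (tau w)) w| <= y] =
  (c^-1 * \int[lebesgue_measure]_(u in `[0, y]) psi u)%:E.
Proof.
move=> tau; set ruin := (X in P X).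
have /choice[Tm TmP] := horizon.
(* the mesh divides 1, so that the horizon is a grid point, and is small
   compared with the inverse of the horizon *)
pose dm m : R := ((Tm m).+1 * m.+1)%:R^-1.
pose nm m := (Tm m * ((Tm m).+1 * m.+1))%N.
have d0 m : 0 < dm m by rewrite invr_gt0.
have nd m : (nm m)%:R * dm m = (Tm m)%:R.
  by rewrite /nm /dm natrM mulfK// pnatr_eq0.
have hm m : 0 < m.+1%:R^-1 :> R by rewrite invr_gt0.
have dT m : (Tm m)%:R * dm m <= m.+1%:R^-1.
  rewrite /dm natrM invfM mulrA ler_piMl ?(ltW (hm m))//.
  by rewrite ler_pdivrMr// mul1r ler_nat.
have d1 m : dm m <= m.+1%:R^-1.
  rewrite /dm natrM invfM ler_piMl ?(ltW (hm m))// invf_le1// ler1n//.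
have harm : m.+1%:R^-1 @[m --> \oo] --> (0 : R) by exact: cvg_harmonic.
have d_cvg : dm m @[m --> \oo] --> 0.
  apply: (@squeeze_cvgr _ _ _ _ (cst 0) (fun m => m.+1%:R^-1)) => //; last exact: cvg_cst.
  by near=> m; rewrite (ltW (d0 m)) d1.
pose A_ m := [set w | ruin_by (cm m * dm m) y (nm m) (fun j => step (dm m) j w)].
have A_ruin w : \forall m \near \oo, A_ m w <-> ruin w.
  apply: (@skeleton_ruin_cvg R (S ^~ w) c y cm dm nm) => //.
    by move=> m; exact: ltW.
  move=> t; near=> m; rewrite nd; apply: le_trans (_ : m%:R <= _); last first.
    by rewrite ler_nat; have [] := TmP m.
  by near: m; exact: nbhs_infty_ger.
have [mE] := eventually_constant_event P (fun m => mruin (cm m * dm m) (nm m) (d0 m)) A_ruin.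
have PE : P ruin = (fine (P ruin))%:E by rewrite fineK// fin_num_measure.
rewrite PE => /fine_cvg /= a_cvg.
pose tl m := fine (P [set w | m%:R < `|S (dm m) w|]).
pose pm m := fine (P [set w | m%:R <= cm m * (Tm m)%:R - S (Tm m)%:R w]).
(* bounds [q * (2 + n * q)] when [q <= g * dm m] and [n * dm m = Tm m] *)
pose err m := (2 * g + g ^+ 2) * m.+1%:R^-1.
have [ipsi mean_cvg] := truncated_mean_cvg (fun m => mabs (d0 m))
  (fun m w => normr_ge0 _) d0 y_ge0 (fun m u => S_tail_le (d0 m))
  (fun u u0 => S_tail d0 d_cvg u0).
split => //; congr EFin; set I := (X in _ = c^-1 * X) in mean_cvg *.
have esc_cvg := S_escape d0 d_cvg.
have cm0 m : 0 < cm m by exact: lt_trans (c_lt_cm m).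
have icm_cvg : (cm m)^-1 @[m --> \oo] --> c^-1 by apply: cvgV => //; exact: lt0r_neq0.
have err_cvg : err m @[m --> \oo] --> 0.
  have : err m @[m --> \oo] --> (2 * g + g ^+ 2) * 0 by apply: cvgM => //; exact: cvg_cst.
  by rewrite mulr0.
have pmE m : pm m =
    fine (P [set w | m%:R <= walk (cm m * dm m) (fun j => step (dm m) j w) (nm m)]).
  congr (fine (P _)); apply/seteqP; split => w /=;
    by rewrite (walk_increments (S := S ^~ w) (cm m) (dm m) (nm m) (S0 w)) nd.
have pm_le1 m : pm m <= 1.
  rewrite pmE; have [ml _] := path_event_abs (d0 m) (mlevel (cm m * dm m) m%:R (nm m)).
  by rewrite -lee_fin fineK ?fin_num_measure//; exact: probability_le1.
have pm_cvg : pm m @[m --> \oo] --> (1 : R).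
  apply: (@squeeze_cvgr _ _ _ _ (fun m => 1 - m.+1%:R^-1) (cst 1)).
  - by near=> m; rewrite pm_le1 andbT; have [] := TmP m.
  - have : 1 - m.+1%:R^-1 @[m --> \oo] --> (1 - 0 : R) by apply: cvgB => //; exact: cvg_cst.
    by rewrite subr0.
  - exact: cvg_cst.
pose lo m := (cm m)^-1 * (pm m * (trunc_mean (dm m) / dm m - y * (tl m / dm m))) - err m.
pose hi m := (cm m)^-1 * (trunc_mean (dm m) / dm m) + err m.
have bounds m : lo m <= fine (P (A_ m)) <= hi m.
  have [q [q0 qg up low]] := skeleton_bounds (nm m) m (d0 m).
  have errP : q * (2 + (nm m)%:R * q) <= err m.
    have h1 : (nm m)%:R * q <= g * (Tm m)%:R.
      apply: (@le_trans _ _ ((nm m)%:R * (g * dm m))); first exact: ler_wpM2l.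
      by rewrite mulrCA nd.
    apply: (@le_trans _ _ (g * dm m * (2 + g * (Tm m)%:R))).
      by apply: ler_pM => //; [rewrite addr_ge0// mulr_ge0|rewrite lerD2l].
    rewrite (_ : _ * _ = 2 * g * dm m + g ^+ 2 * ((Tm m)%:R * dm m)); last by ring.
    rewrite /err (mulrDl (2 * g)); apply: lerD; apply: ler_wpM2l => //; first by rewrite mulr_ge0.
    exact: sqr_ge0.
  have errP' : q * (1 + (nm m)%:R * q) <= err m.
    by apply: le_trans errP; apply: ler_wpM2l => //; rewrite lerD2r ler1n.
  have b0 : 0 < cm m * dm m by exact: mulr_gt0.
  rewrite -pmE -/(tl m) -/(A_ m) in up low.
  have cn : cm m != 0 by exact: lt0r_neq0.
  have dn : dm m != 0 by exact: lt0r_neq0.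
  apply/andP; split; rewrite -(ler_pM2l b0).
    rewrite (_ : _ * lo m = pm m * (trunc_mean (dm m) - y * tl m) - cm m * dm m * err m).
      by rewrite lerBlDr; apply: le_trans low _; rewrite lerD2l ler_wpM2l// ltW.
    by rewrite /lo; field; rewrite cn dn.
  rewrite (_ : _ * hi m = trunc_mean (dm m) + cm m * dm m * err m).
    by apply: le_trans up _; rewrite lerD2l ler_wpM2l// ltW.
  by rewrite /hi; field; rewrite cn dn.
have lo_cvg : lo m @[m --> \oo] --> c^-1 * I.
  have -> : c^-1 * I = c^-1 * (1 * (I - y * 0)) - 0 by rewrite mulr0 !subr0 mul1r.
  apply: cvgB => //; apply: cvgM => //; apply: cvgM => //; apply: cvgB => //.
  by apply: cvgM => //; exact: cvg_cst.
have hi_cvg : hi m @[m --> \oo] --> c^-1 * I.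
  have -> : c^-1 * I = c^-1 * I + 0 by rewrite addr0.
  by apply: cvgD => //; exact: cvgM.
have sq : fine (P (A_ m)) @[m --> \oo] --> c^-1 * I.
  by apply: (squeeze_cvgr _ lo_cvg hi_cvg); near=> m; exact: bounds.
by apply: (cvg_unique _ a_cvg sq).
Unshelve. all: by end_near. Qed.
End zero_capital.

(** * Aggregate claims of the time-changed process *)

Section claims.
Context d (T : measurableType d) (R : realType) (P : probability T R).
Variables (k : nat) (lambda : 'I_k -> R)
    (c2 : R) (nu : {measure set (measurableTypeR R) -> \bar R})
    (M : R -> T -> nat) (D : R -> T -> R) (Z : nat -> {RV P >-> R})
    (F : probability (measurableTypeR R) R).
Hypotheses (k_gt0 : (0 < k)%N) (lambda_gt0 : forall i, 0 < lambda i)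
    (c2_ge0 : 0 <= c2) (nu_levy : levy_measure nu)
    (M_gcp : counting_process P lambda M)
    (D_sub : subordinator P (bernstein c2 nu) D)
    (MD_indep : independent_sigma P
       (sigma_family [set t | 0 <= t] M) (sigma_family [set t | 0 <= t] D))
    (Z_gt0 : forall j, {ae P, forall w, 0 < Z j w})
    (Z_indep : mutually_independent P (fun j => Z j : T -> R))
    (Z_law : forall j (B : set R), measurable B -> distribution P (Z j) B = F B)
    (ZN_indep : independent_sigma P
       (sigma_family setT (fun j => Z j : T -> R))
       (sigma_family [set t | 0 <= t] (time_changed M D))).

Let Zs (j : nat) : T -> R := Z j.
Let N := time_changed M D.
Let S := aggregate_claims N Zs.
Let Lambda := \sum_(i < k) lambda i.
Let g := bernstein c2 nu Lambda.
Let pmf := subordinated_pmf P lambda D.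
Let rate := claim_rate lambda c2 nu.
Let Fn := conv_cdf P Zs.

Let D_levy : levy_process P D. Proof. by have [] := D_sub. Qed.
Let D_mono w (s t : R) : 0 <= s -> s <= t -> D s w <= D t w.
Proof. by have [_ mono _] := D_sub; exact: mono. Qed.

Let mZ j : measurable_fun setT (Zs j). Proof. exact: measurable_funP. Qed.

Let Z_iid : iid_with P Zs (fun B => fine (F B)).
Proof.
split => // j B mB; have := Z_law j mB; rewrite /distribution /pushforward => ->.
by rewrite fineK// fin_num_measure.
Qed.

Let N0 w : N 0 w = 0%N. Proof. exact: (time_changed0 M_gcp D_levy). Qed.

Let S0 w : S 0 w = 0. Proof. by rewrite /S /aggregate_claims N0 big_ord0. Qed.

Let S_path w : right_locally_constant (S ^~ w).
Proof.
move=> t t0; have [[_ M0 _ _ _] _] := M_gcp; have [_ [Mr _]] := M0 w.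
have [_ D0 _ _ _] := D_levy; have [D00 [Dr _]] := D0 w.
have [eta eta0 H] := @right_locally_constant_time_change R (M ^~ w) (D ^~ w) D00
  (fun s t => @D_mono w s t) Dr Mr t t0.
by exists eta => // s ts se; rewrite /S /aggregate_claims /N /time_changed (H s ts se).
Qed.

Let conv_tail n u : R := 1 - Fn n u.

Let mclaim n : measurable_fun setT (claim_sum Zs n).
Proof. by apply: measurable_sum => i; exact: mZ. Qed.

Let mclaim_le n u : measurable [set w | claim_sum Zs n w <= u].
Proof.
rewrite (_ : [set w | _] = claim_sum Zs n @^-1` `]-oo, u]%classic).
  by rewrite -[X in measurable X]setTI; apply: mclaim => //; exact: measurable_itv.
by apply/seteqP; split => w /=; rewrite in_itv.
Qed.

Let FnE n u : P [set w | claim_sum Zs n w <= u] = (Fn n u)%:E.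
Proof. by rewrite /Fn /conv_cdf fineK// fin_num_measure//; exact: mclaim_le. Qed.

Lemma conv_tailE n u : conv_tail n u = fine (P [set w | u < claim_sum Zs n w]).
Proof.
rewrite (_ : [set w | u < _] = ~` [set w | claim_sum Zs n w <= u]); last first.
  by apply/seteqP; split => w /=; rewrite ltNge => /negP.
by rewrite probability_setC// FnE -EFinB.
Qed.

Lemma conv_tail_bound n u : 0 <= conv_tail n u <= 1.
Proof.
rewrite /conv_tail subr_ge0 lerBlDr lerDl -lee_fin -FnE probability_le1//.
by rewrite -lee_fin -FnE measure_ge0.
Qed.

Section grid.
Variable delta : R.
Hypothesis delta_gt0 : 0 < delta.
Let K (j : nat) (w : T) : nat := N (j%:R * delta) w.

Let delta_ge0 : 0 <= delta. Proof. exact: ltW. Qed.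

Let K0 w : K 0%N w = 0%N. Proof. by rewrite /K mul0r N0. Qed.

Let mK j n : measurable (K j @^-1` [set n]).
Proof. exact: (measurable_time_changed M_gcp D_levy D_mono delta_ge0). Qed.

Let K_incr (n : nat -> nat) r :
    P (\bigcap_(j in [set j | (j < r)%N]) [set w | K j.+1 w = (K j w + n j)%N]) =
    (\prod_(0 <= j < r) pmf delta (n j))%:E.
Proof. exact: (time_changed_increments M_gcp D_levy D_mono MD_indep delta_ge0). Qed.

Let KZ_indep (n : nat -> nat) r (A : set T) : sigma_family setT Zs A ->
    P (A `&` \bigcap_(j in [set j | (j < r)%N]) [set w | K j.+1 w = (K j w + n j)%N]) =
    (P A * P (\bigcap_(j in [set j | (j < r)%N]) [set w | K j.+1 w = (K j w + n j)%N]))%E.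
Proof.
move=> AZ; apply: ZN_indep => //; apply: sigma_family_bigcap => j _.
rewrite (_ : [set w | _] = \bigcup_a (K j @^-1` [set a] `&` K j.+1 @^-1` [set (a + n j)%N])).
  have KN i a : sigma_family [set t : R | 0 <= t] N (K i @^-1` [set a]).
    by apply: sub_sigma_algebra; exists (i%:R * delta); split; [exact: mulr_ge0|exists [set a]].
  apply: (@bigcupT_measurable _ (g_sigma_algebraType _)) => a.
  by apply: measurableI; exact: KN.
apply/seteqP; split => w /=; first by move=> h; exists (K j w).
by move=> [a _ [/= -> ->]].
Qed.

Let step := compound_step Zs K.

Lemma claim_step0 w : step 0 w = S delta w.
Proof. by rewrite /step /compound_step {2}/claim_sum K0 big_ord0 subr0 /K mul1r. Qed.

Lemma claim_step_iid : iid_with P step (mixture_law P Zs (pmf delta)).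
Proof. exact: (compound_step_iid Z_iid K0 mK K_incr KZ_indep). Qed.

Lemma claim_step_ge0 j : {ae P, forall w, 0 <= step j w}.
Proof.
have incr : {ae P, forall w, (K j w <= K j.+1 w)%N}.
  have E1 := increasing_ae Z_iid K0 mK K_incr KZ_indep j.+1.
  set E := \bigcap_(_ in _) _ in E1.
  have mE : measurable E.
    apply: bigcap_measurableType => i _.
    rewrite (_ : [set w | _] = \bigcup_a \bigcup_c (K i @^-1` [set a] `&`
        K i.+1 @^-1` [set (a + c)%N])).
      by do 2 (apply: bigcupT_measurable => ?); apply: measurableI; exact: mK.
    apply/seteqP; split => w /=.
      move=> h; exists (K i w) => //; exists (K i.+1 w - K i w)%N => //; split => //=.
      by rewrite subnKC.
    by move=> [a _ [c _ [/= -> ->]]]; rewrite leq_addr.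
  exists (~` E); split; first exact: measurableC.
    by rewrite probability_setC// E1 subee.
  by move=> w /= h Ew; apply: h; exact: (Ew j (ltnSn j)).
have pos : {ae P, forall w i, 0 < Zs i w} by exact: ae_foralln.
apply: filterS2 incr pos => w le_K Zw; rewrite /step /compound_step /claim_sum.
rewrite -(subnKC le_K) big_split_ord/= addrAC subrr add0r.
by apply: sumr_ge0 => i _; exact: ltW.
Qed.

(** Conditioning on the number of claims; the term without claims vanishes. *)
Lemma aggregate_tail_series (u : R) : 0 <= u ->
  (\sum_(n <oo) (pmf delta n.+1 * conv_tail n.+1 u)%:E =
   (fine (P [set w | (u < `|S delta w|)%R]))%:E)%E.
Proof.
move=> u0; pose B := [set x : R | u < `|x|].
have mB : measurable B.
  rewrite (_ : B = Num.norm @^-1` `]u, +oo[%classic).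
    have := @normr_measurable R setT measurableT _ (measurable_itv `]u, +oo[).
    by rewrite setTI.
  by apply/seteqP; split => x; rewrite /B /= in_itv/= andbT.
have lawE n : sum_law P Zs n B = fine (P [set w | u < claim_sum Zs n w]).
  rewrite /sum_law; congr fine; apply: probability_ae_eq.
  - by rewrite -[X in measurable X]setTI; exact: mclaim.
  - exact: tail_event_measurable.
  have : {ae P, forall w i, 0 < Zs i w} by exact: ae_foralln.
  apply: filterS => w h; rewrite /B /= ger0_norm//.
  by apply: sumr_ge0 => i _; exact: ltW.
have law0 : sum_law P Zs 0 B = 0.
  rewrite lawE (_ : [set w | _] = set0) ?measure0//.
  apply/seteqP; split => w //=; rewrite /claim_sum big_ord0 => /(le_lt_trans u0).
  by rewrite ltxx.
have pmf0 n : 0 <= pmf delta n by exact: (subordinated_pmf_ge0 lambda_gt0 D_sub).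
have law_ge0 n : 0 <= sum_law P Zs n B by rewrite /sum_law fine_ge0.
have := @nneseries_behead _ (fun n => pmf delta n * sum_law P Zs n B) _
  (fun n => mulr_ge0 (pmf0 n) (law_ge0 n)) (mixture_lawE Z_iid K0 mK K_incr mB).
rewrite law0 mulr0 subr0 => E; transitivity (mixture_law P Zs (pmf delta) B)%:E.
  by rewrite -E; apply: eq_eseriesr => n _; rewrite conv_tailE lawE.
have [_ /(_ 0%N B mB) <- _] := claim_step_iid.
rewrite fineK; last first.
  rewrite fin_num_measure//; apply: tail_event_measurable; apply: measurableT_comp => //.
  have [ms _ _] := claim_step_iid; rewrite (_ : S delta = step 0)//.
  by apply/funext => w; rewrite claim_step0.
by congr (P _); apply/seteqP; split => w; rewrite /B /= claim_step0.
Qed.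

Lemma aggregate_tail_le (u : R) : 0 <= u -> fine (P [set w | u < `|S delta w|]) / delta <= g.
Proof.
move=> u0; rewrite ler_pdivrMr// -lee_fin -aggregate_tail_series//.
apply: (@le_trans _ _ (1 - expR (- (delta * g)))%:E); last first.
  by rewrite lee_fin lerBlDr -lerBlDl; have := expR_ge1Dx (- (delta * g)); rewrite (mulrC g).
rewrite -(subordinated_pmf_total lambda_gt0 k_gt0 D_sub M_gcp delta_ge0).
apply: lee_nneseries => n _.
  by move=> _; rewrite lee_fin mulr_ge0 ?(subordinated_pmf_ge0 lambda_gt0 D_sub)//;
    have /andP[] := conv_tail_bound n.+1 u.
rewrite lee_fin ler_piMr ?(subordinated_pmf_ge0 lambda_gt0 D_sub)//.
by have /andP[] := conv_tail_bound n.+1 u.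
Qed.
End grid.

(** The threshold passes any given value of the sum. *)
Lemma conv_tail_escape n : conv_tail n m%:R @[m --> \oo] --> 0.
Proof.
pose A m := [set w | m%:R < claim_sum Zs n w].
have mA m : measurable (A m).
  by apply: tail_event_measurable; apply: measurable_sum => i; exact: mZ.
have [w|_] := @eventually_constant_event _ _ _ P set0 A mA.
  near=> m; split => //=; apply/negP; rewrite -leNgt.
  by near: m; exact: nbhs_infty_ger.
rewrite measure0 => /fine_cvg; apply: cvg_trans; apply: near_eq_cvg; near=> m.
rewrite /= -conv_tailE.
Unshelve. all: by end_near. Qed.

Let g_sum : (\sum_(n <oo) (rate n.+1)%:E = g%:E)%E.
Proof. exact: (claim_rate_sum lambda_gt0 k_gt0 c2_ge0 nu_levy D_sub M_gcp). Qed.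

Let rate_ge0 n : 0 <= rate n.+1.
Proof. exact: (claim_rate_ge0 lambda_gt0 k_gt0 c2_ge0 nu_levy). Qed.

Lemma total_claim_rate_ge0 : 0 <= g.
Proof.
by rewrite -lee_fin -g_sum; apply: nneseries_ge0 => n _ _; rewrite lee_fin.
Qed.

(** The threshold may move with the mesh: a fixed one gives the limiting
    tails, and one tending to infinity shows that no claim mass escapes. *)
Let moving_tail_cvg (t v : nat -> R) (b : nat -> R) : (forall m, 0 < t m) ->
  t m @[m --> \oo] --> 0 -> (forall m, 0 <= v m) ->
  (forall n, conv_tail n.+1 (v m) @[m --> \oo] --> b n) ->
  exists2 L : R, (\sum_(n <oo) (rate n.+1 * b n)%:E = L%:E)%E &
    fine (P [set w | v m < `|S (t m) w|]) / t m @[m --> \oo] --> L.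
Proof.
move=> t0 t_cvg v0 vb.
have pmf0 m n : 0 <= pmf (t m) n.
  by apply: (subordinated_pmf_ge0 lambda_gt0 D_sub); exact: ltW.
have it0 m : 0 <= (t m)^-1 by rewrite invr_ge0 ltW.
have [|||||||L [x [LE xE x_cvg]]] := @scheffe_series R
  (fun m n => pmf (t m) n.+1 / t m) (fun n => rate n.+1)
  (fun m => (1 - expR (- (t m * g))) / t m) g 1
  (fun m n => conv_tail n.+1 (v m)) b.
- by move=> m n; rewrite mulr_ge0.
- by move=> n; exact: (claim_rate_cvg lambda_gt0 k_gt0 nu_levy D_sub).
- move=> m; under eq_eseriesr do rewrite mulrC EFinM.
  rewrite nneseriesZl; last by move=> n _; rewrite lee_fin.
  rewrite (subordinated_pmf_total lambda_gt0 k_gt0 D_sub M_gcp (ltW (t0 m))).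
  by rewrite -EFinM mulrC.
- rewrite -[X in _ --> X]opprK; under eq_cvg do rewrite -[X in X / _]opprB mulNr.
  by apply: cvgN; exact: exp_quotient_cvg.
- exact: g_sum.
- by move=> m n; exact: conv_tail_bound.
- exact: vb.
exists L => //; apply: cvg_trans x_cvg; apply: near_eq_cvg; near=> m.
apply: EFin_inj; rewrite -xE.
under eq_eseriesr do rewrite mulrAC (mulrC _ (t m)^-1) EFinM.
rewrite nneseriesZl; last first.
  by move=> n _; rewrite lee_fin mulr_ge0//; have /andP[] := conv_tail_bound n.+1 (v m).
by rewrite aggregate_tail_series// -EFinM mulrC.
Unshelve. all: by end_near. Qed.

Let W := claim_batch_cdf lambda (bernstein c2 nu) Fn.

(** When [g = 0] all rates vanish, so the value given to the normalizing
    factor [g^-1] does not matter. *)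
Lemma limit_tailE (u L : R) :
  (\sum_(n <oo) (rate n.+1 * conv_tail n.+1 u)%:E = L%:E)%E -> g * (1 - W u) = L.
Proof.
move=> LE.
have tail0 n : 0 <= rate n.+1 * conv_tail n.+1 u.
  by rewrite mulr_ge0//; have /andP[] := conv_tail_bound n.+1 u.
have g_cvg := (nneseries_real_cvg g rate_ge0).2 g_sum.
have L_cvg := (nneseries_real_cvg L tail0).2 LE.
have L_le : L <= g.
  rewrite -lee_fin -LE -g_sum; apply: lee_nneseries => n _; first by move=> _; rewrite lee_fin.
  by rewrite lee_fin ler_piMr//; have /andP[] := conv_tail_bound n.+1 u.
have L_ge0 : 0 <= L.
  by rewrite -lee_fin -LE; apply: nneseries_ge0 => n _ _; rewrite lee_fin.
pose V n := \sum_(1 <= i < n) \sum_(a in Omega k i)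
    derive1n (\sum_(i < k) a i)%N (bernstein c2 nu) Lambda
    * (\prod_(i < k) ((- lambda i) ^+ a i / (a i)`!%:R)) * Fn i u.
have VE n : V n.+1 = (\sum_(0 <= i < n) rate i.+1 * conv_tail i.+1 u) - \sum_(0 <= i < n) rate i.+1.
  rewrite /V big_add1 /= -sumrB; apply: eq_bigr => i _.
  rewrite -mulr_suml (_ : \sum_(a in _) _ = - rate i.+1); last by rewrite /rate /claim_rate opprK.
  by rewrite /conv_tail; ring.
have V_cvg : limn V = L - g.
  have V_cvg : V n.+1 @[n --> \oo] --> L - g by under eq_cvg do rewrite VE; exact: cvgB.
  by apply/cvg_lim => //; rewrite -cvg_shiftS.
have [g0|g0] := eqVneq g 0; first by rewrite g0 mul0r; lra.
rewrite /W /claim_batch_cdf -/Lambda -/g -/V V_cvg.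
by field.
Qed.

Lemma aggregate_tail_cvg (t : nat -> R) (u : R) : (forall m, 0 < t m) ->
  t m @[m --> \oo] --> 0 -> 0 <= u ->
  fine (P [set w | u < `|S (t m) w|]) / t m @[m --> \oo] --> g * (1 - W u).
Proof.
move=> t0 t_cvg u0.
have [L LE] := @moving_tail_cvg t (fun=> u) (fun n => conv_tail n.+1 u) t0 t_cvg (fun=> u0)
  (fun n => cvg_cst _).
by rewrite (limit_tailE LE).
Qed.

Lemma aggregate_tail_escape (t : nat -> R) : (forall m, 0 < t m) ->
  t m @[m --> \oo] --> 0 ->
  fine (P [set w | m%:R < `|S (t m) w|]) / t m @[m --> \oo] --> 0.
Proof.
move=> t0 t_cvg.
have [L LE] := @moving_tail_cvg t (fun m => m%:R) (fun=> 0) t0 t_cvg (fun m => ler0n _ m)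
  (fun n => conv_tail_escape n.+1).
suff -> : L = 0 by [].
apply: EFin_inj; rewrite -LE; apply: eseries0 => n _ _; by rewrite mulr0.
Qed.

(** For the aggregate claims the limiting tail of small increments is [g *
    (1 - W u)]. *)
Lemma claims_zero_capital_ruin (c y : R) : 0 < c -> 0 <= y ->
  ('E_P[S 1%R] <= c%:E)%E ->
  let tau w := ereal_inf [set t%:E | t in [set t | 0 < t /\ c * t - S t w < 0]] in
  P [set w | (tau w < +oo)%E /\ `|c * fine (tau w) - S (fine (tau w)) w| <= y] =
  (g / c * \int[lebesgue_measure]_(u in `[0, y]) (1 - W u))%:E.
Proof.
move=> c0 y0 mean tau.
have d1 : 0 < 1 :> R by exact: ltr01.
have S1_ge0 : {ae P, forall w, 0 <= S 1 w}.
  by have := claim_step_ge0 d1 0; apply: filterS => w; rewrite claim_step0.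
have mS1 : measurable_fun setT (S 1).
  have [ms _ _] := claim_step_iid d1; have := ms 0%N.
  by congr measurable_fun; apply/funext => w; rewrite claim_step0.
have S_mean : (\int[P]_w `|S 1 w|%:E <= c%:E)%E.
  apply: le_trans mean; rewrite unlock le_eqVlt; apply/orP; left; apply/eqP.
  apply: ae_eq_integral => //.
  - by apply/measurable_EFinP; exact: measurableT_comp.
  - exact/measurable_EFinP.
  - by apply: filterS S1_ge0 => w h _; rewrite ger0_norm.
have S_iid (delta : R) : 0 < delta -> exists mu,
    iid_with P (fun j w => S (j.+1%:R * delta) w - S (j%:R * delta) w) mu.
  by move=> d0; exists (mixture_law P Zs (pmf delta)); exact: claim_step_iid.
have S_incr (delta : R) j : 0 < delta ->
    {ae P, forall w, 0 <= S (j.+1%:R * delta) w - S (j%:R * delta) w}.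
  by move=> d0; exact: claim_step_ge0.
have [ipsi ->] := zero_capital_ruin S0 S_path S_iid S_incr S_mean c0 y0
  total_claim_rate_ge0 (fun delta u d0 u0 => aggregate_tail_le d0 u0)
  aggregate_tail_cvg aggregate_tail_escape.
congr EFin; have [g0|g0] := eqVneq g 0.
  rewrite {2}g0 !mul0r /Rintegral integral0_eq ?mulr0// => u _.
  by rewrite g0 mul0r.
have mI : measurable (`[0, y] : set (measurableTypeR R)) by exact: measurable_itv.
have iW : lebesgue_measure.-integrable `[0, y] (EFin \o (fun u => 1 - W u)).
  rewrite (_ : EFin \o _ = (fun u => (g^-1)%:E * (EFin \o (fun u => (g * (1 - W u))%R)) u)%E).
    exact: (integrableZl mI _ ipsi).
  by apply/funext => u; rewrite /= -EFinM mulKf.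
by rewrite RintegralZl// mulrA (mulrC c^-1).
Qed.
End claims.

Theorem theorem5p2 (R : realType) (d : measure_display) (T : measurableType d)
    (P : probability T R)
    (k : nat) (lambda : 'I_k -> R)
    (c2 : R) (nu : {measure set (measurableTypeR R) -> \bar R})
    (M : R -> T -> nat) (D : R -> T -> R)
    (c : R) (Z : nat -> {RV P >-> R})
    (F : probability (measurableTypeR R) R)
    (k_gt0 : (0 < k)%N) (lambda_gt0 : forall i, 0 < lambda i)
    (c2_ge0 : 0 <= c2) (nu_levy : levy_measure nu)
    (M_gcp : counting_process P lambda M)
    (D_sub : subordinator P (bernstein c2 nu) D)
    (MD_indep : independent_sigma P
       (sigma_family [set t | 0 <= t] M) (sigma_family [set t | 0 <= t] D))
    (c_gt0 : 0 < c)
    (Z_gt0 : forall j, {ae P, forall w, 0 < Z j w})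
    (Z_indep : mutually_independent P (fun j => Z j : T -> R))
    (Z_law : forall j (B : set R), measurable B -> distribution P (Z j) B = F B)
    (ZN_indep : independent_sigma P
       (sigma_family setT (fun j => Z j : T -> R))
       (sigma_family [set t | 0 <= t] (time_changed M D)))
    (* net profit condition *)
    (net_profit :
       ('E_P[aggregate_claims (time_changed M D) (fun j => Z j : T -> R) 1%R]
          <= c%:E)%E)
    (y : R) (y_ge0 : 0 <= y) :
  let f := bernstein c2 nu in
  let Lambda := \sum_(i < k) lambda i in
  let W := claim_batch_cdf lambda f (conv_cdf P (fun j => Z j : T -> R)) in
  let X := risk_process c (time_changed M D) (fun j => Z j : T -> R) in
  ruin_deficit_prob P X 0 y =
  (f Lambda / c * \int[lebesgue_measure]_(u in `[0, y]) (1 - W u))%:E.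
Proof.
move=> f Lambda W X.
have E : surplus X 0 = fun t w =>
    c * t - aggregate_claims (time_changed M D) (fun j => Z j : T -> R) t w.
  by apply/funext => t; apply/funext => w; rewrite /surplus add0r.
rewrite /ruin_deficit_prob /deficit /ruin_time E.
exact: (claims_zero_capital_ruin k_gt0 lambda_gt0 c2_ge0 nu_levy M_gcp D_sub
  MD_indep Z_gt0 Z_indep Z_law ZN_indep c_gt0 y_ge0 net_profit).
Qed.
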